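(* Let $k\in\{2,3\}$. If $\Omega$ is contractible, then the sequence $$0\longrightarrow\mathbb R\xrightarrow{\ \subset\ }\Sigma_h^{k+1}\xrightarrow{\ \mathrm{curl}\ }V_h^k\xrightarrow{\ \mathrm{div}\ }W_h^{k-1}\longrightarrow0$$ is a complex and is exact.
   Context: $\Omega\subset\mathbb R^2$ is a Lipschitz polygonal domain. $\mathcal Q_h$ is a partition (conforming mesh) of $\Omega$ into convex quadrilaterals; each $Q\in\mathcal Q_h$ is split by its two diagonals into four triangles, and $\mathcal T_h$ is the resulting triangulation of $\Omega$ (criss-cross mesh). $P_j(T)$ denotes polynomials of degree at most $j$ on $T$. For a scalar $u$, $\mathrm{curl}\,u=(\partial_yu,-\partial_xu)$. The global spaces, obtained by gluing the local spaces on the quadrilaterals through their shared degrees of freedom, are $\Sigma_h^{k+1}=\{u\in H^2(\Omega):u|_T\in P_{k+1}(T)\ \forall T\in\mathcal T_h\}$, $V_h^k=\{\boldsymbol u\in[H^1(\Omega)]^2:\boldsymbol u|_T\in[P_k(T)]^2\ \forall T\in\mathcal T_h\}$, $W_h^{k-1}=\mathrm{div}\,V_h^k$. The map $\mathbb R\to\Sigma_h^{k+1}$ is the inclusion of constants. *)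

(* Defs.v *)
From HB Require Import structures.
From mathcomp Require Import all_boot all_order all_algebra.
From mathcomp Require Import all_classical all_reals all_analysis.

Set Implicit Arguments.
Unset Strict Implicit.
Unset Printing Implicit Defensive.
Import Order.TTheory GRing.Theory Num.Theory.
Import numFieldNormedType.Exports.
Local Open Scope classical_set_scope.
Local Open Scope ring_scope.

(* The plane is R * R. Elements of L^2(Omega), H^m(Omega), ... are represented
   by functions on the whole plane, of which only the values on Omega matter,
   and equality in these spaces is equality almost everywhere in Omega. *)

Section Domains.
Context {R : realType}.
Implicit Types (D : set (R * R)) (s : seq (R * R)).

Definition hull s : set (R * R) :=
  [set z | exists c : nat -> R,
    [/\ forall i, 0 <= c i,
        \sum_(i < size s) c i = 1 &
        z = \sum_(i < size s) c i *: nth 0 s i]].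

Definition bdry D : set (R * R) := closure D `\` interior D.

Definition polygonal D :=
  exists e : seq ((R * R) * (R * R)),
    bdry D = \bigcup_(ab in [set` e]) hull [:: ab.1; ab.2].

(* In coordinates centred at x and rotated by the angle with cosine c and sine
   s, the set D is near x the part of the plane above a Lipschitz graph. *)
Definition lipschitz_boundary D :=
  forall x, bdry D x -> exists (c s : R) (g : R -> R),
    [/\ c ^+ 2 + s ^+ 2 = 1,
        [lipschitz g t | t in setT] &
        \forall z \near x,
          D z <-> g (c * (z.1 - x.1) + s * (z.2 - x.2)) <
                  c * (z.2 - x.2) - s * (z.1 - x.1)].

Definition lipschitz_polygonal_domain D :=
  [/\ D !=set0, open D, connected D, bounded_set D
    & polygonal D /\ lipschitz_boundary D].

Definition contractible D :=
  exists2 x0, D x0 & exists H : (R * R) * R -> R * R,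
    [/\ {within D `*` `[0, 1], continuous H},
        forall x t, D x -> t \in `[0, 1] -> D (H (x, t)),
        forall x, D x -> H (x, 0) = x &
        forall x, D x -> H (x, 1) = x0].

End Domains.

Section Meshes.
Context {R : realType}.
Notation quad := (4.-tuple (R * R)).
Implicit Types (q : quad) (Qh : seq quad) (D T : set (R * R)).

(* twice the signed area of the triangle abc *)
Definition orient (a b c : R * R) : R :=
  (b.1 - a.1) * (c.2 - a.2) - (b.2 - a.2) * (c.1 - a.1).

(* Vertices are listed counterclockwise: each side leaves the other two
   vertices strictly on its left. *)
Definition convex_quad q :=
  forall i j : 'I_4, j != i -> j != ordS i ->
    0 < orient (tnth q i) (tnth q (ordS i)) (tnth q j).

Definition side q (i : 'I_4) : set (R * R) :=
  hull [:: tnth q i; tnth q (ordS i)].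

Definition quad_mesh D Qh :=
  [/\ forall q, q \in Qh -> convex_quad q,
      closure D = \bigcup_(q in [set` Qh]) hull q &
      forall q q', q \in Qh -> q' \in Qh -> q != q' ->
        [\/ hull q `&` hull q' = set0,
            exists i j, hull q `&` hull q' = [set tnth q i] /\
                        tnth q i = tnth q' j |
            exists i j, hull q `&` hull q' = side q i /\
                        side q i = side q' j]].

Definition crisscross Qh : set (set (R * R)) :=
  [set T | exists q i m,
    [/\ q \in Qh,
        hull [:: tnth q 0; tnth q 2] m,
        hull [:: tnth q 1; tnth q 3] m &
        T = hull [:: tnth q i; tnth q (ordS i); m]]].

End Meshes.

Section Sobolev.
Context {R : realType}.
Notation plane := (measurableTypeR R * measurableTypeR R)%type.
Implicit Types (D : set (R * R)) (u g phi : R * R -> R).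

Definition area : {measure set plane -> \bar R} :=
  (lebesgue_measure \x lebesgue_measure)%E.

Definition eq_on {V : Type} D (f g : R * R -> V) : Prop :=
  f = g %[ae area in D].

Definition pdx phi : R * R -> R := fun z => derive1 (fun t => phi (t, z.2)) z.1.
Definition pdy phi : R * R -> R := fun z => derive1 (fun t => phi (z.1, t)) z.2.

Fixpoint Cn (n : nat) phi : Prop :=
  continuous phi /\
  if n is n'.+1 then
    [/\ forall z : R * R, derivable (fun t => phi (t, z.2)) z.1 1,
        forall z : R * R, derivable (fun t => phi (z.1, t)) z.2 1,
        Cn n' (pdx phi) & Cn n' (pdy phi)]
  else True.

Definition supp phi : set (R * R) := closure [set z | phi z != 0].

Definition test_function D phi :=
  [/\ forall n, Cn n phi, compact (supp phi) & supp phi `<=` D].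

Definition L2 D u : Prop := (u \_ D : plane -> R) \in Lfun area 2%:E.

(* g is the weak derivative of u on D for the multi-index (a, b) *)
Definition weak_deriv D (a b : nat) u g :=
  forall phi, test_function D phi ->
    (\int[area]_(z in D) (u z * iter a pdx (iter b pdy phi) z)%:E =
     ((-1) ^+ (a + b))%:E * \int[area]_(z in D) (g z * phi z)%:E)%E.

Definition Hm D (m : nat) u :=
  L2 D u /\ forall a b, (a + b <= m)%N ->
    exists2 g, L2 D g & weak_deriv D a b u g.

(* A representative of the weak derivative; arbitrary when there is none in
   L^2(D). *)
Definition wD D (a b : nat) u : R * R -> R :=
  get [set g | L2 D g /\ weak_deriv D a b u g].

Definition curl D u : R * R -> R * R := fun z => (wD D 0 1 u z, - wD D 1 0 u z).

Definition div D (v : R * R -> R * R) : R * R -> R :=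
  fun z => wD D 1 0 (fst \o v) z + wD D 0 1 (snd \o v) z.

End Sobolev.

Section FiniteElements.
Context {R : realType}.
Notation quad := (4.-tuple (R * R)).
Implicit Types (D T : set (R * R)) (Qh : seq quad).

Definition Pdeg (j : nat) (p : R * R -> R) :=
  exists c : nat -> nat -> R, forall z,
    p z = \sum_(a < j.+1) \sum_(b < (j - a).+1) c a b * z.1 ^+ a * z.2 ^+ b.

Definition poly_on T j (u : R * R -> R) := exists2 p, Pdeg j p & eq_on T u p.

Definition Sigma_h D Qh (j : nat) : set (R * R -> R) :=
  [set u | Hm D 2 u /\ forall T, crisscross Qh T -> poly_on T j u].

Definition V_h D Qh (k : nat) : set (R * R -> R * R) :=
  [set v | [/\ Hm D 1 (fst \o v), Hm D 1 (snd \o v) &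
      forall T, crisscross Qh T ->
        poly_on T k (fst \o v) /\ poly_on T k (snd \o v)]].

Definition W_h D Qh (k : nat) : set (R * R -> R) :=
  [set w | L2 D w /\ exists2 v, V_h D Qh k v & eq_on D w (div D v)].

End FiniteElements.

Section Complexes.
Context {R : realType}.
Implicit Type D : set (R * R).

Definition subspace {E : lmodType R} (S : set (R * R -> E)) :=
  S (fun=> 0) /\
  forall (a : R) f g, S f -> S g -> S (fun z => a *: f z + g z).

(* d induces a linear map from S to S' modulo null sets of D *)
Definition linear_map D {E F : lmodType R} (S : set (R * R -> E))
    (S' : set (R * R -> F)) (d : (R * R -> E) -> (R * R -> F)) :=
  [/\ forall f, S f -> S' (d f),
      forall f g, S f -> S g -> eq_on D f g -> eq_on D (d f) (d g) &
      forall (a : R) f g, S f -> S g ->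
        eq_on D (d (fun z => a *: f z + g z)) (fun z => a *: d f z + d g z)].

(* The sequence 0 -> R -> S1 -> S2 -> S3 -> 0, where R -> S1 is the inclusion
   of the constants and the next two maps are d1 and d2. *)
Definition is_complex D (S1 : set (R * R -> R))
    (d1 : (R * R -> R) -> (R * R -> R * R)) (S2 : set (R * R -> R * R))
    (d2 : (R * R -> R * R) -> (R * R -> R)) (S3 : set (R * R -> R)) :=
  [/\ [/\ subspace S1, subspace S2 & subspace S3],
      [/\ forall c, S1 (fun=> c), linear_map D S1 S2 d1 & linear_map D S2 S3 d2],
      forall c, eq_on D (d1 (fun=> c)) (fun=> 0) &
      forall f, S1 f -> eq_on D (d2 (d1 f)) (fun=> 0)].

Definition is_exact D (S1 : set (R * R -> R))
    (d1 : (R * R -> R) -> (R * R -> R * R)) (S2 : set (R * R -> R * R))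
    (d2 : (R * R -> R * R) -> (R * R -> R)) (S3 : set (R * R -> R)) :=
  [/\ forall c : R, eq_on D (fun=> c) (fun=> 0) -> c = 0,
      forall f, S1 f -> eq_on D (d1 f) (fun=> 0) ->
        exists c, eq_on D f (fun=> c),
      forall g, S2 g -> eq_on D (d2 g) (fun=> 0) ->
        exists2 f, S1 f & eq_on D g (d1 f) &
      forall h, S3 h -> exists2 g, S2 g & eq_on D h (d2 g)].

End Complexes.

(* Main.v *)
(* Away from its last term, exactness amounts to the statement that a weakly
   divergence-free v in V_h is a curl. On a rectangle, integrating v_1 in y and
   -v_2 in x gives two functions whose difference has zero mixed derivative,
   hence splits as g(x) + k(y); this yields a potential f_p on a small square
   around each point p. The differences f_p - f_q are constants, which form a
   cocycle, and a contraction of Omega shows that this cocycle is a coboundary: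
   its value at x is the sum of the constants along a fine subdivision of the
   path that contracts x. After correction by constants the f_p glue to F with
   curl F = v. On each triangle v is a divergence-free pair of polynomials of
   degree k, so F is a polynomial of degree k + 1 there; in particular F is
   bounded, as Omega is covered by finitely many triangles. The Lipschitz
   condition ensures that the open triangles are contained in Omega. *)

Require Import Defs.
From mathcomp Require Import all_boot all_order all_algebra.
From mathcomp Require Import all_classical all_reals all_analysis.
From mathcomp Require Import measurable_realfun lra.
Set Implicit Arguments.
Unset Strict Implicit.
Unset Printing Implicit Defensive.
Import Order.TTheory GRing.Theory Num.Theory.
Import numFieldNormedType.Exports.
Local Open Scope classical_set_scope.
Local Open Scope ring_scope.

(** * Smooth functions on the line *)

Section Smooth1.
Context {R : realType}.
Implicit Types (f g : R -> R) (n : nat).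

(** Nothing is mollified. Products f(x)g(y) of one-variable bumps suffice as test functions: their
    limits give the integrals over rectangles, and rectangles generate the measurable sets. On such
    products weak differentiation reduces to one variable, where f minus the integral of f times a
    fixed unit bump has integral zero, hence is the derivative of a bump. This is the source of the
    constants and of the functions g(x) and k(y). Working modulo null sets shapes the gluing:
    constants are compared only on nonempty open intersections of squares, and the glued function is
    assembled from countably many squares. Being piecewise polynomial, v is essentially bounded; it
    is replaced by bounded measurable functions of bounded support on the whole plane, so that
    primitives along full lines exist and Fubini applies. The potential F is controlled only locally
    until its polynomial form bounds it; a partition of unity then makes its weak derivatives
    global. These are, up to sign, the components of v, which lie in H^1, so F lies in H^2.
    Exactness at the last term is built into the definition of [W_h]. *)

Fixpoint Ck n f : Prop :=
  if n is n'.+1 then (forall x : R, derivable f x 1) /\ Ck n' (derive1 f)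
  else continuous f.

Definition smooth f := forall n, Ck n f.

Lemma derivable_continuous f : (forall x : R, derivable f x 1) -> continuous f.
Proof.
by move=> df x; apply: differentiable_continuous; apply/derivable1_diffP.
Qed.

Lemma CkW n f : Ck n.+1 f -> Ck n f.
Proof.
elim: n f => [|n IH] f [df H]; first exact: derivable_continuous df.
by split; [exact: df|exact: IH H].
Qed.

Lemma Ck_continuous n f : Ck n f -> continuous f.
Proof. by case: n => [//|n] [/derivable_continuous]. Qed.

(** Coinduction for smoothness: it suffices to name a class stable under differentiation that
    contains the function, such as the polynomials or the functions [flat p]. *)
Lemma smooth_ind (P : (R -> R) -> Prop) :
  (forall f, P f -> (forall x : R, derivable f x 1) /\ P (derive1 f)) ->
  forall f, P f -> smooth f.
Proof.
move=> HP f Pf n; elim: n f Pf => [|n IH] f Pf /=.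
  by apply: derivable_continuous; case: (HP _ Pf).
by case: (HP _ Pf) => df Pf'; split=> //; apply: IH.
Qed.

Lemma smooth_derivable f x : smooth f -> derivable f x 1.
Proof. by move=> /(_ 1%N) []. Qed.

Lemma smooth_derive f : smooth f -> smooth (derive1 f).
Proof. by move=> sf n; case: (sf n.+1). Qed.

Lemma smooth_continuous f : smooth f -> continuous f.
Proof. exact: (fun sf => sf 0%N). Qed.

Lemma derive1_ext f (x df : R) : is_derive x 1 f df -> (derive1 f) x = df.
Proof. by move=> h; rewrite derive1E derive_val. Qed.

Lemma CkD n f g : Ck n f -> Ck n g -> Ck n (fun x => f x + g x).
Proof.
elim: n f g => [|n IH] f g /=; first by move=> cf cg x; apply: cvgD; [exact: cf|exact: cg].
move=> [df f'] [dg g']; split; first by move=> x; apply: derivableD.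
have -> : derive1 (fun x => f x + g x) = (fun x => (derive1 f) x + (derive1 g) x).
  by apply/funext => x; rewrite !derive1E deriveD.
exact: IH.
Qed.

Lemma CkM n f g : Ck n f -> Ck n g -> Ck n (fun x => f x * g x).
Proof.
elim: n f g => [|n IH] f g; first by move=> cf cg x; apply: cvgM; [exact: cf|exact: cg].
move=> Cf Cg; have := CkW Cf; have := CkW Cg; move: Cf Cg.
move=> [df f'] [dg g'] g0 f0; split; first by move=> x; apply: derivableM.
have -> : derive1 (fun x => f x * g x) = (fun x => f x * (derive1 g) x + g x * (derive1 f) x).
  by apply/funext => x; rewrite !derive1E deriveM.
by apply: CkD; apply: IH.
Qed.

Lemma smooth_cst (c : R) : smooth (fun=> c).
Proof.
apply: (@smooth_ind (fun f => exists c, f = fun=> c)); last by exists c.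
move=> _ [d ->]; split; first by move=> x; exact: derivable_cst.
by exists 0; apply/funext => x; rewrite derive1_cst.
Qed.

Lemma smoothD f g : smooth f -> smooth g -> smooth (fun x => f x + g x).
Proof. by move=> sf sg n; apply: CkD. Qed.

Lemma smoothM f g : smooth f -> smooth g -> smooth (fun x => f x * g x).
Proof. by move=> sf sg n; apply: CkM. Qed.

Lemma smoothZ (c : R) f : smooth f -> smooth (fun x => c * f x).
Proof. by move=> sf; apply: smoothM => //; exact: smooth_cst. Qed.

Lemma smoothB f g : smooth f -> smooth g -> smooth (fun x => f x - g x).
Proof.
move=> sf sg; have -> : (fun x => f x - g x) = (fun x => f x + (-1) * g x).
  by apply/funext => x; rewrite mulN1r.
by apply: smoothD => //; apply: smoothZ.
Qed.

Lemma smooth_affine f (c d : R) : smooth f -> smooth (fun x => f (c * x + d)).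
Proof.
move=> sf; apply: (@smooth_ind (fun h => exists a g, smooth g /\
    h = fun x => a * g (c * x + d))); last first.
  by exists 1, f; split=> //; apply/funext => x; rewrite mul1r.
move=> _ [a [g [sg ->]]].
have D (x : R) : is_derive x 1 (fun x : R => a * g (c * x + d)) (a * ((derive1 g) (c * x + d) * c)).
  have dg : is_derive (c * x + d) 1 g ((derive1 g) (c * x + d)).
    by rewrite derive1E; apply: derivableP; apply: smooth_derivable.
  have da : is_derive x 1 (fun x : R => c * x + d) c.
    by apply: is_derive_eq; rewrite addr0 /GRing.scale /= mulr1.
  have dc := @is_derive1_comp _ g (fun x => c * x + d) x _ _ dg da.
  exact: (@is_deriveZ _ _ _ (fun x => g (c * x + d)) a x 1 _ dc).
split; first by move=> x; have := D x; case.
exists (a * c), (derive1 g); split; first exact: smooth_derive.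
by apply/funext => x; rewrite (derive1_ext (D x)); lra.
Qed.

Lemma smooth_exp n : smooth (fun x : R => x ^+ n).
Proof.
apply: (@smooth_ind (fun f => exists p : {poly R}, f = horner p)); last first.
  by exists ('X^n)%R; apply/funext => x; rewrite hornerXn.
move=> _ [p ->]; split; first by move=> x; exact: derivable_horner.
by exists p^`()%R; apply/funext => x; rewrite derivE.
Qed.

(* The polynomial p makes this class of functions closed under differentiation. *)
Definition flat (p : {poly R}) (x : R) : R :=
  if 0 < x then p.[x^-1] * expR (- x^-1) else 0.

Lemma poly_expRN_bounded (p : {poly R}) :
  exists2 K, 0 <= K & forall t, 0 <= t -> `|p.[t] * expR (- t)| <= K.
Proof.
(* For t >= 0 one has t^i / i! <= exp t, so the monomial of degree i contributes at most |p_i|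
   i!. *)
exists (\sum_(i < size p) `|p`_i| * i`!%:R).
  by apply: sumr_ge0 => i _; rewrite mulr_ge0.
move=> t t0; rewrite horner_coef mulr_suml.
apply: (le_trans (ler_norm_sum _ _ _)); apply: ler_sum => i _.
rewrite -mulrA normrM ler_wpM2l// ger0_norm; last first.
  by rewrite mulr_ge0 ?exprn_ge0 ?expR_ge0.
rewrite expRN ler_pdivrMr ?expR_gt0//.
case: i => -[|i] /= _; first by rewrite expr0 mul1r -expR0 ler_expR.
have := expR_ge1Dxn i t0; set F := _`!%:R => H.
have F0 : 0 < F by rewrite ltr0n fact_gt0.
rewrite mulrC -ler_pdivrMr//; lra.
Qed.

(** The exponential absorbs every power of 1/x; bounding it against ['X^2 * p] instead of [p] gains
    the factor x^2, which is what makes the derivative at the origin vanish. *)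
Lemma flat_quadratic (p : {poly R}) :
  exists2 K, 0 <= K & forall x, `|flat p x| <= K * x ^+ 2.
Proof.
have [K K0 HK] := poly_expRN_bounded ('X^2 * p).
exists K => // x; rewrite /flat; case: ifPn => x0; last first.
  by rewrite normr0 mulr_ge0 ?sqr_ge0.
have := HK x^-1 (ltW _); rewrite invr_gt0 => /(_ x0).
rewrite hornerM hornerXn -mulrA normrM [`|x^-1 ^+ 2|]ger0_norm ?sqr_ge0//.
by rewrite exprVn mulrC ler_pdivrMr// exprn_gt0.
Qed.

(** For x > 0 the chain rule gives (p - p')(1/x) x^-2 exp(-1/x), and x^-2 is the value of ['X^2] at
    1/x. At 0 the difference quotient is at most K |h|. *)
Lemma is_derive_flat (p : {poly R}) (x : R) :
  is_derive x 1 (flat p) (flat ('X^2 * (p - p^`())) x).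
Proof.
have [x0|x0|<-] := ltgtP 0 x.
- have ne : x != 0 by rewrite gt_eqF.
  apply: (@near_eq_is_derive R R R (fun x => p.[x^-1] * expR (- x^-1))).
  + near=> y; rewrite /flat ifT//.
    by near: y; exact: lt_nbhsr.
  + have dV : is_derive x 1 (fun y : R => y^-1) (- x ^- 2).
      have := @is_deriveV _ id x 1 1 ne (is_derive_id _ _).
      by move=> h; apply: (is_derive_eq h); rewrite /GRing.scale /= mulr1.
    have dp := @is_derive1_comp _ (horner p) (fun y => y^-1) x _ _ (is_derive_poly p _) dV.
    have dN : is_derive x 1 (fun y : R => - y^-1) (x ^- 2).
      by apply: is_derive_eq; rewrite opprK.
    have de := @is_derive1_comp _ expR (fun y => - y^-1) x _ _ (is_derive_expR _) dN.
    have h := is_deriveM dp de; apply: (is_derive_eq h).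
    rewrite /flat x0 /GRing.scale /= !hornerE /= -exprVn; lra.
- have -> : flat ('X^2 * (p - p^`())) x = 0 by rewrite /flat ltNge (ltW x0).
  apply: (@near_eq_is_derive R R R (cst 0)).
  near=> y; rewrite /flat ifF//; apply/negbTE; rewrite -leNgt ltW//.
    by near: y; exact: lt_nbhsl.
have -> : flat ('X^2 * (p - p^`())) 0 = 0 by rewrite /flat ltxx.
have [K K0 HK] := flat_quadratic p.
have f0 : flat p 0 = 0 by rewrite /flat ltxx.
have cv : h^-1 *: (flat p (h *: 1 + 0) - flat p 0) @[h --> 0^'] --> (0 : R).
  apply/cvgr0Pnorm_le => e e0.
  near=> h.
  have h0 : h != 0 by near: h; exact: nbhs_dnbhs_neq.
  rewrite f0 subr0 addr0 /GRing.scale /= mulr1 normrM normfV.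
  rewrite mulrC ler_pdivrMr ?normr_gt0//.
  apply: (le_trans (HK h)).
  rewrite -real_normK ?num_real// expr2 mulrA ler_wpM2r//.
  (* The denominator is [K + 1] because [K] may be zero. *)
  have hl : `|h| <= e / (K + 1).
    near: h; apply: dnbhs0_le; by rewrite divr_gt0// ltr_wpDl.
  apply: (le_trans (ler_wpM2l K0 hl)).
  rewrite mulrCA ger_pMr// ler_pdivrMr; lra.
apply: DeriveDef; first by apply/cvg_ex; exists 0.
exact: cvg_lim cv.
Unshelve. all: by end_near. Qed.

Lemma smooth_flat (p : {poly R}) : smooth (flat p).
Proof.
apply: (@smooth_ind (fun f => exists p, f = flat p)); last by exists p.
move=> _ [q ->]; split; first by move=> x; have := is_derive_flat q x; case.
exists ('X^2 * (q - q^`())); apply/funext => x.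
exact: (derive1_ext (is_derive_flat q x)).
Qed.

End Smooth1.

(** * Compactly supported smooth functions of one variable *)

Section Bumps.
Context {R : realType}.
Implicit Types (f g : R -> R) (n : nat).

Definition vanishes_outside (a b : R) f := forall x : R, ~~ (a <= x <= b) -> f x = 0.

(** Compact support inside the open interval, expressed by endpoints so that real arithmetic can
    handle it. If b' < a' the function is zero. *)
Definition bump_in (a b : R) f :=
  smooth f /\ exists a' b', [/\ a < a', b' < b & vanishes_outside a' b' f].

Lemma vanishes_outsideW (a b a' b' : R) f : a' <= a -> b <= b' ->
  vanishes_outside a b f -> vanishes_outside a' b' f.
Proof.
move=> aa bb vf x /negP xab; apply: vf; apply/negP => /andP[ax xb]; apply: xab.
by rewrite (le_trans aa ax) (le_trans xb bb).
Qed.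

Lemma bump_common (a b : R) f g : bump_in a b f -> bump_in a b g ->
  exists a' b', [/\ a < a', b' < b, vanishes_outside a' b' f & vanishes_outside a' b' g].
Proof.
move=> [_ [a1 [b1 [h1 h2 h3]]]] [_ [a2 [b2 [k1 k2 k3]]]].
exists (Num.min a1 a2), (Num.max b1 b2); split.
- by rewrite lt_min h1.
- by rewrite gt_max h2.
- by apply: vanishes_outsideW h3; rewrite ?ge_min ?le_max lexx.
- by apply: vanishes_outsideW k3; rewrite ?ge_min ?le_max lexx orbT.
Qed.

Lemma bump_comb (a b c : R) f g : bump_in a b f -> bump_in a b g ->
  bump_in a b (fun x => f x + c * g x).
Proof.
move=> bf bg; have [a' [b' [h1 h2 h3 h4]]] := bump_common bf bg.
case: bf => sf _; case: bg => sg _.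
split; first by apply: smoothD => //; exact: smoothZ.
by exists a', b'; split=> // x hx; rewrite h3// h4// mulr0 addr0.
Qed.

Lemma derive1_vanishes (a b : R) f : vanishes_outside a b f -> vanishes_outside a b (derive1 f).
Proof.
move=> vf x /negP hx.
apply: (@derive1_ext _ f x 0); apply: (@near_eq_is_derive R R R (cst 0)).
have [xa|xb] : x < a \/ b < x.
- case: (ltP x a) => xa; first by left.
  by right; rewrite ltNge; apply/negP => xb; apply: hx; rewrite xa xb.
- have : \forall y \near x, y < a by apply: lt_nbhsl.
  by apply: filterS => y ya; rewrite vf// negb_and -ltNge ya.
have : \forall y \near x, b < y by apply: lt_nbhsr.
by apply: filterS => y ya; rewrite vf// negb_and orbC -ltNge ya.
Qed.

Lemma bump_derive (a b : R) f : bump_in a b f -> bump_in a b (derive1 f).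
Proof.
move=> [sf [a' [b' [h1 h2 h3]]]]; split; first exact: smooth_derive.
by exists a', b'; split=> //; exact: derive1_vanishes.
Qed.

Lemma bump_mono (a b a' b' : R) f : a' <= a -> b <= b' -> bump_in a b f -> bump_in a' b' f.
Proof.
move=> aa bb [sf [c [d [ac db vf]]]]; split=> //; exists c, d; split=> //.
  exact: le_lt_trans ac.
exact: lt_le_trans bb.
Qed.

(* Smooth functions increasing to the indicator of ]a, b[, each supported in a
   compact part of it. *)
Definition cutoff (a b : R) n (x : R) : R :=
  flat 1 (n.+1%:R * x + (- (n.+1%:R * a) - 1)) *
  flat 1 (- n.+1%:R * x + (n.+1%:R * b - 1)).

Lemma flat1_ge0 x : 0 <= @flat R 1 x.
Proof. by rewrite /flat; case: ifP => // _; rewrite hornerC mul1r expR_ge0. Qed.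

Lemma flat1_le1 x : @flat R 1 x <= 1.
Proof.
rewrite /flat; case: ifPn => // x0; rewrite hornerC mul1r -expR0 ler_expR.
by rewrite oppr_le0 invr_ge0 ltW.
Qed.

Lemma flat1_le0 x : x <= 0 -> @flat R 1 x = 0.
Proof. by rewrite /flat ltNge => ->. Qed.

Lemma flat1_ge x : 0 < x -> 1 - x^-1 <= @flat R 1 x.
Proof.
by move=> x0; rewrite /flat x0 hornerC mul1r; exact: expR_ge1Dx.
Qed.

Lemma cutoff_ge0 a b n x : 0 <= cutoff a b n x.
Proof. by rewrite mulr_ge0 ?flat1_ge0. Qed.

Lemma cutoff_le1 a b n x : cutoff a b n x <= 1.
Proof. by rewrite mulr_ile1 ?flat1_ge0 ?flat1_le1. Qed.

Lemma bump_cutoff a b n : bump_in a b (cutoff a b n).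
Proof.
split; first by apply: smoothM; apply: smooth_affine; exact: smooth_flat.
have n0 : 0 < n.+1%:R :> R by rewrite ltr0n.
exists (a + n.+1%:R^-1), (b - n.+1%:R^-1); split.
- by rewrite ltrDl invr_gt0.
- by rewrite ltrBlDr ltrDl invr_gt0.
move=> x; rewrite negb_and -!ltNge => /orP[xa|xb]; rewrite /cutoff.
  rewrite flat1_le0 ?mul0r//.
  have : n.+1%:R * x < n.+1%:R * (a + n.+1%:R^-1) by rewrite ltr_pM2l.
  by rewrite mulrDr divff ?gt_eqF//; lra.
rewrite [X in _ * X]flat1_le0 ?mulr0//.
have : n.+1%:R * (b - n.+1%:R^-1) < n.+1%:R * x by rewrite ltr_pM2l.
by rewrite mulrBr divff ?gt_eqF//; lra.
Qed.

Lemma flat1_cvg (c : R) : 0 < c -> flat 1 (n.+1%:R * c - 1) @[n --> \oo] --> (1 : R).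
Proof.
move=> c0; apply/cvgrPdist_le => e e0; near=> n.
(* From this rank on the argument of [flat] is at least 1/e, and [flat1_ge] puts the value within
   [e] of 1. *)
have nc : (e^-1 + 1) / c <= n%:R by near: n; exact: nbhs_infty_ger.
have nc' : e^-1 <= n.+1%:R * c - 1.
  have : (e^-1 + 1) / c <= n.+1%:R by apply: (le_trans nc); rewrite ler_nat.
  by rewrite ler_pdivrMr//; lra.
have p : 0 < n.+1%:R * c - 1 by apply: lt_le_trans nc'; rewrite invr_gt0.
rewrite ger0_norm ?subr_ge0 ?flat1_le1//.
have := flat1_ge p.
have : (n.+1%:R * c - 1)^-1 <= e by rewrite invf_ple ?posrE// invr_gt0.
lra.
Unshelve. all: by end_near. Qed.

Lemma cutoff_cvg (a b x : R) :
  cutoff a b n x @[n --> \oo] --> (((a < x < b)%R)%:R : R).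
Proof.
have [ax|xa] := ltP a x; last first.
  rewrite /=; under eq_fun => n.
    rewrite /cutoff flat1_le0 ?mul0r; last first.
      have : n.+1%:R * x <= n.+1%:R * a by rewrite ler_pM2l// ltr0n.
      lra.
    over.
  exact: cvg_cst.
have [xb|bx] := ltP x b; last first.
  rewrite /=; under eq_fun => n.
    rewrite /cutoff [X in _ * X]flat1_le0 ?mulr0; last first.
      have : n.+1%:R * b <= n.+1%:R * x by rewrite ler_pM2l// ltr0n.
      lra.
    over.
  exact: cvg_cst.
rewrite /= -[1%:R]mulr1; apply: cvgM.
  have := @flat1_cvg (x - a); rewrite subr_gt0 => /(_ ax).
  by under eq_fun do rewrite mulrBr -addrA.
have := @flat1_cvg (b - x); rewrite subr_gt0 => /(_ xb).
have E n : n.+1%:R * (b - x) - 1 = - n.+1%:R * x + (n.+1%:R * b - 1) by lra.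
by under eq_fun do rewrite E.
Qed.

End Bumps.

(** * Integrals and primitives on the line *)

Section Integrals1.
Context {R : realType}.
Implicit Types (f g : R -> R) (n : nat).
Notation mu := (@lebesgue_measure R).

Lemma vanishes_outside_integrable (a b : R) f : continuous f -> vanishes_outside a b f ->
  mu.-integrable setT (EFin \o f).
Proof.
move=> cf vf; have -> : EFin \o f = (EFin \o f) \_ `[a, b].
  apply/funext => x; rewrite /patch; case: ifPn => // /negP xab /=.
  by rewrite vf//; apply/negP => h; apply: xab; rewrite inE /= in_itv /=.
apply: (@integrable_mkcond _ _ _ mu `[a, b] (EFin \o f) (measurable_itv _)).1.
apply: continuous_compact_integrable; first exact: segment_compact.
exact: continuous_subspaceT.
Qed.

Lemma bump_integrable (a b : R) f : bump_in a b f -> mu.-integrable setT (EFin \o f).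
Proof.
move=> [sf [a' [b' [_ _ vf]]]]; apply: vanishes_outside_integrable vf.
exact: smooth_continuous.
Qed.

(** The half-line is a factor of the integrand rather than a domain, so that s and y can later be
    exchanged by Fubini in the plane. *)
Lemma integral_halfline_derive1 (a b s : R) f : (forall x : R, derivable f x 1) ->
  continuous (derive1 f) -> vanishes_outside a b f ->
  \int[mu]_y ((s < y)%R%:R * derive1 f y) = - f s.
Proof.
move=> df cf vf; have vf' := derive1_vanishes vf.
(* Beyond both [s] and the support: [f] vanishes at [B], and the fundamental theorem is applied on a
   nondegenerate interval. *)
pose B := Num.max b s + 1.
have sB : s < B.
  have : s <= Num.max b s by rewrite le_max lexx orbT.
  by rewrite /B; lra.
have bB : b < B.
  have : b <= Num.max b s by rewrite le_max lexx.
  by rewrite /B; lra.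
transitivity (\int[mu]_(y in `]s, B]) derive1 f y).
  rewrite [RHS]Rintegral_mkcond; apply: eq_Rintegral => y _; rewrite /patch.
  rewrite mem_setE in_itv /=; case: (ltP s y) => sy /=; last by rewrite mul0r.
  rewrite mul1r; case: ifPn => //; rewrite -ltNge => By.
  by rewrite vf'// negb_and orbC -ltNge (lt_trans bB By).
have i1 : mu.-integrable `[s, B] (EFin \o derive1 f).
  apply: continuous_compact_integrable; first exact: segment_compact.
  exact: continuous_subspaceT.
rewrite Rintegral_itv_obnd_cbnd; last first.
  by apply: integrableS i1 => //; apply: subset_itvr; rewrite bnd_simp.
have H1 : {within `[s, B], continuous (derive1 f)} by exact: continuous_subspaceT.
have H2 : derivable_oo_LRcontinuous f s B.
  have cf0 := derivable_continuous df.
  split; first by move=> x _; exact: df.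
    by apply: cvg_at_right_filter; exact: cf0.
  by apply: cvg_at_left_filter; exact: cf0.
have H3 : {in `]s, B[, derive1 f =1 derive1 f} by [].
rewrite /Rintegral (continuous_FTC2 sB H1 H2 H3) -EFinB /=.
by rewrite vf ?sub0r// negb_and orbC -ltNge bB.
Qed.

Lemma integral_derive1 (a b : R) f : (forall x : R, derivable f x 1) ->
  continuous (derive1 f) -> vanishes_outside a b f ->
  \int[mu]_y derive1 f y = 0.
Proof.
move=> df cf vf; have vf' := derive1_vanishes vf.
rewrite -[RHS]oppr0 -(_ : f (a - 1) = 0); last first.
  by rewrite vf// negb_and -ltNge ltrBlDr ltrDl ltr01.
rewrite -(integral_halfline_derive1 _ df cf vf); apply: eq_Rintegral => y _.
case: ltP => [_|ya]; first by rewrite mul1r.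
rewrite mul0r vf'// negb_and -ltNge; apply/orP; left; lra.
Qed.

Lemma bump_primitive (a b : R) f : bump_in a b f ->
  exists F, [/\ smooth F, derive1 F = f, forall x, x <= a -> F x = 0 &
    forall x, b <= x -> F x = \int[mu]_y f y].
Proof.
move=> bf; have fi := bump_integrable bf; case: bf => sf [a' [b' [aa bb vf]]].
pose F x := \int[mu]_(t in `]-oo, x]) f t.
have FD x : derivable F x 1 /\ derive1 F x = f x.
  apply: (@continuous_FTC1 _ f -oo%O x (x + 1)).
  - by rewrite ltrDl.
  - exact: integrableS fi.
  - by rewrite ltNyr.
  - exact: smooth_continuous.
have F'E : derive1 F = f by apply/funext => x; case: (FD x).
exists F; split=> //.
- move=> [|n]; last first.
    by split; [move=> x; case: (FD x)|rewrite F'E; exact: sf].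
  by apply: derivable_continuous => x; case: (FD x).
- move=> x xa; rewrite /F (@eq_Rintegral _ _ _ mu _ (cst 0)); first by rewrite /Rintegral integral0.
  move=> y; rewrite inE /= in_itv /= => yx; rewrite vf// negb_and -ltNge.
  by rewrite (le_lt_trans (le_trans yx xa) aa).
- move=> x xb; rewrite /F Rintegral_mkcond; apply: eq_Rintegral => y _.
  rewrite /patch mem_setE in_itv /=; case: ifPn => //; rewrite -ltNge => xy.
  by rewrite vf// negb_and orbC -ltNge (lt_le_trans bb (le_trans xb (ltW xy))).
Qed.

(** A primitive that starts left of the support is constant right of it, equal to the integral of
    [f]; integral zero is exactly what makes it a bump. *)
Lemma bump_primitive0 (a b : R) f : bump_in a b f -> \int[mu]_y f y = 0 ->
  exists2 F, bump_in a b F & derive1 F = f.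
Proof.
move=> [sf [a' [b' [aa bb vf]]]] f0.
(* The midpoints leave room on both sides: [f] is a bump in ]a2, b2[, and the primitive, zero
   outside [a2, b2], is a bump in ]a, b[. *)
pose a2 := (a + a') / 2; pose b2 := (b + b') / 2.
have bf : bump_in a2 b2 f.
  by split=> //; exists a', b'; split=> //; rewrite /a2 /b2; lra.
have [F [sF F'E Fa Fb]] := bump_primitive bf.
exists F => //; split=> //; exists a2, b2; split; [rewrite /a2; lra|rewrite /b2; lra|].
move=> x; rewrite negb_and -!ltNge => /orP[/ltW/Fa//|/ltW/Fb ->//].
Qed.

Lemma cutoff_integral_cvg (a b : R) : a < b ->
  \int[mu]_x cutoff a b n x @[n --> \oo] --> b - a.
Proof.
move=> ab.
have mi : measurable (`]a, b[ : set R) by exact: measurable_itv.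
have mc n : measurable_fun (setT : set (measurableTypeR R)) (cutoff a b n).
  by apply: measurable_realfun.continuous_measurable_fun; apply: smooth_continuous; case: (bump_cutoff a b n).
have ci : mu.-integrable setT (EFin \o (\1_(`]a, b[ : set R) : R -> R)).
  exact: integrable_indic_itv.
have E x : ((a < x < b)%R%:R : R) = \1_(`]a, b[ : set R) x.
  by rewrite indicE mem_setE in_itv.
pose f_ n : measurableTypeR R -> \bar R := EFin \o cutoff a b n.
pose g : measurableTypeR R -> \bar R := EFin \o (\1_(`]a, b[ : set R) : R -> R).
have [||||| _ _] := @dominated_convergence _ (measurableTypeR R) R mu setT measurableT f_ g g.
- by move=> n; apply/measurable_EFinP.
- by apply/measurable_EFinP; exact: measurable_indic.
- apply: aeW => x _; apply: cvg_EFin; first exact: nearW.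
  by rewrite /= -E; exact: cutoff_cvg.
- exact: ci.
- apply: aeW => x n _ /=; rewrite lee_fin ger0_norm ?cutoff_ge0// -E.
  case: (boolP (a < x < b)) => [_|/negP ab']; first by rewrite cutoff_le1.
  have [_ [a' [b' [h1 h2 h3]]]] := bump_cutoff a b n.
  rewrite h3//; apply/negP => /andP[ax xb]; apply: ab'.
  by rewrite (lt_le_trans h1 ax) (le_lt_trans xb h2).
rewrite /g (_ : (\int[mu]_x _)%E = (b - a)%:E).
  by move/fine_cvgP => [_].
rewrite integral_indic// setIT /= lebesgue_measure_itv /= lte_fin ab.
by rewrite EFinB.
Qed.

Lemma unit_bump (a b : R) : a < b -> exists2 f, bump_in a b f & \int[mu]_x f x = 1.
Proof.
move=> ab; have H := cutoff_integral_cvg ab.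
have : \forall n \near \oo, 0 < \int[mu]_x cutoff a b n x.
  by apply: (cvgr_gt _ H); rewrite subr_gt0.
move=> [N _ /(_ N (leqnn _)) /= N0].
pose I := \int[mu]_x cutoff a b N x.
have bc := bump_cutoff a b N.
exists (fun x => I^-1 * cutoff a b N x).
  (* The multiple is written as the cutoff plus [I^-1 - 1] times itself, the shape of
     [bump_comb]. *)
  have := @bump_comb _ a b (I^-1 - 1) _ _ bc bc.
  by congr bump_in; apply/funext => x; rewrite mulrBl mul1r addrC subrK.
by rewrite RintegralZl// ?mulVf ?gt_eqF//; exact: bump_integrable bc.
Qed.

Lemma smooth_step (c d : R) : c < d -> exists F, [/\ smooth F,
  forall x, x <= c -> F x = 0 & forall x : R, d <= x -> F x = 1].
Proof.
move=> cd; have [f bf f1] := unit_bump cd.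
have [F [sF _ F0 F1]] := bump_primitive bf.
by exists F; split=> // x xd; rewrite F1.
Qed.

Lemma plateau (a a' b' b : R) : a < a' -> b' < b ->
  exists2 f, bump_in a b f & forall x, a' <= x <= b' -> f x = 1.
Proof.
move=> aa bb; pose a2 := (a + a') / 2; pose b2 := (b + b') / 2.
have h1 : a2 < a' by rewrite /a2; lra.
have h2 : b' < b2 by rewrite /b2; lra.
have [F [sF F0 F1]] := smooth_step h1; have [G [sG G0 G1]] := smooth_step h2.
(* [F] passes from 0 to 1 between a2 and a', and [G] between b' and b2. *)
exists (fun x => F x * (1 - G x)); last first.
  by move=> x /andP[ax xb]; rewrite F1// G0// subr0 mulr1.
split; first by apply: smoothM => //; apply: smoothB => //; exact: smooth_cst.
exists a2, b2; split; [rewrite /a2; lra|rewrite /b2; lra|].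
move=> x; rewrite negb_and -!ltNge => /orP[/ltW/F0 ->|/ltW/G1 ->].
  by rewrite mul0r.
by rewrite subrr mulr0.
Qed.

End Integrals1.

(** * Rectangles and test functions *)

Section Plane.
Context {R : realType}.
Notation plane := (measurableTypeR R * measurableTypeR R)%type.
Implicit Types (p z : R * R) (A D G : set (R * R)).

Definition rect (a b c d : R) : set (R * R) := `]a, b[ `*` `]c, d[.

Definition box p (r : R) := rect (p.1 - r) (p.1 + r) (p.2 - r) (p.2 + r).

Lemma rectE (a b c d : R) z : rect a b c d z = (a < z.1 < b /\ c < z.2 < d) :> Prop.
Proof. by rewrite /rect /= !in_itv. Qed.

Lemma boxE p r z : box p r z = (`|z.1 - p.1| < r /\ `|z.2 - p.2| < r) :> Prop.
Proof. by rewrite /box rectE !ltr_distl. Qed.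

Lemma nbhs_boxP p A : nbhs p A <-> exists2 r, 0 < r & box p r `<=` A.
Proof.
rewrite -nbhs_ballE; split=> -[r r0 H]; exists r => // z.
  by rewrite boxE => -[h1 h2]; apply: H; split => /=; rewrite /ball /= distrC.
by move=> [/= h1 h2]; apply: H; rewrite boxE; split; rewrite distrC.
Qed.

Lemma box_center p (r : R) : 0 < r -> box p r p.
Proof. by move=> r0; rewrite boxE !subrr normr0. Qed.

Lemma nbhs_box p (r : R) : 0 < r -> nbhs p (box p r).
Proof. by move=> r0; apply/nbhs_boxP; exists r. Qed.

Lemma open_rect (a b c d : R) : open (rect a b c d).
Proof.
rewrite openE => z; rewrite rectE => -[/andP[h1 h2] /andP[h3 h4]].
pose r := Num.min (Num.min (z.1 - a) (b - z.1)) (Num.min (z.2 - c) (d - z.2)).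
have r0 : 0 < r by rewrite !lt_min !subr_gt0 h1 h2 h3 h4.
apply/nbhs_boxP; exists r => // w; rewrite boxE rectE !lt_min !ltr_distl.
move=> [/andP[+ +] /andP[+ +]].
have /andP[/andP[k1 k2] /andP[k3 k4]] : (r <= z.1 - a) && (r <= b - z.1) && ((r <= z.2 - c) && (r <= d - z.2)).
  by rewrite -!le_min.
by move=> *; split; apply/andP; split; lra.
Qed.

Lemma open_box p (r : R) : open (box p r).
Proof. exact: open_rect. Qed.

Lemma measurable_rect (a b c d : R) : measurable (rect a b c d : set plane).
Proof. by apply: measurableX; exact: measurable_itv. Qed.

Lemma area_rect (a b c d : R) : a < b -> c < d ->
  area (rect a b c d) = ((b - a) * (d - c))%:E.
Proof.
move=> ab cd.
rewrite (_ : area _ = (lebesgue_measure \x lebesgue_measure)%E (`]a, b[ `*` `]c, d[))//.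
rewrite product_measure1E; [|exact: measurable_itv..].
by rewrite /= !lebesgue_measure_itv /= !lte_fin ab cd -!EFinB.
Qed.

(** Lindelof's argument: each point lies in a square with rational centre and radius 1/(n+1) inside
    its neighbourhood, and there are countably many such squares. *)
Lemma countable_subcover D (N : R * R -> set (R * R)) : D !=set0 ->
  (forall x, D x -> nbhs x (N x)) ->
  exists2 s : nat -> R * R, (forall i, D (s i)) & D `<=` \bigcup_i N (s i).
Proof.
move=> [x0 Dx0] DN.
pose q (i : rat * rat * nat) := box (ratr i.1.1 : R, ratr i.1.2 : R) i.2.+1%:R^-1.
(* The point selected for a rational square may differ from the one that the square was found for;
   all that counts is that the same square lies in its neighbourhood. Indices without such a point
   fall back on [x0]. *)
pose s n := xget x0 [set x | exists i, [/\ unpickle n = Some i, D x & q i `<=` N x]].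
exists s.
  by move=> n; rewrite /s; case: xgetP => // x _ [i []].
move=> x Dx; have /nbhs_boxP[r r0 rN] := DN _ Dx.
(* Half of [r]: the rational centre is within 1/(n+1) of [x], and the points of the square within
   1/(n+1) of the centre. *)
have [n Hn] : exists n : nat, n.+1%:R^-1 < r / 2.
  have r2 : 0 < r / 2 by rewrite divr_gt0.
  have [n _ /(_ n (leqnn _))] := @near_infty_natSinv_lt _ (PosNum r2).
  by exists n.
set e : R := n.+1%:R^-1 in Hn *.
have e0 : 0 < e by rewrite invr_gt0.
have [q1] : exists q1 : rat, ratr q1 \in `]x.1 - e, x.1 + e[ by apply: rat_in_itvoo; lra.
rewrite in_itv /= => /andP[a1 a2].
have [q2] : exists q2 : rat, ratr q2 \in `]x.2 - e, x.2 + e[ by apply: rat_in_itvoo; lra.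
rewrite in_itv /= => /andP[a3 a4].
exists (pickle (q1, q2, n)) => //.
rewrite /s; case: xgetP => [y _ [i [+ _ qy]]|/(_ x)].
  rewrite pickleK => -[Ei]; apply: qy; rewrite -Ei /q boxE /= !ltr_distl -/e.
  by split; lra.
case; exists (q1, q2, n); split=> //; first exact: pickleK.
move=> z; rewrite /q boxE /= !ltr_distl -/e => -[/andP[b1 b2] /andP[b3 b4]].
apply: rN; rewrite boxE !ltr_distl; split; lra.
Qed.

Lemma negligible_local A :
  (forall x, A x -> exists2 U, nbhs x U & area.-negligible (A `&` U : set plane)) ->
  area.-negligible (A : set plane).
Proof.
move=> H; have [->|/set0P A0] := eqVneq A set0; first exact: negligible_set0.
have /choice[N HN] : forall x, exists U, A x -> nbhs x U /\ area.-negligible (A `&` U : set plane).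
  move=> x; have [Ax|nAx] := pselect (A x); last by exists setT.
  by have [U U1 U2] := H _ Ax; exists U.
have [s sA cover] := countable_subcover A0 (fun x Ax => (HN x Ax).1).
apply: (@negligibleS _ _ _ area (\bigcup_i (A `&` N (s i)))).
  by move=> x Ax; have [i _ Ni] := cover _ Ax; exists i.
by apply: negligible_bigcup => i; case: (HN _ (sA i)).
Qed.

(** The measurable sets of [plane] are those of the product sigma-algebra; an open set belongs to it
    as a countable union of open squares. *)
Lemma open_measurable_plane G : open G -> measurable (G : set plane).
Proof.
move=> oG; have [->|/set0P G0] := eqVneq G set0; first exact: measurable0.
have /choice[r Hr] : forall x, exists r, G x -> 0 < r /\ box x r `<=` G.
  move=> x; have [Gx|nGx] := pselect (G x); last by exists 0.
  by move: oG; rewrite openE => /(_ _ Gx) /nbhs_boxP[r r0 H]; exists r.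
have [s sG cover] := @countable_subcover G (fun x => box x (r x)) G0
   (fun x Gx => nbhs_box x (Hr x Gx).1).
have -> : G = \bigcup_i box (s i) (r (s i)).
  apply/seteqP; split=> // x [i _]; exact: (Hr _ (sG i)).2.
by apply: bigcup_measurable => i _; exact: measurable_rect.
Qed.

Lemma continuous_measurable_plane (f : R * R -> R) : continuous f ->
  measurable_fun (setT : set plane) f.
Proof.
move=> /continuousP cf; apply: (measurability _ (RGenOpens.measurableE R)).
move=> _ [_ [a [b ->] <-]]; rewrite setTI; apply: open_measurable_plane.
by apply: cf; exact: interval_open.
Qed.

Lemma open_not_negligible G : open G -> area.-negligible (G : set plane) -> G = set0.
Proof.
move=> oG nG; apply/eqP; apply/negPn/negP => /set0P[x Gx].
move: oG; rewrite openE => /(_ _ Gx) /nbhs_boxP[r r0 H].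
have : area.-negligible (box x r : set plane) by exact: negligibleS nG.
move/negligibleP => /(_ (measurable_rect _ _ _ _)).
have E : area (box x r) = ((x.1 + r - (x.1 - r)) * (x.2 + r - (x.2 - r)))%:E.
  by apply: area_rect; lra.
move=> Z; have : ((x.1 + r - (x.1 - r)) * (x.2 + r - (x.2 - r)))%:E = 0%:E :> \bar R.
  by rewrite -E; exact: Z.
by move=> [] /eqP; rewrite mulf_eq0 => /orP[] /eqP; lra.
Qed.

End Plane.

(** * The fundamental lemma of the calculus of variations *)

Section Fundamental.
Context {R : realType}.
Notation plane := (measurableTypeR R * measurableTypeR R)%type.
Implicit Types (D G : set (R * R)) (u f : R * R -> R).

Definition L1 D u := area.-integrable (D : set plane) (EFin \o u).

Definition rects : set (set (R * R)) :=
  [set A | exists a b c d, A = rect a b c d].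

Lemma rectI (a b c d a' b' c' d' : R) :
  rect a b c d `&` rect a' b' c' d' =
  rect (Num.max a a') (Num.min b b') (Num.max c c') (Num.min d d').
Proof.
apply/seteqP; split=> z; rewrite /setI /= !rectE !gt_max !lt_min.
  by move=> [[/andP[-> ->] /andP[-> ->]] [/andP[-> ->] /andP[-> ->]]].
by move=> [/andP[/andP[-> ->] /andP[-> ->]] /andP[/andP[-> ->] /andP[-> ->]]].
Qed.

(** The form required by Dynkin's theorem, open rectangles being stable under intersection. Both
    projections are measurable for the sigma-algebra that they generate. *)
Lemma measurable_planeE : @measurable _ plane = <<s rects >>.
Proof.
pose T := g_sigma_algebraType (rects : set (set plane)).
have ex (x : R) : exists n : nat, - n%:R < x < n%:R.
  exists (Num.truncn `|x|).+1; rewrite -ltr_norml; exact: truncnS_gt.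
have m1 : measurable_fun (setT : set T) (fst : T -> measurableTypeR R).
  apply: (measurability _ (RGenOpens.measurableE R)).
  move=> _ [_ [a [b ->] <-]]; rewrite setTI.
  rewrite (_ : fst @^-1` _ = \bigcup_n rect a b (- n%:R) n%:R).
    apply: bigcup_measurable => n _; apply: sub_sigma_algebra.
    by do 4 eexists.
  apply/seteqP; split=> z /=; rewrite in_itv /=.
    by move=> h; have [n hn] := ex z.2; exists n => //; rewrite rectE.
  by move=> [n _]; rewrite rectE => -[].
have m2 : measurable_fun (setT : set T) (snd : T -> measurableTypeR R).
  apply: (measurability _ (RGenOpens.measurableE R)).
  move=> _ [_ [a [b ->] <-]]; rewrite setTI.
  rewrite (_ : snd @^-1` _ = \bigcup_n rect (- n%:R) n%:R a b).
    apply: bigcup_measurable => n _; apply: sub_sigma_algebra.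
    by do 4 eexists.
  apply/seteqP; split=> z /=; rewrite in_itv /=.
    by move=> h; have [n hn] := ex z.1; exists n => //; rewrite rectE.
  by move=> [n _]; rewrite rectE => -[].
apply/seteqP; split; last first.
  apply: smallest_sub; first exact: sigma_algebra_measurable.
  by move=> _ [a [b [c [d ->]]]]; exact: measurable_rect.
rewrite measurable_prod_measurableType; apply: smallest_sub.
  exact: (sigma_algebra_measurable T).
move=> _ [A mA [B mB <-]].
rewrite (_ : A `*` B = (setT `&` fst @^-1` A) `&` (setT `&` snd @^-1` B)); last first.
  by rewrite !setTI.
by apply: (@measurableI _ T); [exact: m1|exact: m2].
Qed.

(** Products of cutoffs converge to the indicator of the inner rectangle and stay between 0 and 1,
    so [|u|] dominates. *)
Lemma integral_rect_eq0 (a b c d a' b' c' d' : R) u :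
  a <= a' -> b' <= b -> c <= c' -> d' <= d -> L1 (rect a b c d) u ->
  (forall f g : R -> R, bump_in a b f -> bump_in c d g ->
    (\int[area]_(z in rect a b c d) (u z * (f z.1 * g z.2))%:E = 0)%E) ->
  (\int[area]_(z in rect a' b' c' d') (u z)%:E = 0)%E.
Proof.
move=> aa bb cc dd Lu H.
have Q'Q : rect a' b' c' d' `<=` rect a b c d.
  move=> z; rewrite !rectE => -[/andP[h1 h2] /andP[h3 h4]].
  by split; apply/andP; split; lra.
have mu_ : measurable_fun (rect a b c d : set plane) u.
  by apply/measurable_EFinP; exact: measurable_int Lu.
pose k n (z : plane) : R := cutoff a' b' n z.1 * cutoff c' d' n z.2.
have mk n : measurable_fun (setT : set plane) (k n).
  have mc x y : measurable_fun (setT : set (measurableTypeR R)) (cutoff x y n).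
    by apply: continuous_measurable_fun; apply: smooth_continuous; case: (bump_cutoff x y n).
  by apply: measurable_funM; apply: (measurableT_comp (mc _ _));
    [exact: measurable_fst|exact: measurable_snd].
pose f_ n (z : plane) : \bar R := (u z * k n z)%:E.
pose f (z : plane) : \bar R := (u z * (z \in rect a' b' c' d')%:R)%:E.
have mQ := @measurable_rect R a b c d.
have [||||| _ _] := @dominated_convergence _ plane R area (rect a b c d) mQ f_ f
  (fun z => `|u z|%:E).
- move=> n; apply/measurable_EFinP; apply: measurable_funM => //.
  exact: measurable_funTS.
- apply/measurable_EFinP; apply: measurable_funM => //.
  apply: measurable_funTS; rewrite (_ : (fun _ => _) = \1_(rect a' b' c' d')).
    by apply: measurable_indic; exact: measurable_rect.
  by apply/funext => z; rewrite indicE.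
- apply: aeW => z _; apply: cvg_EFin; first exact: nearW.
  apply: cvgM; first exact: cvg_cst.
  have -> : (z \in rect a' b' c' d')%:R = (a' < z.1 < b')%R%:R * (c' < z.2 < d')%R%:R :> R.
    rewrite -natrM mulnb; congr (_%:R); congr nat_of_bool.
    apply/idP/andP; first by rewrite inE rectE.
    by rewrite inE rectE.
  by apply: cvgM; exact: cutoff_cvg.
- exact: (integrable_norm Lu).
- apply: aeW => z n _; rewrite lee_fin normrM.
  have -> : `|k n z| = k n z by rewrite ger0_norm// mulr_ge0 ?cutoff_ge0.
  by rewrite ler_piMr// mulr_ile1 ?cutoff_ge0 ?cutoff_le1.
have bc n := bump_mono aa bb (bump_cutoff a' b' n).
have bc' n := bump_mono cc dd (bump_cutoff c' d' n).
rewrite (_ : [sequence _]_n = cst 0%E); last first.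
  by apply/funext => n; exact: (H _ _ (bc n) (bc' n)).
move/(cvg_lim (@ereal_hausdorff R)); rewrite (lim_cst (@ereal_hausdorff R)) => H0.
rewrite [RHS]H0 -(setIidr Q'Q) integral_mkcondr; apply: eq_integral => z _.
by rewrite /f /patch; case: ifP => _; rewrite ?mulr1 ?mulr0.
Qed.

(** The integrals of [u] over rectangles vanish, hence by Dynkin those over all measurable subsets
    of [Q], hence [u] itself. From here on an identity on a rectangle need only be tested on tensor
    products. *)
Lemma fundamental_rect (a b c d : R) u : L1 (rect a b c d) u ->
  (forall f g : R -> R, bump_in a b f -> bump_in c d g ->
    (\int[area]_(z in rect a b c d) (u z * (f z.1 * g z.2))%:E = 0)%E) ->
  eq_on (rect a b c d) u (fun=> 0).
Proof.
move=> Lu H; set Q := rect a b c d.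
have mQ : measurable (Q : set plane) := @measurable_rect R a b c d.
have Z A : measurable (A : set plane) -> (\int[area]_(z in (A `&` Q)) (u z)%:E = 0)%E.
  rewrite measurable_planeE.
  apply: (@dynkin_induction _ plane rects
    (fun A => (\int[area]_(z in (A `&` Q)) (u z)%:E = 0)%E)).
  - exact: measurable_planeE.
  - move=> _ _ [a1 [b1 [c1 [d1 ->]]]] [a2 [b2 [c2 [d2 ->]]]].
    by rewrite rectI; do 4 eexists.
  - by rewrite setTI; apply: (integral_rect_eq0 _ _ _ _ Lu H).
  - move=> _ [a1 [b1 [c1 [d1 ->]]]]; rewrite rectI.
    by apply: (integral_rect_eq0 _ _ _ _ Lu H); rewrite ?le_max ?ge_min lexx orbT.
  - move=> S mS S0.
    (* The integral over all of [Q] is zero, which carries the property from [S] to its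
       complement. *)
    have QE : Q = (S `&` Q) `|` (~` S `&` Q) by rewrite -setIUl setUv setTI.
    have := @integral_rect_eq0 a b c d a b c d u (lexx _) (lexx _) (lexx _) (lexx _) Lu H.
    rewrite -/Q {1}QE integral_setU_EFin.
    + by rewrite S0 add0e.
    + exact: measurableI.
    + by apply: measurableI => //; exact: measurableC.
    + by rewrite -QE; apply/measurable_EFinP; exact: measurable_int Lu.
    + by rewrite disj_set2E setIACA setICr set0I.
  - move=> F mF tF F0; rewrite setI_bigcupl integral_bigcup.
    + by apply: eseries0 => i _ _; exact: F0.
    + by apply: trivIset_setIr.
    + by move=> i; exact: measurableI.
    + apply: integrableS Lu => //; last by move=> z [i _ []].
      by apply: bigcup_measurable => i _; exact: measurableI.
have : ae_eq area (Q : set plane) (EFin \o u) (cst 0%E).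
  apply: integral_ae_eq => //.
  by move=> E EQ mE; rewrite integral0 -(setIidl EQ); exact: Z.
by apply: filterS => z /= /[apply] -[].
Qed.

End Fundamental.

(** * Smooth functions and test functions of two variables *)

Section SmoothPlane.
Context {R : realType}.
Implicit Types (D G : set (R * R)) (u phi psi : R * R -> R).

Definition Cinf phi := forall n, Cn n phi.

(** Exchanges [pdx] and [pdy] by mere computation, so that statements are proved for one variable
    and transported to the other. *)
Definition swapf phi : R * R -> R := fun z => phi (z.2, z.1).

Lemma pdx_swapf phi : pdx (swapf phi) = swapf (pdy phi).
Proof. by []. Qed.

Lemma pdy_swapf phi : pdy (swapf phi) = swapf (pdx phi).
Proof. by []. Qed.

Lemma swapfK phi : swapf (swapf phi) = phi.
Proof. by apply/funext => -[]. Qed.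

Lemma continuous_swap : continuous (fun z : R * R => (z.2, z.1)).
Proof. by move=> z; apply: (@cvg_pair _ _ _ _ (nbhs z.2) (nbhs z.1)); [exact: cvg_snd|exact: cvg_fst]. Qed.

Lemma continuous_swapf phi : continuous phi -> continuous (swapf phi).
Proof.
move=> cp z; have h := @continuous_comp _ _ _ (fun z : R * R => (z.2, z.1)) phi z.
apply: h; first exact: continuous_swap.
exact: cp.
Qed.

Lemma Cn_continuous n phi : Cn n phi -> continuous phi.
Proof. by case: n => [|n] []. Qed.

Lemma CnW n phi : Cn n.+1 phi -> Cn n phi.
Proof.
elim: n phi => [|n IH] phi [c [h1 h2 h3 h4]]; first by split.
split; first exact: c.
by split; [exact: h1|exact: h2|exact: IH h3|exact: IH h4].
Qed.

Lemma Cn_swapf n phi : Cn n phi -> Cn n (swapf phi).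
Proof.
elim: n phi => [|n IH] phi [c H]; split; rewrite ?pdx_swapf ?pdy_swapf; try exact: continuous_swapf.
  by [].
case: H => h1 h2 h3 h4; split.
- by move=> z; exact: (h2 (z.2, z.1)).
- by move=> z; exact: (h1 (z.2, z.1)).
- exact: IH.
- exact: IH.
Qed.

Lemma Cinf_pdx phi : Cinf phi -> Cinf (pdx phi).
Proof. by move=> cp n; case: (cp n.+1) => _ []. Qed.

Lemma Cinf_pdy phi : Cinf phi -> Cinf (pdy phi).
Proof. by move=> cp n; case: (cp n.+1) => _ []. Qed.

Lemma Cinf_iter_pdx n phi : Cinf phi -> Cinf (iter n pdx phi).
Proof. by move=> c; elim: n => //= n; exact: Cinf_pdx. Qed.

Lemma Cinf_iter_pdy n phi : Cinf phi -> Cinf (iter n pdy phi).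
Proof. by move=> c; elim: n => //= n; exact: Cinf_pdy. Qed.

Lemma Cinf_continuous phi : Cinf phi -> continuous phi.
Proof. by move=> /(_ 0%N) []. Qed.

Lemma Cinf_swapf phi : Cinf phi -> Cinf (swapf phi).
Proof. by move=> cp n; exact: Cn_swapf. Qed.

Lemma pdxD phi psi : Cn 1 phi -> Cn 1 psi ->
  pdx (fun z => phi z + psi z) = (fun z => pdx phi z + pdx psi z).
Proof.
move=> [_ [hx _ _ _]] [_ [kx _ _ _]]; apply/funext => z.
by rewrite /pdx derive1E deriveD ?derive1E.
Qed.

Lemma pdyD phi psi : Cn 1 phi -> Cn 1 psi ->
  pdy (fun z => phi z + psi z) = (fun z => pdy phi z + pdy psi z).
Proof.
move=> [_ [_ hx _ _]] [_ [_ kx _ _]]; apply/funext => z.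
by rewrite /pdy derive1E deriveD ?derive1E.
Qed.

Lemma pdxM phi psi : Cn 1 phi -> Cn 1 psi ->
  pdx (fun z => phi z * psi z) = (fun z => phi z * pdx psi z + psi z * pdx phi z).
Proof.
move=> [_ [hx _ _ _]] [_ [kx _ _ _]]; apply/funext => z.
by rewrite /pdx derive1E deriveM ?derive1E//= -surjective_pairing.
Qed.

Lemma pdyM phi psi : Cn 1 phi -> Cn 1 psi ->
  pdy (fun z => phi z * psi z) = (fun z => phi z * pdy psi z + psi z * pdy phi z).
Proof.
move=> [_ [_ hx _ _]] [_ [_ kx _ _]]; apply/funext => z.
by rewrite /pdy derive1E deriveM ?derive1E//= -surjective_pairing.
Qed.

Lemma CnS1 n phi : Cn n.+1 phi -> Cn 1 phi.
Proof. by elim: n phi => [//|n IH] phi /CnW /IH. Qed.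

Lemma CnD n phi psi : Cn n phi -> Cn n psi -> Cn n (fun z => phi z + psi z).
Proof.
elim: n phi psi => [|n IH] phi psi C1 C2.
  by split=> // z; apply: cvgD; [exact: C1.1|exact: C2.1].
have D1 := CnS1 C1; have D2 := CnS1 C2.
split; first by move=> z; apply: cvgD; [exact: C1.1|exact: C2.1].
rewrite pdxD// pdyD//; case: C1 => _ [h1 h2 h3 h4]; case: C2 => _ [k1 k2 k3 k4].
split; [by move=> z; apply: derivableD|by move=> z; apply: derivableD|exact: IH|exact: IH].
Qed.

Lemma CnM n phi psi : Cn n phi -> Cn n psi -> Cn n (fun z => phi z * psi z).
Proof.
elim: n phi psi => [|n IH] phi psi C1 C2.
  by split=> // z; apply: cvgM; [exact: C1.1|exact: C2.1].
have D1 := CnS1 C1; have D2 := CnS1 C2; have W1 := CnW C1; have W2 := CnW C2.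
split; first by move=> z; apply: cvgM; [exact: C1.1|exact: C2.1].
rewrite pdxM// pdyM//; case: C1 => _ [h1 h2 h3 h4]; case: C2 => _ [k1 k2 k3 k4].
split; [by move=> z; apply: derivableM|by move=> z; apply: derivableM| |].
  by apply: CnD; apply: IH.
by apply: CnD; apply: IH.
Qed.

Lemma CinfD phi psi : Cinf phi -> Cinf psi -> Cinf (fun z => phi z + psi z).
Proof. by move=> h k n; exact: CnD. Qed.

Lemma CinfM phi psi : Cinf phi -> Cinf psi -> Cinf (fun z => phi z * psi z).
Proof. by move=> h k n; exact: CnM. Qed.

Definition tensor (f g : R -> R) : R * R -> R := fun z => f z.1 * g z.2.

Lemma pdx_tensor (f g : R -> R) : (forall x : R, derivable f x 1) ->
  pdx (tensor f g) = tensor (derive1 f) g.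
Proof.
move=> df; apply/funext => z; rewrite /pdx /tensor /=.
have D : is_derive z.1 1 (fun t => f t * g z.2) (derive1 f z.1 * g z.2).
  have h1 : is_derive z.1 1 f (derive1 f z.1) by rewrite derive1E; exact: derivableP.
  have h := is_deriveM h1 (is_derive_cst (g z.2) z.1 1).
  by apply: (is_derive_eq h); rewrite /cst /= scaler0 add0r /GRing.scale /= mulrC.
exact: derive1_ext D.
Qed.

Lemma tensor_swapf (f g : R -> R) : swapf (tensor f g) = tensor g f.
Proof. by apply/funext => z; rewrite /swapf /tensor /= mulrC. Qed.

Lemma pdy_tensor (f g : R -> R) : (forall x : R, derivable g x 1) ->
  pdy (tensor f g) = tensor f (derive1 g).
Proof.
by move=> dg; rewrite -[tensor f g]tensor_swapf pdy_swapf pdx_tensor// tensor_swapf.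
Qed.

Lemma continuous_tensor (f g : R -> R) : continuous f -> continuous g ->
  continuous (tensor f g).
Proof.
move=> cf cg z; apply: cvgM.
  by apply: (@continuous_comp _ _ _ fst f); [exact: cvg_fst|exact: cf].
by apply: (@continuous_comp _ _ _ snd g); [exact: cvg_snd|exact: cg].
Qed.

Lemma Cn_tensor n (f g : R -> R) : Ck n f -> Ck n g -> Cn n (tensor f g).
Proof.
elim: n f g => [|n IH] f g Cf Cg.
  by split=> //; exact: continuous_tensor.
split; first by apply: continuous_tensor; [exact: Ck_continuous Cf|exact: Ck_continuous Cg].
have Wf := CkW Cf; have Wg := CkW Cg; case: Cf => df Cf; case: Cg => dg Cg.
rewrite pdx_tensor// pdy_tensor//; split; [| |exact: IH|exact: IH].
  by move=> z; rewrite /tensor /=; apply: derivableM.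
by move=> z; rewrite /tensor /=; apply: derivableM.
Qed.

Lemma Cinf_tensor (f g : R -> R) : smooth f -> smooth g -> Cinf (tensor f g).
Proof. by move=> sf sg n; exact: Cn_tensor. Qed.

Lemma Cinf_cst (c : R) : Cinf (fun=> c).
Proof.
have -> : (fun=> c) = tensor (fun=> c) (fun=> 1).
  by apply/funext => z; rewrite /tensor mulr1.
by apply: Cinf_tensor; exact: smooth_cst.
Qed.

Lemma pdx_near0 phi z : (\forall w \near z, phi w = 0) -> pdx phi z = 0.
Proof.
move=> /nbhs_boxP[r r0 H]; apply: (@derive1_ext _ _ z.1 0).
apply: (@near_eq_is_derive R R R (cst 0)).
exists r => //= t /=; rewrite distrC => tr; rewrite H// boxE /= subrr normr0.
by split.
Qed.

Lemma pdy_near0 phi z : (\forall w \near z, phi w = 0) -> pdy phi z = 0.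
Proof.
move=> /nbhs_boxP[r r0 H]; apply: (@derive1_ext _ _ z.2 0).
apply: (@near_eq_is_derive R R R (cst 0)).
exists r => //= t /=; rewrite distrC => tr; rewrite H// boxE /= subrr normr0.
by split.
Qed.

Lemma supp_eq0 phi z : ~ supp phi z -> phi z = 0.
Proof.
by move=> h; apply/eqP/negPn/negP => p0; apply: h; apply: subset_closure.
Qed.

Lemma supp_near0 phi z : ~ supp phi z -> \forall w \near z, phi w = 0.
Proof.
move=> h; have : nbhs z (~` supp phi).
  by apply: open_nbhs_nbhs; split=> //; apply: closed_openC; exact: closed_closure.
by apply: filterS => w; exact: supp_eq0.
Qed.

Lemma supp_sub phi psi : (forall z, ~ supp phi z -> psi z = 0) -> supp psi `<=` supp phi.
Proof.
move=> H; rewrite /supp -/(supp phi) [X in _ `<=` X](_ : _ = closure (supp phi)).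
  apply: closure_subset => z /= nz; apply: contrapT => /H z0.
  by rewrite z0 eqxx in nz.
by apply/closure_id; exact: closed_closure.
Qed.

Lemma test_sub D phi psi : test_function D phi -> Cinf psi ->
  (forall z, ~ supp phi z -> psi z = 0) -> test_function D psi.
Proof.
move=> [_ cp sD] cpsi /supp_sub H; split=> //.
  by apply: subclosed_compact cp H; exact: closed_closure.
exact: subset_trans sD.
Qed.

Lemma test_pdx D phi : test_function D phi -> test_function D (pdx phi).
Proof.
move=> tp; apply: (test_sub tp); first by apply: Cinf_pdx; case: tp.
by move=> z /supp_near0 /pdx_near0.
Qed.

Lemma test_pdy D phi : test_function D phi -> test_function D (pdy phi).
Proof.
move=> tp; apply: (test_sub tp); first by apply: Cinf_pdy; case: tp.
by move=> z /supp_near0 /pdy_near0.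
Qed.

Lemma test_mulr D phi psi : test_function D phi -> Cinf psi ->
  test_function D (fun z => phi z * psi z).
Proof.
move=> tp cpsi; apply: (test_sub tp).
  by apply: CinfM => //; case: tp.
by move=> z /supp_eq0 ->; rewrite mul0r.
Qed.

Lemma test_mull D phi psi : Cinf phi -> test_function D psi ->
  test_function D (fun z => phi z * psi z).
Proof.
move=> cphi tp; apply: (test_sub tp).
  by apply: CinfM => //; case: tp.
by move=> z /supp_eq0 ->; rewrite mulr0.
Qed.

Lemma testS D G phi : G `<=` D -> test_function G phi -> test_function D phi.
Proof. by move=> GD [h1 h2 h3]; split=> //; exact: subset_trans GD. Qed.

Lemma test_tensor (a b c d : R) (f g : R -> R) : bump_in a b f -> bump_in c d g ->
  test_function (rect a b c d) (tensor f g).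
Proof.
move=> [sf [a' [b' [ha hb vf]]]] [sg [c' [d' [hc hd vg]]]].
have S : supp (tensor f g) `<=` `[a', b'] `*` `[c', d'].
  rewrite /supp [X in _ `<=` X](_ : _ = closure (`[a', b'] `*` `[c', d'])).
    apply: closure_subset => z /= nz; split; rewrite /= in_itv /=.
      by apply/negPn/negP => /vf z0; rewrite /tensor z0 mul0r eqxx in nz.
    by apply/negPn/negP => /vg z0; rewrite /tensor z0 mulr0 eqxx in nz.
  apply/closure_id; apply: (compact_closed (@norm_hausdorff _ _)).
  by apply: compact_setX; exact: segment_compact.
split; first exact: Cinf_tensor.
  apply: (@subclosed_compact _ _ (`[a', b'] `*` `[c', d'])) => //.
    exact: closed_closure.
  by apply: compact_setX; exact: segment_compact.
move=> z /S [/=]; rewrite !in_itv /= rectE => /andP[h1 h2] /andP[h3 h4].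
by split; apply/andP; split; lra.
Qed.

Lemma test_swapf D phi : test_function D phi ->
  test_function [set z | D (z.2, z.1)] (swapf phi).
Proof.
move=> [cp cs sD].
have S z : supp (swapf phi) z -> supp phi (z.2, z.1).
  move=> hz; apply: contrapT => /supp_near0 nz.
  have nz' : \forall w \near z, swapf phi w = 0.
    exact: (continuous_swap nz).
  by have [w [/= /eqP + w0]] := hz _ nz'; rewrite w0.
split; first exact: Cinf_swapf.
  apply: (@subclosed_compact _ _ ((fun z : R * R => (z.2, z.1)) @` supp phi)).
  - exact: closed_closure.
  - apply: continuous_compact => //; apply: continuous_subspaceT.
    exact: continuous_swap.
  - by move=> z /S hz; exists (z.2, z.1) => //; case: z hz.
by move=> z /S /sD.
Qed.

Lemma test_bounded_support D phi : test_function D phi ->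
  exists2 M : R, 0 < M & forall z, phi z != 0 -> `|z.1| <= M /\ `|z.2| <= M.
Proof.
move=> [_ cs _]; have [M [Mr HM]] := compact_bounded cs.
exists (`|M| + 1); first by rewrite ltr_wpDl.
move=> z nz; have : `|z| <= `|M| + 1.
  apply: HM; first by rewrite (le_lt_trans (ler_norm M))// ltrDl.
  exact: subset_closure.
by rewrite prod_normE ge_max => /andP[].
Qed.

End SmoothPlane.

(** * Fubini and integration by parts in the plane *)

Section PlaneIntegrals.
Context {R : realType}.
Notation plane := (measurableTypeR R * measurableTypeR R)%type.
Notation mu := (@lebesgue_measure R).
Implicit Types (D G : set (R * R)) (u v g phi psi : R * R -> R).

Lemma area_fubini (f : R * R -> \bar R) : area.-integrable (setT : set plane) f ->
  (\int[area]_z f z = \int[mu]_x \int[mu]_y f (x, y))%E.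
Proof. by move=> fi; rewrite -(integral12_prod_meas1 fi). Qed.

Lemma area_fubini' (f : R * R -> \bar R) : area.-integrable (setT : set plane) f ->
  (\int[area]_z f z = \int[mu]_y \int[mu]_x f (x, y))%E.
Proof. by move=> fi; rewrite -(integral21_prod_meas1 fi). Qed.

Lemma measurable_swap : measurable_fun (setT : set plane) (fun z : plane => (z.2, z.1) : plane).
Proof. by apply: measurable_fun_pair; [exact: measurable_snd|exact: measurable_fst]. Qed.

(** By Tonelli either integrability is the finiteness of an iterated integral of the absolute value;
    the two orders match the exchange of coordinates. *)
Lemma integrable_swap (f : R * R -> \bar R) : area.-integrable (setT : set plane) f ->
  area.-integrable (setT : set plane) (fun z => f (z.2, z.1)).
Proof.
move=> fi; have mf := measurable_int _ fi.
have mf' : measurable_fun (setT : set plane) (fun z => f (z.2, z.1)).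
  by apply: (measurableT_comp mf); exact: measurable_swap.
have := @integrable21ltyP _ _ (measurableTypeR R) (measurableTypeR R) R mu mu
  (fun z => f (z.2, z.1)) mf'.
by case=> _; apply; have [+ _] := @integrable12ltyP _ _ (measurableTypeR R) (measurableTypeR R) R mu mu f mf; apply.
Qed.

Lemma area_swap (f : R * R -> \bar R) : area.-integrable (setT : set plane) f ->
  (\int[area]_z f (z.2, z.1) = \int[area]_z f z)%E.
Proof.
by move=> fi; rewrite area_fubini'; [rewrite [RHS]area_fubini|exact: integrable_swap].
Qed.

(** Continuity and bounded support are all that integrability takes, and unlike the test functions
    on a given set the class is stable under multiplication by any continuous function. *)
Definition CK phi := continuous phi /\
  exists2 M : R, 0 < M & forall z, phi z != 0 -> `|z.1| <= M /\ `|z.2| <= M.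

Lemma test_CK D phi : test_function D phi -> CK phi.
Proof.
move=> tp; split; first by apply: Cinf_continuous; case: tp.
exact: test_bounded_support tp.
Qed.

Lemma rect_bounded (a b c d : R) phi : continuous phi ->
  exists2 K : R, 0 < K & forall z, a <= z.1 <= b -> c <= z.2 <= d -> `|phi z| <= K.
Proof.
move=> cp; have : compact (phi @` (`[a, b] `*` `[c, d])).
  apply: continuous_compact; first exact: continuous_subspaceT.
  by apply: compact_setX; exact: segment_compact.
move=> /compact_bounded [K [Kr HK]].
exists (`|K| + 1); first by rewrite ltr_wpDl.
move=> z h1 h2; apply: HK; first by rewrite (le_lt_trans (ler_norm K))// ltrDl.
by exists z => //; split; rewrite /= in_itv.
Qed.

Lemma CK_bounded phi : CK phi -> exists2 K : R, 0 < K & forall z, `|phi z| <= K.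
Proof.
move=> [cp [M M0 HM]]; have [K K0 HK] := rect_bounded (- M) M (- M) M cp.
exists K => // z; have [->|/HM [h1 h2]] := eqVneq (phi z) 0; first by rewrite normr0 ltW.
by apply: HK; rewrite -ler_norml.
Qed.

Lemma L1_bounded_support v (M : R) : measurable_fun (setT : set plane) v -> 0 < M ->
  (forall z, `|v z| <= M) -> (forall z, v z != 0 -> `|z.1| <= M /\ `|z.2| <= M) ->
  L1 setT v.
Proof.
move=> mv M0 vM vs.
pose Q := rect (- (M + 1)) (M + 1) (- (M + 1)) (M + 1).
have mQ : measurable (Q : set plane) := @measurable_rect R _ _ _ _.
rewrite /L1 (_ : EFin \o v = (EFin \o v) \_ Q); last first.
  apply/funext => z; rewrite /patch; case: ifPn => // /negP zQ /=.
  have [->//|/vs [h1 h2]] := eqVneq (v z) 0; exfalso; apply: zQ; rewrite inE /Q rectE.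
  have MM : M < M + 1 by rewrite ltrDl.
  by rewrite -!ltr_norml; split; [exact: le_lt_trans h1 MM|exact: le_lt_trans h2 MM].
apply: (@integrable_mkcond _ _ _ area Q (EFin \o v) mQ).1; apply: measurable_bounded_integrable => //.
- by rewrite /= [X in (X < _)%E]area_rect ?ltry//; lra.
- exact: measurable_funTS.
- exists M; split; first exact: num_real.
  by move=> x Mx z _ /=; rewrite (le_trans (vM z))// ltW.
Qed.

Lemma CK_L1 phi : CK phi -> L1 setT phi.
Proof.
move=> Cphi; have [K K0 HK] := CK_bounded Cphi; case: Cphi => cp [M M0 HM].
apply: (@L1_bounded_support _ (Num.max K M)).
- exact: continuous_measurable_plane.
- by rewrite lt_max K0.
- by move=> z; rewrite le_max HK.
- by move=> z /HM [h1 h2]; rewrite !le_max h1 h2 !orbT.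
Qed.

Lemma L1M D u psi (K : R) : measurable (D : set plane) -> L1 D u ->
  measurable_fun (setT : set plane) psi -> (forall z, `|psi z| <= K) ->
  L1 D (fun z => u z * psi z).
Proof.
move=> mD Lu mp pK; apply: (integrableMl mD Lu (measurable_funTS mp)).
exists K; split; first exact: num_real.
by move=> x Kx z _ /=; rewrite (le_trans (pK z))// ltW.
Qed.

Lemma L1_CK D u psi : measurable (D : set plane) -> L1 D u -> CK psi ->
  L1 D (fun z => u z * psi z).
Proof.
move=> mD Lu Cp; have [K K0 HK] := CK_bounded Cp.
by apply: L1M HK => //; apply: continuous_measurable_plane; case: Cp.
Qed.

Lemma continuous_sectiony phi (x : R) : continuous phi -> continuous (fun t => phi (x, t)).
Proof.
move=> cp t; apply: (@continuous_comp _ _ _ (fun t => (x, t)) phi); last exact: cp.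
by apply: (@cvg_pair _ _ _ _ (nbhs x) (nbhs t)); [exact: cvg_cst|exact: cvg_id].
Qed.

Lemma CK_pdy phi : Cn 1 phi -> CK phi -> CK (pdy phi).
Proof.
move=> [_ [_ _ _ [cy _]]] [cp [M M0 HM]]; split=> //; exists M => // z.
have [h|] := pselect (`|z.1| <= M /\ `|z.2| <= M); first by [].
move=> h /eqP[]; apply: pdy_near0.
have [h1|h1] := leP `|z.1| M; last first.
  have : \forall w \near z, M < `|w.1|.
    apply/nbhs_boxP; exists (`|z.1| - M); rewrite ?subr_gt0// => w; rewrite boxE => -[kx ky].
    have := lerB_dist z.1 w.1; rewrite distrC; lra.
  by apply: filterS => w Mw; apply/eqP/negPn/negP => /HM []; rewrite leNgt Mw.
have [h2|h2] := leP `|z.2| M; first by case: h.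
have : \forall w \near z, M < `|w.2|.
  apply/nbhs_boxP; exists (`|z.2| - M); rewrite ?subr_gt0// => w; rewrite boxE => -[kx ky].
  have := lerB_dist z.2 w.2; rewrite distrC; lra.
by apply: filterS => w Mw; apply/eqP/negPn/negP => /HM [_]; rewrite leNgt Mw.
Qed.

Lemma integral_pdy phi : Cn 1 phi -> CK phi -> (\int[area]_z (pdy phi z)%:E = 0)%E.
Proof.
move=> C1 Cp; rewrite area_fubini; last by apply: CK_L1; exact: CK_pdy.
apply: integral0_eq => x _.
case: C1 => _ [_ dy _ [cy _]]; case: Cp => cp [M M0 HM].
have fi : mu.-integrable setT (EFin \o derive1 (fun t => phi (x, t))).
  apply: (@vanishes_outside_integrable _ (-M) M).
    exact: (continuous_sectiony (x := x) cy).
  apply: derive1_vanishes => t; rewrite -ler_norml => /negP h.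
  by apply/eqP/negPn/negP => /HM [].
rewrite -[LHS]fineK; last exact: (integrable_fin_num _ fi).
congr EFin; apply: (@integral_derive1 _ (-M) M (fun t => phi (x, t))).
- by move=> t; exact: (dy (x, t)).
- exact: (continuous_sectiony (x := x) cy).
- move=> t; rewrite -ler_norml => /negP h.
  by apply/eqP/negPn/negP => /HM [].
Qed.

Lemma CK_swapf phi : CK phi -> CK (swapf phi).
Proof.
move=> [cp [M M0 HM]]; split; first exact: continuous_swapf.
by exists M => // z /HM [].
Qed.

Lemma CK_pdx phi : Cn 1 phi -> CK phi -> CK (pdx phi).
Proof.
move=> C1 Cp; rewrite -[phi]swapfK pdx_swapf; apply: CK_swapf; apply: CK_pdy.
  exact: Cn_swapf.
exact: CK_swapf.
Qed.

Lemma CKM u phi : continuous u -> CK phi -> CK (fun z => u z * phi z).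
Proof.
move=> cu [cp [M M0 HM]]; split; first by move=> z; apply: cvgM; [exact: cu|exact: cp].
by exists M => // z; rewrite mulf_eq0 negb_or => /andP[_ /HM].
Qed.

Lemma fin_opp (x y : \bar R) : x \is a fin_num -> y \is a fin_num ->
  (x + y = 0 -> x = - y)%E.
Proof.
by case: x => // x; case: y => // y _ _ [] /eqP; rewrite addr_eq0 => /eqP ->.
Qed.

(** The product has bounded support because [phi] does, so the integral of its y-derivative is zero;
    the product rule splits it. *)
Lemma integral_by_parts_y u phi : Cn 1 u -> Cn 1 phi -> CK phi ->
  (\int[area]_z (u z * pdy phi z)%:E = - \int[area]_z (pdy u z * phi z)%:E)%E.
Proof.
move=> Cu Cp Kp; have := integral_pdy (CnM Cu Cp) (CKM (Cn_continuous Cu) Kp).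
rewrite pdyM//.
have i1 : L1 setT (fun z => u z * pdy phi z).
  by apply: CK_L1; apply: CKM; [exact: Cn_continuous Cu|exact: CK_pdy].
have i2 : L1 setT (fun z => phi z * pdy u z).
  rewrite (_ : (fun _ => _) = (fun z => pdy u z * phi z)); last by apply/funext => z; rewrite mulrC.
  by apply: CK_L1; apply: CKM => //; case: Cu => _ [_ _ _ []].
rewrite (integralD_EFin measurableT i1 i2).
under [X in _ = (- X)%E]eq_integral do rewrite mulrC.
have f1 := integrable_fin_num measurableT i1; have f2 := integrable_fin_num measurableT i2.
by move=> h; have := fin_opp f1 f2 h.
Qed.

Lemma integral_by_parts_x u phi : Cn 1 u -> Cn 1 phi -> CK phi ->
  (\int[area]_z (u z * pdx phi z)%:E = - \int[area]_z (pdx u z * phi z)%:E)%E.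
Proof.
move=> Cu Cp Kp.
have := integral_by_parts_y (Cn_swapf Cu) (Cn_swapf Cp) (CK_swapf Kp).
rewrite !pdy_swapf (@area_swap (fun z => (u z * pdx phi z)%:E)).
  rewrite (@area_swap (fun z => (pdx u z * phi z)%:E))//.
  by apply: CK_L1; apply: CKM => //; case: Cu => _ [_ _ []].
by apply: CK_L1; apply: CKM; [exact: Cn_continuous Cu|exact: CK_pdx].
Qed.

End PlaneIntegrals.

(** * Weak derivatives *)

Section WeakDerivatives.
Context {R : realType}.
Notation plane := (measurableTypeR R * measurableTypeR R)%type.
Implicit Types (D G U : set (R * R)) (u v g h phi psi : R * R -> R) (a b : nat).

Lemma ae_areaS (P Q : set (R * R)) : (forall z, P z -> Q z) ->
  {ae area, forall z, P z} -> {ae area, forall z, Q z}.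
Proof. by move=> PQ; apply: negligibleS => z nQ /PQ. Qed.

Lemma ae_areaS2 (P P' Q : set (R * R)) : (forall z, P z -> P' z -> Q z) ->
  {ae area, forall z, P z} -> {ae area, forall z, P' z} -> {ae area, forall z, Q z}.
Proof.
move=> PQ h1 h2; apply: negligibleS (negligibleU h1 h2) => z nQ.
by apply: contrapT => /not_orP[/contrapT h3 /contrapT h4]; apply: nQ; exact: PQ.
Qed.

Lemma eq_onS {V : Type} D G (f g : R * R -> V) : G `<=` D -> eq_on D f g -> eq_on G f g.
Proof. by move=> GD; apply: ae_areaS => z + /GD; apply. Qed.

Lemma eq_on_refl {V : Type} D (f : R * R -> V) : eq_on D f f.
Proof. exact: aeW. Qed.

Lemma eq_on_sym {V : Type} D (f g : R * R -> V) : eq_on D f g -> eq_on D g f.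
Proof. by apply: ae_areaS => z + Dz => /(_ Dz). Qed.

Lemma eq_on_trans {V : Type} D (f g h : R * R -> V) :
  eq_on D f g -> eq_on D g h -> eq_on D f h.
Proof. by apply: ae_areaS2 => z + + Dz => /(_ Dz) -> /(_ Dz). Qed.

Lemma eq_on_pointwise {V : Type} D (f g : R * R -> V) : (forall z, D z -> f z = g z) -> eq_on D f g.
Proof. by move=> h; apply: aeW. Qed.

Lemma eq_on_local {V : Type} D (f g : R * R -> V) :
  (forall x, D x -> exists2 U, nbhs x U & eq_on (D `&` U) f g) -> eq_on D f g.
Proof.
move=> H; apply: (@negligible_local _ (~` [set z | D z -> f z = g z])).
move=> x /not_implyP[Dx fg]; have [U Ux HU] := H _ Dx; exists U => //.
apply: negligibleS HU => z [/not_implyP[Dz fgz] Uz].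
by move=> h; apply: fgz; apply: h.
Qed.

Lemma continuous_eq_on G (f g : R * R -> R) : open G -> continuous f -> continuous g ->
  eq_on G f g -> forall z, G z -> f z = g z.
Proof.
move=> oG cf cg fg z Gz; apply/eqP/negPn/negP => nz.
have oA : open (G `&` [set w | f w - g w != 0]).
  apply: openI => //; apply: (@open_comp _ _ (fun w => f w - g w) [set x | x != 0]).
    by move=> w _; apply: cvgB; [exact: cf|exact: cg].
  exact: open_neq.
have : (G `&` [set w | f w - g w != 0]) = set0.
  apply: open_not_negligible => //; apply: negligibleS fg => w [Gw /= nw].
  by move=> h; move: nw; rewrite h// subrr eqxx.
by move=> /seteqP[/(_ z) + _] => /(_ _)[]; split => //=; rewrite subr_eq0.
Qed.

Lemma integral_restrict D G (h : R * R -> \bar R) : G `<=` D ->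
  (forall z, D z -> ~ G z -> h z = 0%E) ->
  (\int[area]_(z in D) h z = \int[area]_(z in G) h z)%E.
Proof.
move=> GD H; rewrite integral_mkcond [RHS]integral_mkcond; apply: eq_integral => z _.
rewrite /patch; case: ifPn => [/[!inE] Dz|/negP nD]; case: ifPn => [/[!inE] Gz|/negP nG] //.
  by apply: H => // Gz; apply: nG; rewrite inE.
by exfalso; apply: nD; rewrite inE; apply: GD.
Qed.

(** Extended by zero, the two integrands coincide, so the equality holds for any [u]. This moves
    weak derivatives between domains. *)
Lemma integral_test D G u phi : G `<=` D -> test_function G phi ->
  (\int[area]_(z in D) (u z * phi z)%:E = \int[area]_(z in G) (u z * phi z)%:E)%E.
Proof.
move=> GD tp; apply: integral_restrict => // z _ Gz.
by rewrite (@supp_eq0 _ phi) ?mulr0// => sz; apply: Gz; case: tp => _ _; apply.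
Qed.

Lemma test_iter D a b phi : test_function D phi -> test_function D (iter a pdx (iter b pdy phi)).
Proof.
move=> tp; have : test_function D (iter b pdy phi).
  by elim: b => [//|b IH]; exact: test_pdy.
by move=> tb; elim: a => [//|a IH]; exact: test_pdx.
Qed.

Lemma weakS D G a b u g : G `<=` D -> weak_deriv D a b u g -> weak_deriv G a b u g.
Proof.
move=> GD H phi tp; have := H phi (testS GD tp).
by rewrite !(integral_test _ GD)//; exact: test_iter.
Qed.

Lemma fin_sub (x y : \bar R) : y \is a fin_num -> x = y -> (x - y = 0)%E.
Proof. by move=> h ->; exact: subee. Qed.

(** Shown weakly: two integrations by parts move both derivatives onto a tensor product, for which
    they visibly commute. The difference is then zero almost everywhere on a square, and everywhere
    by continuity. *)
Lemma schwarz phi : Cinf phi -> pdx (pdy phi) = pdy (pdx phi).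
Proof.
move=> cp; apply/funext => z.
have C1 := cp 1%N; have Cx := Cinf_pdx cp; have Cy := Cinf_pdy cp.
have cxy := Cinf_continuous (Cinf_pdx Cy); have cyx := Cinf_continuous (Cinf_pdy Cx).
pose h w := pdx (pdy phi) w - pdy (pdx phi) w.
have ch : continuous h by move=> w; apply: cvgB; [exact: cxy|exact: cyx].
pose Q := box z 1.
have mQ : measurable (Q : set plane) := @measurable_rect R _ _ _ _.
suff : eq_on Q h (fun=> 0).
  move=> /(continuous_eq_on (@open_box _ _ _) ch) H.
  have cc : continuous (fun _ : R * R => 0 : R) by move=> w; exact: cvg_cst.
  by have /eqP := H cc z (box_center z ltr01); rewrite subr_eq0 => /eqP.
have Lh : L1 Q h.
  apply: measurable_bounded_integrable => //.
  - by rewrite /= [X in (X < _)%E]area_rect ?ltry//; lra.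
  - by apply: measurable_funTS; exact: continuous_measurable_plane.
  - have [K K0 HK] := rect_bounded (z.1 - 1) (z.1 + 1) (z.2 - 1) (z.2 + 1) ch.
    exists K; split; first exact: num_real.
    move=> x Kx w; rewrite /= /Q /box rectE => -[/andP[h1 h2] /andP[h3 h4]].
    by rewrite (le_trans _ (ltW Kx))// HK// !ltW.
apply: fundamental_rect => // f g bf bg.
have tt := test_tensor bf bg; have Kt := test_CK tt.
have Ct : Cinf (tensor f g) by case: tt.
have Ctx := Cinf_pdx Ct; have Cty := Cinf_pdy Ct.
have Ktx := CK_pdx (Ct 1%N) Kt; have Kty := CK_pdy (Ct 1%N) Kt.
transitivity (\int[area]_w ((pdx (pdy phi) w * tensor f g w)%:E - (pdy (pdx phi) w * tensor f g w)%:E))%E.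
  rewrite -(@integral_test setT Q h (tensor f g))//.
  by apply: eq_integral => w _; rewrite -EFinB -mulrBl.
have I1 : L1 setT (fun w => pdx (pdy phi) w * tensor f g w) by apply: CK_L1; exact: CKM.
have I2 : L1 setT (fun w => pdy (pdx phi) w * tensor f g w) by apply: CK_L1; exact: CKM.
rewrite (integralB_EFin measurableT I1 I2).
have E1 := integral_by_parts_x (Cy 1%N) (Ct 1%N) Kt.
have E2 := integral_by_parts_y (C1) (Ctx 1%N) Ktx.
have E3 := integral_by_parts_y (Cx 1%N) (Ct 1%N) Kt.
have E4 := integral_by_parts_x (C1) (Cty 1%N) Kty.
have sf := bf.1; have sg := bg.1.
have S : pdy (pdx (tensor f g)) = pdx (pdy (tensor f g)).
  rewrite pdx_tensor; last by move=> x; exact: smooth_derivable.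
  rewrite !pdy_tensor; [|by move=> x; exact: smooth_derivable..].
  by rewrite pdx_tensor// => x; exact: smooth_derivable.
have A : (\int[area]_w (pdx (pdy phi) w * tensor f g w)%:E =
          \int[area]_w (phi w * pdy (pdx (tensor f g)) w)%:E)%E.
  by rewrite E2 E1 oppeK.
have B : (\int[area]_w (pdy (pdx phi) w * tensor f g w)%:E =
          \int[area]_w (phi w * pdy (pdx (tensor f g)) w)%:E)%E.
  by rewrite S E4 E3 oppeK.
have F : (\int[area]_w (pdy (pdx phi) w * tensor f g w)%:E)%E \is a fin_num.
  by have := integrable_fin_num measurableT I2.
suff : (\int[area]_w (pdx (pdy phi) w * tensor f g w)%:E -
        \int[area]_w (pdy (pdx phi) w * tensor f g w)%:E = 0)%E by [].
have E := etrans A (esym B).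
exact (fin_sub F E).
Qed.

Lemma iter_comm phi a b : Cinf phi ->
  iter a pdx (iter b pdy phi) = iter b pdy (iter a pdx phi) /\ Cinf (iter a pdx (iter b pdy phi)).
Proof.
have S b' psi : Cinf psi -> pdx (iter b' pdy psi) = iter b' pdy (pdx psi).
  by move=> c; elim: b' => //= n IH; rewrite schwarz ?IH//; exact: Cinf_iter_pdy.
move=> c; split; last by apply: Cinf_iter_pdx; exact: Cinf_iter_pdy.
by elim: a => //= n ->; rewrite S//; exact: Cinf_iter_pdx.
Qed.

Lemma iter_add phi a b a' b' : Cinf phi ->
  iter a pdx (iter b pdy (iter a' pdx (iter b' pdy phi))) =
  iter (a + a') pdx (iter (b + b') pdy phi).
Proof.
by move=> c; rewrite -(proj1 (iter_comm a' b (Cinf_iter_pdy b' c))) !iterD.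
Qed.

Lemma signeK n (x : \bar R) : (((-1) ^+ n)%:E * (((-1) ^+ n)%:E * x) = x)%E.
Proof. by rewrite muleA -EFinM -expr2 sqrr_sign mul1e. Qed.

(** In [weak_deriv] all x-derivatives are applied after all y-derivatives; orders add up only
    because [iter_add] commutes them. *)
Lemma weak_comp D a b a' b' u g h : weak_deriv D a b u g -> weak_deriv D a' b' g h ->
  weak_deriv D (a + a') (b + b') u h.
Proof.
move=> H1 H2 phi tp; rewrite -iter_add; last by case: tp.
rewrite H1; last exact: test_iter.
by rewrite H2// muleA -EFinM -exprD addnACA.
Qed.

(** The composition read backwards: the hypothesis on [g] is applied to a derivative of the test
    function. It supplies derivatives of a derivative of [u] from higher derivatives of [u]. *)
Lemma weak_cancel D a b a' b' u g h : weak_deriv D a b u g ->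
  weak_deriv D (a + a') (b + b') u h -> weak_deriv D a' b' g h.
Proof.
move=> H1 H2 phi tp; have := H2 phi tp; rewrite -iter_add; last by case: tp.
rewrite H1; last exact: test_iter.
rewrite (_ : (-1) ^+ (a + a' + (b + b')) = (-1) ^+ (a + b) * (-1) ^+ (a' + b') :> R); last first.
  by rewrite addnACA exprD.
rewrite EFinM -muleA => /(congr1 (fun x => ((-1) ^+ (a + b))%:E * x)%E).
by rewrite !signeK.
Qed.

Lemma weak_linear D a b (c : R) u v g h : open D -> L1 D u -> L1 D v -> L1 D g -> L1 D h ->
  weak_deriv D a b u g -> weak_deriv D a b v h ->
  weak_deriv D a b (fun z => c * u z + v z) (fun z => c * g z + h z).
Proof.
move=> oD Lu Lv Lg Lh H1 H2 phi tp; have mD := open_measurable_plane oD.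
have key w w' psi : L1 D w -> L1 D w' -> test_function D psi ->
    (\int[area]_(z in D) ((c * w z + w' z) * psi z)%:E =
     c%:E * \int[area]_(z in D) (w z * psi z)%:E + \int[area]_(z in D) (w' z * psi z)%:E)%E.
  move=> Lw Lw' tpsi; have Kp := test_CK tpsi.
  have L' := L1_CK mD Lw Kp; have L'' := L1_CK mD Lw' Kp.
  rewrite -(integralZl mD L') -(integralD mD (integrableZl mD c L') L'').
  by apply: eq_integral => z _; rewrite -EFinM -EFinD mulrDl mulrA.
rewrite !key//; last exact: test_iter.
rewrite H1// H2//; have Kp := test_CK tp.
have := integrable_fin_num mD (L1_CK mD Lg Kp).
have := integrable_fin_num mD (L1_CK mD Lh Kp).
move: (\int[area]_(z in D) _)%E (\int[area]_(z in D) _)%E => [x||] [y||] // _ _.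
have E : c * ((-1) ^+ (a + b) * y) + (-1) ^+ (a + b) * x = (-1) ^+ (a + b) * (c * y + x).
  by rewrite mulrDr mulrCA.
exact: (congr1 EFin E).
Qed.

Lemma weak_eq D a b u v g h : open D -> L1 D u -> L1 D v -> L1 D g -> L1 D h ->
  eq_on D u v -> eq_on D g h -> weak_deriv D a b u g -> weak_deriv D a b v h.
Proof.
move=> oD Lu Lv Lg Lh uv gh H phi tp; have mD := open_measurable_plane oD.
have key w w' psi : L1 D w -> L1 D w' -> eq_on D w w' -> test_function D psi ->
    (\int[area]_(z in D) (w z * psi z)%:E = \int[area]_(z in D) (w' z * psi z)%:E)%E.
  move=> Lw Lw' ww tpsi; have Kp := test_CK tpsi.
  apply: ae_eq_integral => //.
  - exact: measurable_int (L1_CK mD Lw Kp).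
  - exact: measurable_int (L1_CK mD Lw' Kp).
  - by move: ww; apply: ae_areaS => z /[apply] ->.
rewrite -(key u v)//; last exact: test_iter.
by rewrite -(key g h)// H.
Qed.

(** The two functions have the same pairing with every test function, so they agree on small squares
    by [fundamental_rect], and countably many squares cover [D]. *)
Lemma weak_unique D a b u g h : open D -> L1 D g -> L1 D h ->
  weak_deriv D a b u g -> weak_deriv D a b u h -> eq_on D g h.
Proof.
move=> oD Lg Lh H1 H2; have mD := open_measurable_plane oD.
have key phi : test_function D phi ->
    (\int[area]_(z in D) (g z * phi z)%:E = \int[area]_(z in D) (h z * phi z)%:E)%E.
  move=> tp; have := H1 _ tp; rewrite H2// => /(congr1 (fun x => ((-1) ^+ (a + b))%:E * x)%E).
  by rewrite !signeK => ->.
apply: eq_on_local => x Dx; move: (oD); rewrite openE => /(_ _ Dx) /nbhs_boxP[r r0 rD].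
exists (box x r); first exact: nbhs_box.
rewrite setIidr//.
have mB : measurable (box x r : set plane) := @measurable_rect R _ _ _ _.
have Lg' : L1 (box x r) g := integrableS mD mB rD Lg.
have Lh' : L1 (box x r) h := integrableS mD mB rD Lh.
have L : L1 (box x r) (fun z => g z - h z) := integrableB mB Lg' Lh'.
have : eq_on (box x r) (fun z => g z - h z) (fun=> 0).
  apply: fundamental_rect => // f1 f2 b1 b2; have tt := test_tensor b1 b2.
  have Kt := test_CK tt.
  have I1 := L1_CK mB Lg' Kt; have I2 := L1_CK mB Lh' Kt.
  under eq_integral do rewrite mulrBl EFinB.
  rewrite (integralB_EFin mB I1 I2) -(integral_test g rD tt) -(integral_test h rD tt).
  have F := integrable_fin_num mD (L1_CK mD Lh Kt).
  by rewrite key ?subee//; exact: testS rD tt.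
by apply: ae_areaS => z /[apply] /eqP; rewrite subr_eq0 => /eqP.
Qed.

End WeakDerivatives.

(** * Weak derivatives from local to global *)

Section Localisation.
Context {R : realType}.
Notation mu := (@lebesgue_measure R).
Implicit Types (D G U : set (R * R)) (u v g h phi psi : R * R -> R) (a b : nat).

Lemma CinfN phi : Cinf phi -> Cinf (fun z => 1 - phi z).
Proof.
move=> cp; rewrite (_ : (fun z => _) = fun z => 1 + (-1) * phi z); last first.
  by apply/funext => z; rewrite mulN1r.
by apply: CinfD; [|apply: CinfM => //]; exact: Cinf_cst.
Qed.

Lemma iterD_test a b phi psi : Cinf phi -> Cinf psi ->
  iter a pdx (iter b pdy (fun z => phi z + psi z)) =
  (fun z => iter a pdx (iter b pdy phi) z + iter a pdx (iter b pdy psi) z).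
Proof.
move=> c1 c2.
have -> : iter b pdy (fun z => phi z + psi z) = (fun z => iter b pdy phi z + iter b pdy psi z).
  elim: b => [//|b IH] /=; rewrite IH pdyD//; exact: (@Cinf_iter_pdy _ b _ _ 1%N).
elim: a => [//|a IH] /=; rewrite IH pdxD//; apply: (@Cinf_iter_pdx _ a _ _ 1%N); exact: Cinf_iter_pdy.
Qed.

Lemma compact_box_cover (K : set (R * R)) (r : R * R -> R) : compact K ->
  (forall x, K x -> 0 < r x) ->
  exists2 s : seq (R * R), (forall x, x \in s -> K x) &
    forall z, K z -> exists2 x, x \in s & box x (r x) z.
Proof.
move=> /compact_near_coveringP cK r0.
(* Compactness is used as near covering, along the filter of finite sequences in which a property is
   eventual when it holds for all sequences containing a given one. *)
pose F : set_system (seq (R * R)) :=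
  filter_from setT (fun s0 : seq (R * R) => [set s : seq (R * R) | forall x, x \in s0 -> x \in s]).
have FF : Filter F.
  apply: filter_from_filter; first by exists [::].
  move=> s1 s2 _ _; exists (s1 ++ s2) => // s /= h.
  by split=> x xs; apply: h; rewrite mem_cat xs ?orbT.
have := cK _ F (fun s z => exists x, [/\ x \in s, K x & box x (r x) z]) FF.
case.
  move=> x Kx; exists (box x (r x), [set s | x \in s]) => /=.
    split; first exact: nbhs_box (r0 _ Kx).
    by exists [:: x] => // s /= h; apply: h; rewrite mem_head.
  by move=> [z s] /= [h1 h2]; exists x.
move=> s0 _ H; exists [seq x <- s0 | `[< K x >]].
  by move=> x; rewrite mem_filter => /andP[/asboolP].
move=> z Kz; have [x [xs Kx xz]] := H s0 (fun=> id) z Kz.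
by exists x => //; rewrite mem_filter xs andbT; apply/asboolP.
Qed.

(** A partition of unity without its sum: each [p x] is 1 on a half-size square, and finitely many
    of these squares cover the support of [phi], so [phi] times the product of the 1 - p x is zero,
    a case in which the identity is trivial. *)
Lemma weak_deriv_local D a b u g : open D -> L1 D u -> L1 D g ->
  (forall x, D x -> exists r, [/\ 0 < r, box x r `<=` D & weak_deriv (box x r) a b u g]) ->
  weak_deriv D a b u g.
Proof.
move=> oD Lu Lg H; have mD := open_measurable_plane oD.
pose ok phi := (\int[area]_(z in D) (u z * iter a pdx (iter b pdy phi) z)%:E =
     ((-1) ^+ (a + b))%:E * \int[area]_(z in D) (g z * phi z)%:E)%E.
have okD phi psi : test_function D phi -> test_function D psi -> ok phi -> ok psi ->
    ok (fun z => phi z + psi z).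
  move=> t1 t2 o1 o2; rewrite /ok iterD_test; [|by case: t1|by case: t2].
  have s1 := test_iter a b t1; have s2 := test_iter a b t2.
  have key w p q : L1 D w -> test_function D p -> test_function D q ->
      (\int[area]_(z in D) (w z * (p z + q z))%:E =
       \int[area]_(z in D) (w z * p z)%:E + \int[area]_(z in D) (w z * q z)%:E)%E.
    move=> Lw tp tq.
    rewrite -(integralD mD (L1_CK mD Lw (test_CK tp)) (L1_CK mD Lw (test_CK tq))).
    by apply: eq_integral => z _; rewrite -EFinD mulrDr.
  rewrite !key// o1 o2.
  have := integrable_fin_num mD (L1_CK mD Lg (test_CK t1)).
  have := integrable_fin_num mD (L1_CK mD Lg (test_CK t2)).
  move: (\int[area]_(z in D) _)%E (\int[area]_(z in D) _)%E => [x||] [y||] // _ _.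
  by apply: (congr1 EFin); rewrite mulrDr.
have /choice[r Hr] : forall x, exists r, D x -> [/\ 0 < r, box x r `<=` D & weak_deriv (box x r) a b u g].
  move=> x; have [Dx|nDx] := pselect (D x); last by exists 0.
  by have [r rP] := H _ Dx; exists r.
have /choice[p Hp] : forall x, exists p, D x -> test_function (box x (r x)) p /\
    forall z, box x (r x / 2) z -> p z = 1.
  move=> x; have [Dx|nDx] := pselect (D x); last by exists (fun=> 0).
  have [r0 _ _] := Hr _ Dx.
  have [f bf f1] : exists2 f, bump_in (x.1 - r x) (x.1 + r x) f &
    forall t : R, x.1 - r x / 2 <= t <= x.1 + r x / 2 -> f t = 1 by apply: plateau; lra.
  have [k bk k1] : exists2 k, bump_in (x.2 - r x) (x.2 + r x) k &
    forall t : R, x.2 - r x / 2 <= t <= x.2 + r x / 2 -> k t = 1 by apply: plateau; lra.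
  exists (tensor f k) => _; split; first exact: test_tensor.
  move=> z; rewrite /box rectE => -[/andP[h1 h2] /andP[h3 h4]].
  by rewrite /tensor f1 ?k1 ?mulr1//; apply/andP; split; lra.
move=> phi tp; rewrite -/(ok phi).
(* Each factor is removed by psi = psi (1 - p x) + psi p x: the second term is supported in one
   square, where the local hypothesis applies. *)
have red (s : seq (R * R)) psi : (forall x, x \in s -> D x) -> test_function D psi ->
    ok (fun z => psi z * \prod_(x <- s) (1 - p x z)) -> ok psi.
  elim: s psi => [|x s IH] psi sD tpsi.
    by congr ok; apply/funext => z; rewrite big_nil mulr1.
  have Dx : D x by apply: sD; rewrite mem_head.
  have [r0 rD wx] := Hr _ Dx; have [tx _] := Hp _ Dx.
  move=> o; have tN : test_function D (fun z => psi z * (1 - p x z)).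
    by apply: test_mulr => //; apply: CinfN; case: tx.
  have t1 : test_function (box x (r x)) (fun z => psi z * p x z).
    by apply: test_mull => //; case: tpsi.
  have -> : psi = (fun z => psi z * (1 - p x z) + psi z * p x z).
    by apply/funext => z; lra.
  apply: okD => //; first exact: testS t1.
    apply: IH => //; first by move=> y ys; apply: sD; rewrite inE ys orbT.
    by move: o; congr ok; apply/funext => z; rewrite big_cons mulrA.
  rewrite /ok (integral_test _ rD (test_iter a b t1)) (integral_test _ rD t1).
  exact: wx.
have [_ cs sD] := tp.
have r20 x : supp phi x -> 0 < r x / 2.
  by move=> /sD Dx; have [r0 _ _] := Hr _ Dx; rewrite divr_gt0.
have [s ss cov] := compact_box_cover cs r20.
apply: (red s) => //.
  by move=> x /ss /sD.
rewrite (_ : (fun z => _) = fun=> 0).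
  have Z : forall c d, iter c pdx (iter d pdy (fun _ : R * R => 0 : R)) = fun=> 0.
    have Zx : pdx (fun _ : R * R => 0 : R) = fun=> 0.
      by apply/funext => z; rewrite /pdx derive1_cst.
    have Zy : pdy (fun _ : R * R => 0 : R) = fun=> 0.
      by apply/funext => z; rewrite /pdy derive1_cst.
    move=> c d; have -> : iter d pdy (fun _ : R * R => 0 : R) = fun=> 0.
      by elim: d => //= d ->.
    by elim: c => //= c ->.
  by rewrite /ok Z !integral0_eq ?mule0// => z _; rewrite mulr0.
apply/funext => z; have [sz|/supp_eq0 ->] := pselect (supp phi z); last by rewrite mul0r.
have [x xs xz] := cov _ sz.
have Dx : D x := sD _ (ss _ xs).
rewrite (big_rem x)//= (proj2 (Hp _ Dx)) ?subrr ?mul0r ?mulr0//.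
Qed.

(** Du Bois-Reymond's decomposition: subtracting from [f] its integral times [rho] leaves integral
    zero, hence the derivative of a bump. *)
Lemma bump_split (a b : R) (rho f : R -> R) : bump_in a b rho -> \int[mu]_x rho x = 1 ->
  bump_in a b f -> exists2 F, bump_in a b F &
    forall x, f x = (\int[mu]_y f y) * rho x + derive1 F x.
Proof.
move=> br r1 bf; pose c := \int[mu]_y f y.
have bg := bump_comb (- c) bf br.
have [|F bF F'] := bump_primitive0 bg.
  have If := bump_integrable bf; have Ir := bump_integrable br.
  rewrite RintegralD//; last exact: (integrableZl measurableT (- c) Ir).
  by rewrite RintegralZl// r1 mulr1 subrr.
by exists F => // x; rewrite F' -/c; lra.
Qed.

Lemma Rintegral_tensor (f g : R -> R) :
  mu.-integrable setT (EFin \o f) -> mu.-integrable setT (EFin \o g) ->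
  L1 setT (tensor f g) ->
  (\int[area]_z (tensor f g z)%:E = (\int[mu]_x f x * \int[mu]_y g y)%:E)%E.
Proof.
move=> If Ig L; rewrite area_fubini//=.
transitivity (\int[mu]_x ((\int[mu]_y g y)%R%:E * (f x)%:E))%E.
  apply: eq_integral => x _; rewrite /tensor /= muleC /Rintegral fineK; last first.
    exact: (integrable_fin_num measurableT Ig).
  rewrite -(integralZl measurableT Ig); apply: eq_integral => y _.
  by rewrite -EFinM.
rewrite (integralZl measurableT If).
have -> : (\int[mu]_x (EFin \o f) x)%E = (\int[mu]_x f x)%R%:E.
  by rewrite /Rintegral fineK//; exact: (integrable_fin_num measurableT If).
by rewrite -EFinM mulrC.
Qed.

End Localisation.

(** * Potentials on rectangles *)

Section Potentials.
Context {R : realType}.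
Notation plane := (measurableTypeR R * measurableTypeR R)%type.
Notation mu := (@lebesgue_measure R).
Implicit Types (D G U : set (R * R)) (u v w g h phi psi : R * R -> R) (f k : R -> R).

(** Tonelli yields measurability for nonnegative integrands, so the positive and negative parts are
    integrated separately. *)
Lemma measurable_param {d} {T : measurableType d} (H : T * measurableTypeR R -> R) :
  measurable_fun setT H -> measurable_fun setT (fun p => \int[mu]_s H (p, s)).
Proof.
move=> mH; have mE : measurable_fun setT (EFin \o H) by exact/measurable_EFinP.
apply: (measurableT_comp (@fine_measurable R setT measurableT)).
rewrite (_ : (fun _ => _) = (fun p => \int[mu]_s (EFin \o H)^\+ (p, s)) \-
   (fun p => \int[mu]_s (EFin \o H)^\- (p, s)))%E; last first.
  apply/funext => p /=; rewrite [LHS]integralE; congr (_ - _)%E; apply: eq_integral => s _.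
    by rewrite !funeposE.
  by rewrite !funenegE.
apply: emeasurable_funB; apply: measurable_fun_fubini_tonelli_F => //.
  exact: measurable_funepos.
exact: measurable_funeneg.
Qed.

(** Here and in [bdd2] one constant bounds both the values and the support, so that a single
    hypothesis yields integrability, also of sections, and Fubini. *)
Definition bdd1 (M : R) f := [/\ measurable_fun (setT : set (measurableTypeR R)) f,
  forall s, `|f s| <= M & forall s, f s != 0 -> `|s| <= M].

Definition bdd2 (M : R) v := [/\ measurable_fun (setT : set plane) v,
  forall z, `|v z| <= M & forall z, v z != 0 -> `|z.1| <= M /\ `|z.2| <= M].

Lemma bdd1_itv (M : R) f : bdd1 M f -> EFin \o f = (EFin \o f) \_ `[-M, M].
Proof.
move=> [_ _ fs]; apply/funext => s; rewrite /patch; case: ifPn => // /negP sI /=.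
have [->//|/fs sM] := eqVneq (f s) 0; exfalso; apply: sI.
by rewrite inE /= in_itv /= -ler_norml.
Qed.

Lemma bdd1_integrable (M : R) f : bdd1 M f -> mu.-integrable setT (EFin \o f).
Proof.
move=> B; rewrite (bdd1_itv B); case: B => mf fM fs.
apply: (@integrable_mkcond _ _ _ mu `[-M, M] (EFin \o f) (measurable_itv _)).1.
apply: measurable_bounded_integrable => //.
- by rewrite /= lebesgue_measure_itv /=; case: ifP; rewrite ?ltry// -EFinB ltry.
- exact: measurable_funTS.
- exists M; split; first exact: num_real.
  by move=> x Mx z _ /=; rewrite (le_trans (fM z))// ltW.
Qed.

(** [M + M] is the length of the interval that carries [f]. *)
Lemma bdd1_integral (M : R) f : 0 < M -> bdd1 M f -> `|\int[mu]_s f s| <= M * (M + M).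
Proof.
move=> M0 B; have If := bdd1_integrable B.
apply: (le_trans (le_normr_Rintegral measurableT If)).
have -> : \int[mu]_s `|f s| = \int[mu]_(s in `[-M, M]) `|f s|.
  rewrite [RHS]Rintegral_mkcond; apply: eq_Rintegral => s _.
  have := bdd1_itv B => /(congr1 (fun F => F s)); rewrite /patch /=.
  by case: ifP => // _ [->]; rewrite normr0.
have In : mu.-integrable `[-M, M] (EFin \o (fun s => `|f s|)).
  by apply: integrableS (integrable_norm If) => //; exact: measurable_itv.
have Ic : mu.-integrable `[-M, M] (EFin \o (fun=> M)).
  apply: continuous_compact_integrable; first exact: segment_compact.
  by apply: continuous_subspaceT => s; exact: cvg_cst.
have [_ fM _] := B.
have LE : \int[mu]_(s in `[-M, M]) `|f s| <= \int[mu]_(s in `[-M, M]) M.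
  by apply: le_Rintegral In Ic _ => //; exact: measurable_itv.
apply: (le_trans LE).
rewrite Rintegral_cst; last exact: measurable_itv.
rewrite [fine _](_ : _ = M + M)//.
rewrite /= lebesgue_measure_itv /= lte_fin ifT; last by lra.
by rewrite -EFinB /= opprK.
Qed.

Lemma measurable_pairl (x : R) : measurable_fun (setT : set (measurableTypeR R)) (fun t => (x, t) : plane).
Proof. exact: measurable_fun_pair. Qed.

Lemma bdd2_sectiony (M x : R) v : bdd2 M v -> bdd1 M (fun t => v (x, t)).
Proof.
move=> [mv vM vs]; split=> //; last by move=> s /vs [].
by apply: (measurableT_comp mv); exact: measurable_pairl.
Qed.

Lemma bdd2_swapf (M : R) v : bdd2 M v -> bdd2 M (swapf v).
Proof.
move=> [mv vM vs]; split; [|by move=> z; exact: vM|by move=> z /vs []].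
by apply: (measurableT_comp mv); exact: measurable_swap.
Qed.

Lemma bdd2_L1 (M : R) v : 0 < M -> bdd2 M v -> L1 setT v.
Proof. by move=> M0 [mv vM vs]; exact: (L1_bounded_support mv M0 vM vs). Qed.

Lemma CK_bdd2 phi : CK phi -> exists2 M : R, 0 < M & bdd2 M phi.
Proof.
move=> Cp; have [K K0 HK] := CK_bounded Cp; case: Cp => cp [M M0 HM].
exists (Num.max K M); first by rewrite lt_max K0.
split; [exact: continuous_measurable_plane|by move=> z; rewrite le_max HK|].
by move=> z /HM [h1 h2]; rewrite !le_max h1 h2 !orbT.
Qed.

Lemma bdd2M (M K : R) v g : 0 < M -> bdd2 M v -> measurable_fun (setT : set plane) g ->
  0 < K -> (forall z, `|g z| <= K) -> bdd2 (Num.max M (M * K)) (fun z => v z * g z).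
Proof.
move=> M0 [mv vM vs] mg K0 gK; split.
- exact: measurable_funM.
- move=> z; rewrite le_max; apply/orP; right.
  by rewrite normrM ler_pM.
- by move=> z; rewrite mulf_eq0 negb_or => /andP[/vs [h1 h2] _]; rewrite !le_max h1 h2.
Qed.

(** The vertical primitive from minus infinity. With the half-line as a factor, the integrand is
    jointly measurable in z and s. *)
Definition primy v : R * R -> R := fun z => \int[mu]_s ((s < z.2)%R%:R * v (z.1, s)).

Lemma measurable_ltR {d} {T : measurableType d} (p q : T -> R) :
  measurable_fun setT p -> measurable_fun setT q ->
  measurable_fun setT (fun t => (p t < q t)%R%:R : R).
Proof.
move=> mp mq; have mA : measurable [set t | p t < q t].
  have := measurable_fun_ltr mp mq => /(_ measurableT [set true]).
  by rewrite setTI => h; apply: h.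
rewrite (_ : (fun _ => _) = \1_[set t | p t < q t]); first exact: measurable_indic.
by apply/funext => z; rewrite indicE; congr (_%:R); congr nat_of_bool; apply/idP/idP; rewrite inE.
Qed.

Lemma primy_measurable v : measurable_fun (setT : set plane) v ->
  measurable_fun (setT : set plane) (primy v).
Proof.
move=> mv.
apply: (@measurable_param _ plane (fun q : plane * measurableTypeR R =>
   (q.2 < q.1.2)%R%:R * v (q.1.1, q.2))).
have m1 : measurable_fun setT (fun q : plane * measurableTypeR R => q.1) by exact: measurable_fst.
have m2 : measurable_fun setT (fun q : plane * measurableTypeR R => q.2) by exact: measurable_snd.
have m11 : measurable_fun setT (fun q : plane * measurableTypeR R => q.1.1).
  by apply: (measurableT_comp measurable_fst m1).
have m12 : measurable_fun setT (fun q : plane * measurableTypeR R => q.1.2).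
  by apply: (measurableT_comp measurable_snd m1).
apply: measurable_funM.
  exact: measurable_ltR.
exact: (measurableT_comp mv (measurable_fun_pair m11 m2)).
Qed.

Lemma bdd1_mul (M : R) f k : bdd1 M f -> measurable_fun (setT : set (measurableTypeR R)) k ->
  (forall s, `|k s| <= 1) -> bdd1 M (fun s => k s * f s).
Proof.
move=> [mf fM fs] mk k1; split; first exact: measurable_funM.
- by move=> s; rewrite normrM -[M]mul1r ler_pM.
- by move=> s; rewrite mulf_eq0 negb_or => /andP[_ /fs].
Qed.

Lemma bdd1_halfline (M y : R) f : bdd1 M f -> bdd1 M (fun s => (s < y)%R%:R * f s).
Proof.
move=> B; apply: bdd1_mul B _ _; first exact: measurable_ltR.
by move=> s; case: (s < y); rewrite ?normr1 ?normr0.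
Qed.

Lemma primy_bounded (M : R) v : 0 < M -> bdd2 M v -> forall z, `|primy v z| <= M * (M + M).
Proof.
move=> M0 B z; apply: bdd1_integral => //.
by apply: bdd1_halfline; exact: bdd2_sectiony.
Qed.

Lemma Rarea_fubini (M : R) v : 0 < M -> bdd2 M v ->
  \int[area]_z v z = \int[mu]_x \int[mu]_y v (x, y).
Proof.
move=> M0 B; have L := bdd2_L1 M0 B.
have Ex : (\int[mu]_x (\int[mu]_y v (x, y))%R%:E = \int[mu]_x \int[mu]_y (v (x, y))%:E)%E.
  apply: eq_integral => x _; rewrite fineK//.
  exact: (integrable_fin_num measurableT (bdd1_integrable (bdd2_sectiony x B))).
exact (congr1 fine (etrans (area_fubini L) (esym Ex))).
Qed.

Lemma Rintegral_fubini (M : R) v : 0 < M -> bdd2 M v ->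
  \int[mu]_x \int[mu]_y v (x, y) = \int[mu]_y \int[mu]_x v (x, y).
Proof.
move=> M0 B; rewrite -(Rarea_fubini M0 B) -(Rarea_fubini M0 (bdd2_swapf B)).
exact: (congr1 fine (esym (area_swap (bdd2_L1 M0 B)))).
Qed.

(** Integration by parts on a vertical line for a merely measurable [v]: after exchanging the two
    integrals, the derivative of [phi] is integrated over y > s, which gives -phi(x, s). *)
Lemma primy_section (M x : R) v phi D : 0 < M -> bdd2 M v -> test_function D phi ->
  \int[mu]_y (primy v (x, y) * pdy phi (x, y)) = \int[mu]_s (- 1 * (v (x, s) * phi (x, s))).
Proof.
move=> M0 B tp; have Cp := test_CK tp; have C1 : Cn 1 phi by case: tp.
have [K K0 BK] := CK_bdd2 (CK_pdy C1 Cp).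
have BKx := bdd2_sectiony x BK; have Bx := bdd2_sectiony x B.
pose H (q : plane) : R := (q.2 < q.1)%R%:R * v (x, q.2) * pdy phi (x, q.1).
have mH : measurable_fun (setT : set plane) H.
  apply: measurable_funM; first apply: measurable_funM.
  - by apply: measurable_ltR; [exact: measurable_snd|exact: measurable_fst].
  - by case: Bx => mx _ _; apply: (measurableT_comp mx); exact: measurable_snd.
  - by case: BKx => mx _ _; apply: (measurableT_comp mx); exact: measurable_fst.
(* [M * K] bounds the values of [H]; [M] and [K] bound its support in s and in y. *)
pose N := Num.max (Num.max M K) (M * K).
have N0 : 0 < N by rewrite !lt_max M0.
have BH : bdd2 N H.
  split=> //.
  - move=> q; rewrite /H !normrM !le_max; apply/orP; right.
    apply: ler_pM => //; last by case: BKx.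
    case: (q.2 < q.1) => /=; last by rewrite normr0 mul0r ltW.
    by rewrite normr1 mul1r; case: Bx.
  - move=> q; rewrite /H !mulf_eq0 !negb_or => /andP[/andP[_ h1] h2].
    case: Bx => _ _ /(_ _ h1) k1; case: BKx => _ _ /(_ _ h2) k2.
    by rewrite !le_max k1 k2 !orbT.
transitivity (\int[mu]_y \int[mu]_s H (y, s)).
  apply: eq_Rintegral => y _; rewrite /primy.
  rewrite -(RintegralZr _ measurableT (bdd1_integrable (bdd1_halfline y Bx))).
  exact: eq_Rintegral.
rewrite (Rintegral_fubini N0 BH).
have vphi (t : R) : phi (x, t) = (fun t => phi (x, t)) t by [].
have [cp [L L0 HL]] := Cp.
have vo : vanishes_outside (- L) L (fun t => phi (x, t)).
  by move=> t; rewrite -ler_norml => h; apply/eqP/negPn/negP => /HL [_]; exact/negP.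
have dphi (t : R) : derivable (fun t => phi (x, t)) t 1.
  by case: C1 => _ [_ dy _ _]; exact: (dy (x, t)).
have cphi : continuous (derive1 (fun t => phi (x, t))).
  by case: C1 => _ [_ _ _ [cy _]]; exact: (continuous_sectiony (x := x) cy).
apply: eq_Rintegral => s _.
transitivity (v (x, s) * \int[mu]_y ((s < y)%R%:R * derive1 (fun t => phi (x, t)) y)).
  rewrite -RintegralZl//.
    by apply: eq_Rintegral => y _; rewrite /H /= mulrA [X in X * _]mulrC.
  have B1 : bdd1 K (fun y => (s < y)%R%:R * pdy phi (x, y)).
    apply: bdd1_mul BKx _ _; first exact: measurable_ltR.
    by move=> y; case: (s < y); rewrite ?normr1 ?normr0.
  exact: (bdd1_integrable B1).
by rewrite (integral_halfline_derive1 _ dphi cphi vo); lra.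
Qed.

Lemma primy_weak (M : R) v D : 0 < M -> bdd2 M v -> weak_deriv D 0 1 (primy v) v.
Proof.
move=> M0 B phi tp /=; rewrite expr1 mulN1e.
have Cp := test_CK tp; have C1 : Cn 1 phi by case: tp.
have Cy := CK_pdy C1 Cp.
have [mv _ _] := B.
rewrite -(@integral_test _ setT D (primy v) (pdy phi))//; last exact: test_pdy.
rewrite -(@integral_test _ setT D v phi)//.
have [K K0 [mK bK sK]] := CK_bdd2 Cy; have [K' K'0 [mp bp sp]] := CK_bdd2 Cp.
have PB := primy_bounded M0 B; have MM : 0 < M * (M + M) by rewrite mulr_gt0// addr_gt0.
have B1 := bdd2M K0 (And3 mK bK sK) (primy_measurable mv) MM PB.
have B2 := bdd2M M0 B mp K'0 bp.
have L1' : L1 setT (fun z => primy v z * pdy phi z).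
  rewrite (_ : (fun _ => _) = (fun z => pdy phi z * primy v z)); last by apply/funext => z; rewrite mulrC.
  by apply: bdd2_L1 B1; rewrite lt_max K0.
have L2' : L1 setT (fun z => v z * phi z) by apply: bdd2_L1 B2; rewrite lt_max M0.
have L3 : L1 setT (fun z => -1 * (v z * phi z)) := integrableZl measurableT (-1) L2'.
transitivity (\int[area]_z (-1 * (v z * phi z))%:E)%E; last first.
  by under eq_integral do rewrite EFinM; rewrite (integralZl measurableT L2') mulN1e.
rewrite (area_fubini L1') (area_fubini L3); apply: eq_integral => x _.
have E := congr1 EFin (primy_section x M0 B tp).
rewrite /Rintegral !fineK// in E.
  have h := bdd1_integrable (bdd2_sectiony x B2).
  exact: (integrable_fin_num measurableT (integrableZl measurableT (-1) h)).
have h := bdd1_integrable (bdd2_sectiony x B1).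
rewrite (_ : (fun y => _) = (EFin \o (fun t => pdy phi (x, t) * primy v (x, t)))).
  exact: (integrable_fin_num measurableT h).
by apply/funext => y /=; rewrite mulrC.
Qed.

End Potentials.

(** * Weak derivatives of primitives, and functions with zero gradient *)

Section LocalPotential.
Context {R : realType}.
Notation plane := (measurableTypeR R * measurableTypeR R)%type.
Notation mu := (@lebesgue_measure R).
Implicit Types (D G U : set (R * R)) (u v w phi psi : R * R -> R).

(** The class of the primitives, which do not inherit the bounded support of the integrand. *)
Definition bm (K : R) u := measurable_fun (setT : set plane) u /\ forall z, `|u z| <= K.

Lemma bm_CK (K : R) u psi : 0 < K -> bm K u -> CK psi ->
  exists2 M : R, 0 < M & bdd2 M (fun z => u z * psi z).
Proof.
move=> K0 [mu_ uK] Cp; have [M M0 BM] := CK_bdd2 Cp.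
exists (Num.max M (M * K)); first by rewrite lt_max M0.
rewrite (_ : (fun z => _) = (fun z => psi z * u z)); first exact: bdd2M.
by apply/funext => z; rewrite mulrC.
Qed.

Lemma bm_CK_L1 (K : R) u psi : 0 < K -> bm K u -> CK psi -> L1 setT (fun z => u z * psi z).
Proof. by move=> K0 Bu Cp; have [M M0 /(bdd2_L1 M0)] := bm_CK K0 Bu Cp. Qed.

Lemma bm_L1 (K : R) u D : open D -> (area D < +oo)%E -> bm K u -> L1 D u.
Proof.
move=> oD fD [mu_ uK]; apply: measurable_bounded_integrable => //.
- exact: open_measurable_plane.
- exact: measurable_funTS.
- exists K; split; first exact: num_real.
  by move=> x Kx z _ /=; rewrite (le_trans (uK z))// ltW.
Qed.

Lemma area_rect_fin (a b c d : R) : (area (rect a b c d) < +oo)%E.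
Proof.
have [ab|ba] := ltP a b; last first.
  rewrite (_ : rect a b c d = set0) ?measure0//.
  by apply/seteqP; split=> // z; rewrite rectE => -[/andP[h1 h2] _] /=; lra.
have [cd|dc] := ltP c d; last first.
  rewrite (_ : rect a b c d = set0) ?measure0//.
  by apply/seteqP; split=> // z; rewrite rectE => -[_ /andP[h1 h2]] /=; lra.
by rewrite area_rect// ltry.
Qed.

Lemma weak_swapf (K : R) D u g : 0 < K -> bm K u -> bm K g ->
  weak_deriv [set z | D (z.2, z.1)] 0 1 (swapf u) (swapf g) -> weak_deriv D 1 0 u g.
Proof.
move=> K0 Bu Bg H phi tp /=; have := H _ (test_swapf tp) => /=.
have tx := test_pdx tp.
rewrite pdy_swapf -(@integral_test _ setT _ (swapf u) (swapf (pdx phi)))//; last first.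
  exact: test_swapf.
rewrite -(@integral_test _ setT _ (swapf g) (swapf phi))//; last exact: test_swapf.
rewrite -(@integral_test _ setT _ u (pdx phi))// -(@integral_test _ setT _ g phi)//.
have S1 := area_swap (bm_CK_L1 K0 Bu (test_CK tx)).
have S2 := area_swap (bm_CK_L1 K0 Bg (test_CK tp)).
by move=> E; rewrite -[LHS]S1 -[X in (_ * X)%E]S2.
Qed.

Definition primx v := swapf (primy (swapf v)).

Lemma primx_bm (M : R) v : 0 < M -> bdd2 M v -> bm (M * (M + M)) (primx v).
Proof.
move=> M0 B; have B' := bdd2_swapf B; split.
  apply: (measurableT_comp _ measurable_swap).
  by apply: primy_measurable; case: B'.
by move=> z; exact: primy_bounded.
Qed.

Lemma primy_bm (M : R) v : 0 < M -> bdd2 M v -> bm (M * (M + M)) (primy v).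
Proof.
move=> M0 B; split; first by apply: primy_measurable; case: B.
exact: primy_bounded.
Qed.

Lemma bmW (K K' : R) u : K <= K' -> bm K u -> bm K' u.
Proof. by move=> KK [mu_ uK]; split=> // z; exact: le_trans (uK z) KK. Qed.

Lemma primx_weak (M : R) v D : 0 < M -> bdd2 M v -> weak_deriv D 1 0 (primx v) v.
Proof.
move=> M0 B; pose K := Num.max M (M * (M + M)).
have K0 : 0 < K by rewrite lt_max M0.
apply: (weak_swapf K0).
- by apply: bmW (primx_bm M0 B); rewrite le_max lexx orbT.
- by case: B => mv vM _; apply: (@bmW M); rewrite ?le_max ?lexx.
- by rewrite /primx swapfK; exact: primy_weak M0 (bdd2_swapf B).
Qed.

(** On each vertical line the factor [k z.1] is constant and the y-derivative of a test function has
    integral zero. *)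
Lemma weak_cst_y (K : R) D (k : R -> R) : 0 < K ->
  measurable_fun (setT : set (measurableTypeR R)) k -> (forall x, `|k x| <= K) ->
  weak_deriv D 0 1 (fun z => k z.1) (fun=> 0).
Proof.
move=> K0 mk kK phi tp /=.
have tpy := test_pdy tp; have Cy := test_CK tpy.
have Bk : bm K (fun z => k z.1).
  by split=> //; exact: (measurableT_comp mk measurable_fst).
rewrite -(@integral_test _ setT D (fun z => k z.1) (pdy phi))//.
rewrite [X in (_ * X)%E]integral0_eq ?mule0//; last by move=> z _; rewrite mul0r.
rewrite (area_fubini (bm_CK_L1 K0 Bk Cy)); apply: integral0_eq => x _ /=.
have [L L0 BL] := CK_bdd2 Cy.
have I := bdd1_integrable (bdd2_sectiony x BL).
under eq_integral do rewrite EFinM.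
rewrite (integralZl measurableT I) (_ : (\int[mu]_y _)%E = 0%E) ?mule0//.
have C1 : Cn 1 phi by case: tp.
have [cp [N N0 HN]] := test_CK tp.
rewrite -[LHS]fineK; last exact: (integrable_fin_num measurableT I).
congr EFin; apply: (@integral_derive1 _ (-N) N (fun t => phi (x, t))).
- by move=> t; case: C1 => _ [_ dy _ _]; exact: (dy (x, t)).
- by case: C1 => _ [_ _ _ [cy _]]; exact: (continuous_sectiony (x := x) cy).
- by move=> t; rewrite -ler_norml => h; apply/eqP/negPn/negP => /HN [_]; exact/negP.
Qed.

Lemma weak_cst_x (K : R) D (k : R -> R) : 0 < K ->
  measurable_fun (setT : set (measurableTypeR R)) k -> (forall x, `|k x| <= K) ->
  weak_deriv D 1 0 (fun z => k z.2) (fun=> 0).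
Proof.
move=> K0 mk kK; apply: (weak_swapf K0).
- by split=> //; exact: (measurableT_comp mk measurable_snd).
- by split; [exact: measurable_cst|move=> z; rewrite normr0 ltW].
- exact: (@weak_cst_y K _ k K0 mk kK).
Qed.

Lemma Rint_comb D u phi psi (c : R) : measurable (D : set plane) -> L1 D u ->
  CK phi -> CK psi ->
  \int[area]_(z in D) (u z * (c * phi z + psi z)) =
  c * \int[area]_(z in D) (u z * phi z) + \int[area]_(z in D) (u z * psi z).
Proof.
move=> mD Lu Cp Cq; have L1' := L1_CK mD Lu Cp; have L2' := L1_CK mD Lu Cq.
rewrite -(RintegralZl c mD L1') -(RintegralD mD (integrableZl mD c L1') L2').
by apply: eq_Rintegral => z _; rewrite mulrDr mulrCA.
Qed.

Section Rectangle.
Variables (a b c d : R).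
Hypotheses (ab : a < b) (cd : c < d).
Let Q := rect a b c d.
Let mQ : measurable (Q : set plane) := @measurable_rect R a b c d.

Lemma tensor_CK (f g : R -> R) : bump_in a b f -> bump_in c d g -> CK (tensor f g).
Proof. by move=> bf bg; apply: test_CK (test_tensor bf bg). Qed.

Lemma Rint_split u (rho f F g : R -> R) (r : R) : L1 Q u ->
  bump_in a b rho -> bump_in a b F -> bump_in c d g ->
  (forall x, f x = r * rho x + derive1 F x) ->
  \int[area]_(z in Q) (u z * tensor f g z) =
  r * \int[area]_(z in Q) (u z * tensor rho g z) +
  \int[area]_(z in Q) (u z * tensor (derive1 F) g z).
Proof.
move=> Lu br bF bg E; rewrite -Rint_comb//; [|exact: tensor_CK|].
  by apply: eq_Rintegral => z _; rewrite /tensor E; congr (_ * _); lra.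
by apply: tensor_CK => //; exact: bump_derive.
Qed.

Lemma Rint_split' u (sigma g G f : R -> R) (s : R) : L1 Q u ->
  bump_in c d sigma -> bump_in c d G -> bump_in a b f ->
  (forall x, g x = s * sigma x + derive1 G x) ->
  \int[area]_(z in Q) (u z * tensor f g z) =
  s * \int[area]_(z in Q) (u z * tensor f sigma z) +
  \int[area]_(z in Q) (u z * tensor f (derive1 G) z).
Proof.
move=> Lu br bF bg E; rewrite -Rint_comb//; [|exact: tensor_CK|].
  by apply: eq_Rintegral => z _; rewrite /tensor E; congr (_ * _); lra.
by apply: tensor_CK => //; exact: bump_derive.
Qed.

Lemma Rint_tensor (f g : R -> R) : bump_in a b f -> bump_in c d g ->
  \int[area]_(z in Q) tensor f g z = \int[mu]_x f x * \int[mu]_y g y.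
Proof.
move=> bf bg; have tt := test_tensor bf bg; have L := CK_L1 (test_CK tt).
have := Rintegral_tensor (bump_integrable bf) (bump_integrable bg) L.
rewrite /Rintegral => /(congr1 fine) /= <-; congr fine.
rewrite (@integral_restrict _ setT Q)// => z _ Qz.
by case: tt => _ _ sQ; rewrite supp_eq0// => /sQ.
Qed.

Lemma EFin_Rintegral D u : measurable (D : set plane) -> L1 D u ->
  (\int[area]_(z in D) (u z)%:E = (\int[area]_(z in D) u z)%R%:E)%E.
Proof.
by move=> mD Lu; rewrite /Rintegral fineK//; exact: (integrable_fin_num mD Lu).
Qed.

Lemma fundamental_rect_R u : L1 Q u ->
  (forall f g : R -> R, bump_in a b f -> bump_in c d g ->
     \int[area]_(z in Q) (u z * tensor f g z) = 0) ->
  eq_on Q u (fun=> 0).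
Proof.
move=> Lu H; apply: fundamental_rect => // f g bf bg.
have L := L1_CK mQ Lu (tensor_CK bf bg).
by have := EFin_Rintegral mQ L; rewrite H.
Qed.

Lemma weak_tensor_x u g (f k : R -> R) : L1 Q u -> L1 Q g -> weak_deriv Q 1 0 u g ->
  bump_in a b f -> bump_in c d k ->
  \int[area]_(z in Q) (u z * tensor (derive1 f) k z) = - \int[area]_(z in Q) (g z * tensor f k z).
Proof.
move=> Lu Lg H bf bk; have := H _ (test_tensor bf bk) => /=.
rewrite pdx_tensor; last by move=> x; apply: smooth_derivable; case: bf.
rewrite (EFin_Rintegral mQ (L1_CK mQ Lu (tensor_CK (bump_derive bf) bk))).
rewrite (EFin_Rintegral mQ (L1_CK mQ Lg (tensor_CK bf bk))) expr1 -EFinM mulN1r.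
by move=> [].
Qed.

Lemma weak_tensor_y u g (f k : R -> R) : L1 Q u -> L1 Q g -> weak_deriv Q 0 1 u g ->
  bump_in a b f -> bump_in c d k ->
  \int[area]_(z in Q) (u z * tensor f (derive1 k) z) = - \int[area]_(z in Q) (g z * tensor f k z).
Proof.
move=> Lu Lg H bf bk; have := H _ (test_tensor bf bk) => /=.
rewrite pdy_tensor; last by move=> x; apply: smooth_derivable; case: bk.
rewrite (EFin_Rintegral mQ (L1_CK mQ Lu (tensor_CK bf (bump_derive bk)))).
rewrite (EFin_Rintegral mQ (L1_CK mQ Lg (tensor_CK bf bk))) expr1 -EFinM mulN1r.
by move=> [].
Qed.

Lemma Rint_cst0 phi D : \int[area]_(z in D) (0 * phi z) = 0.
Proof. by rewrite /Rintegral integral0_eq// => z _; rewrite mul0r. Qed.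

Lemma L1_cst (C : R) : L1 Q (fun=> C).
Proof.
apply: (@bm_L1 `|C|); [exact: open_rect|exact: area_rect_fin|].
by split; [exact: measurable_cst|].
Qed.

(** Both factors of a tensor product are split by [bump_split]; the parts with a derivative pair to
    zero with [u]. What remains is the product of the two integrals with [C], which is also what the
    constant [C] gives. *)
Lemma zero_gradient_rect u : L1 Q u ->
  weak_deriv Q 1 0 u (fun=> 0) -> weak_deriv Q 0 1 u (fun=> 0) ->
  exists C, eq_on Q u (fun=> C).
Proof.
move=> Lu Hx Hy; have [rho br r1] := unit_bump ab; have [sigma bs s1] := unit_bump cd.
have L0 := L1_cst 0.
pose C := \int[area]_(z in Q) (u z * tensor rho sigma z).
exists C.
have LC : L1 Q (fun z => u z - C) := integrableB mQ Lu (L1_cst C).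
have : eq_on Q (fun z => u z - C) (fun=> 0).
  apply: fundamental_rect_R => // f g bf bg.
  have [F bF Ff] := bump_split br r1 bf; have [G bG Gg] := bump_split bs s1 bg.
  have Kt := tensor_CK bf bg.
  have E1 : \int[area]_(z in Q) (u z * tensor f g z) =
      \int[mu]_x f x * (\int[mu]_y g y * C).
    rewrite (Rint_split Lu br bF bg Ff) (weak_tensor_x Lu L0 Hx)// Rint_cst0 oppr0 addr0.
    by rewrite (Rint_split' Lu bs bG br Gg) (weak_tensor_y Lu L0 Hy)// Rint_cst0 oppr0 addr0.
  transitivity (\int[area]_(z in Q) (u z * tensor f g z - C * tensor f g z)).
    by apply: eq_Rintegral => z _; rewrite mulrBl.
  have Lt : L1 Q (tensor f g) := integrableS measurableT mQ (@subsetT _ _) (CK_L1 Kt).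
  rewrite (RintegralB mQ (L1_CK mQ Lu Kt) (integrableZl mQ C Lt)).
  by rewrite (RintegralZl C mQ Lt) Rint_tensor// E1; lra.
by apply: ae_areaS => z /[apply] /eqP; rewrite subr_eq0 => /eqP.
Qed.

End Rectangle.
End LocalPotential.

(** * Potentials of curl-free fields on a rectangle *)

Section RectanglePotential.
Context {R : realType}.
Notation plane := (measurableTypeR R * measurableTypeR R)%type.
Notation mu := (@lebesgue_measure R).
Implicit Types (D G U : set (R * R)) (u v w phi psi : R * R -> R).
Variables (a b c d : R).
Hypotheses (ab : a < b) (cd : c < d).
Let Q := rect a b c d.
Let mQ : measurable (Q : set plane) := @measurable_rect R a b c d.
Let oQ : open Q := @open_rect R a b c d.

Lemma bump_bounded (x y : R) (f : R -> R) : bump_in x y f ->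
  measurable_fun (setT : set (measurableTypeR R)) f /\
  exists2 K : R, 0 < K & forall t, `|f t| <= K.
Proof.
move=> [sf [x' [y' [_ _ vf]]]]; have cf := smooth_continuous sf.
split; first exact: continuous_measurable_fun.
have : compact (f @` `[x', y']).
  by apply: continuous_compact; [exact: continuous_subspaceT|exact: segment_compact].
move=> /compact_bounded [K [Kr HK]].
exists (`|K| + 1); first by rewrite ltr_wpDl.
move=> t; have [h|/vf ->] := boolP (x' <= t <= y'); last by rewrite normr0 addr_ge0.
by apply: HK; [rewrite (le_lt_trans (ler_norm K))// ltrDl|exists t => //; rewrite /= in_itv].
Qed.

Lemma bmM (K L : R) u v : bm K u -> bm L v -> bm (K * L) (fun z => u z * v z).
Proof.
move=> [m1 b1] [m2 b2]; split; first exact: measurable_funM.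
by move=> z; rewrite normrM ler_pM.
Qed.

Lemma bmD (K L : R) u v : bm K u -> bm L v -> bm (K + L) (fun z => u z + v z).
Proof.
move=> [m1 b1] [m2 b2]; split; first exact: measurable_funD.
by move=> z; rewrite (le_trans (ler_normD _ _))// lerD.
Qed.

Lemma bmZ (K r : R) u : bm K u -> bm (`|r| * K) (fun z => r * u z).
Proof.
move=> Bu; apply: bmM => //; by split; [exact: measurable_cst|].
Qed.

Lemma bm_fst (K : R) (k : R -> R) : measurable_fun (setT : set (measurableTypeR R)) k ->
  (forall x, `|k x| <= K) -> bm K (fun z => k z.1).
Proof. by move=> mk kK; split=> //; exact: (measurableT_comp mk measurable_fst). Qed.

Lemma bm_snd (K : R) (k : R -> R) : measurable_fun (setT : set (measurableTypeR R)) k ->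
  (forall x, `|k x| <= K) -> bm K (fun z => k z.2).
Proof. by move=> mk kK; split=> //; exact: (measurableT_comp mk measurable_snd). Qed.

(* The functions g and k are the averages of w along the vertical and along the
   horizontal lines, against weights of integral 1. *)
Lemma mixed_zero (M : R) w : 0 < M -> bdd2 M w -> (forall z, ~ Q z -> w z = 0) ->
  (forall F G : R -> R, bump_in a b F -> bump_in c d G ->
    \int[area]_(z in Q) (w z * tensor (derive1 F) (derive1 G) z) = 0) ->
  exists g k : R -> R, [/\ measurable_fun (setT : set (measurableTypeR R)) g,
    measurable_fun (setT : set (measurableTypeR R)) k,
    exists2 K, 0 < K & (forall x, `|g x| <= K) /\ (forall x, `|k x| <= K) &
    eq_on Q w (fun z => g z.1 + k z.2)].
Proof.
move=> M0 B wQ H; have [rho br r1] := unit_bump ab; have [sigma bs s1] := unit_bump cd.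
have [mr [Kr Kr0 rK]] := bump_bounded br; have [ms [Ks Ks0 sK]] := bump_bounded bs.
have Br : bm Kr (fun z => rho z.1) by exact: bm_fst.
have Bs : bm Ks (fun z => sigma z.2) by exact: bm_snd.
have Bwr := bdd2M M0 B Br.1 Kr0 Br.2; have Bws := bdd2M M0 B Bs.1 Ks0 Bs.2.
set Mr := Num.max M (M * Kr) in Bwr; set Ms := Num.max M (M * Ks) in Bws.
have Mr0 : 0 < Mr by rewrite lt_max M0.
have Ms0 : 0 < Ms by rewrite lt_max M0.
pose k0 y := \int[mu]_x (w (x, y) * rho x).
pose g x := \int[mu]_y (w (x, y) * sigma y).
have mg : measurable_fun (setT : set (measurableTypeR R)) g.
  by apply: (measurable_param (H := fun z => w z * sigma z.2)); case: Bws.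
have mk0 : measurable_fun (setT : set (measurableTypeR R)) k0.
  apply: (measurable_param (H := swapf (fun z => w z * rho z.1))).
  by case: (bdd2_swapf Bwr).
have gK x : `|g x| <= Ms * (Ms + Ms) by exact: (bdd1_integral Ms0 (bdd2_sectiony x Bws)).
have kK y : `|k0 y| <= Mr * (Mr + Mr).
  exact: (bdd1_integral Mr0 (bdd2_sectiony y (bdd2_swapf Bwr))).
have Lw : L1 Q w := integrableS measurableT mQ (@subsetT _ _) (bdd2_L1 M0 B).
pose C := \int[area]_(z in Q) (w z * tensor rho sigma z).
have Bw : bm M w by case: B.
have Bg : bm (Ms * (Ms + Ms)) (fun z => g z.1) by exact: bm_fst.
have Bk : bm (Mr * (Mr + Mr)) (fun z => k0 z.2) by exact: bm_snd.
have JQ u f h : bump_in a b f -> bump_in c d h ->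
    \int[area]_(z in Q) (u z * tensor f h z) = \int[area]_z (u z * tensor f h z).
  move=> bf bh; rewrite /Rintegral; congr fine; apply/esym.
  exact: integral_test (test_tensor bf bh).
(* Fubini turns the pairing of an average of [w] into a pairing of [w] itself, in which [rho]
   replaces [f]; the integral of [f] comes out as a factor. *)
have Jk f h : bump_in a b f -> bump_in c d h ->
    \int[area]_(z in Q) (k0 z.2 * tensor f h z) =
    \int[mu]_x f x * \int[area]_(z in Q) (w z * tensor rho h z).
  move=> bf bh; rewrite !JQ//.
  have Kfh := tensor_CK bf bh; have Krh := tensor_CK br bh.
  have kk0 : 0 < Mr * (Mr + Mr) by rewrite mulr_gt0// addr_gt0.
  have [N N0 BN] := bm_CK kk0 Bk Kfh; have [L L0 BL] := bm_CK M0 Bw Krh.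
  rewrite (Rarea_fubini N0 BN) (Rarea_fubini L0 BL) (Rintegral_fubini L0 BL).
  have [mh [Kh Kh0 hK]] := bump_bounded bh.
  have E2 y : \int[mu]_x (w (x, y) * tensor rho h (x, y)) = k0 y * h y.
    rewrite /k0 -RintegralZr//.
      by apply: eq_Rintegral => x _; rewrite /tensor mulrA.
    exact: (bdd1_integrable (bdd2_sectiony y (bdd2_swapf Bwr))).
  have -> : \int[mu]_y \int[mu]_x (w (x, y) * tensor rho h (x, y)) = \int[mu]_y (k0 y * h y).
    by apply: eq_Rintegral => y _; exact: E2.
  have Ikh : mu.-integrable setT (EFin \o (fun y => k0 y * h y)).
    rewrite (_ : _ \o _ = (EFin \o h) \* (EFin \o k0))%E; last first.
      by apply/funext => y /=; rewrite -EFinM mulrC.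
    apply: (integrableMl measurableT (bump_integrable bh) mk0).
    exists (Mr * (Mr + Mr)); split; first exact: num_real.
    by move=> x Kx z _ /=; rewrite (le_trans (kK z))// ltW.
  rewrite -(RintegralZr _ measurableT (bump_integrable bf)).
  apply: eq_Rintegral => x _; rewrite -(RintegralZl _ measurableT Ikh).
  by apply: eq_Rintegral => y _; rewrite /tensor /=; lra.
have Jg f h : bump_in a b f -> bump_in c d h ->
    \int[area]_(z in Q) (g z.1 * tensor f h z) =
    \int[mu]_x h x * \int[area]_(z in Q) (w z * tensor f sigma z).
  move=> bf bh; rewrite !JQ//.
  have Kfh := tensor_CK bf bh; have Krh := tensor_CK bf bs.
  have kk0 : 0 < Ms * (Ms + Ms) by rewrite mulr_gt0// addr_gt0.
  have [N N0 BN] := bm_CK kk0 Bg Kfh; have [L L0 BL] := bm_CK M0 Bw Krh.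
  rewrite (Rarea_fubini N0 BN) (Rarea_fubini L0 BL).
  have E2 x : \int[mu]_y (w (x, y) * tensor f sigma (x, y)) = g x * f x.
    rewrite /g -RintegralZr//.
      by apply: eq_Rintegral => y _; rewrite /tensor /=; lra.
    exact: (bdd1_integrable (bdd2_sectiony x Bws)).
  have -> : \int[mu]_x \int[mu]_y (w (x, y) * tensor f sigma (x, y)) = \int[mu]_x (g x * f x).
    by apply: eq_Rintegral => x _; exact: E2.
  have Ikh : mu.-integrable setT (EFin \o (fun y => g y * f y)).
    rewrite (_ : _ \o _ = (EFin \o f) \* (EFin \o g))%E; last first.
      by apply/funext => y /=; rewrite -EFinM mulrC.
    apply: (integrableMl measurableT (bump_integrable bf) mg).
    exists (Ms * (Ms + Ms)); split; first exact: num_real.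
    by move=> x Kx z _ /=; rewrite (le_trans (gK z))// ltW.
  rewrite -(RintegralZl _ measurableT Ikh).
  apply: eq_Rintegral => x _; rewrite mulrC -(RintegralZl _ measurableT (bump_integrable bh)).
  by apply: eq_Rintegral => y _; rewrite /tensor /=; lra.
(* The double average [C] of [w] is contained in both averages, so it is subtracted once. *)
exists g, (fun y => k0 y - C); split=> //.
- exact: measurable_funB.
- pose K := Ms * (Ms + Ms) + (Mr * (Mr + Mr) + `|C|).
  have p1 : 0 < Ms * (Ms + Ms) by rewrite mulr_gt0// addr_gt0.
  have p2 : 0 < Mr * (Mr + Mr) by rewrite mulr_gt0// addr_gt0.
  have p3 := normr_ge0 C.
  exists K; first by rewrite /K; lra.
  split=> x; first by rewrite /K; have := gK x; lra.
  have := kK x; have := ler_normB (k0 x) C; rewrite /K; lra.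
- have finQ := area_rect_fin a b c d.
  have Lg := bm_L1 oQ finQ Bg; have Lk := bm_L1 oQ finQ Bk; have LC := L1_cst a b c d C.
  have LkC : L1 Q (fun z => k0 z.2 - C) := integrableB mQ Lk LC.
  have Lgk : L1 Q (fun z => g z.1 + (k0 z.2 - C)) := integrableD mQ Lg LkC.
  have LW : L1 Q (fun z => w z - (g z.1 + (k0 z.2 - C))) := integrableB mQ Lw Lgk.
  have : eq_on Q (fun z => w z - (g z.1 + (k0 z.2 - C))) (fun=> 0).
    apply: fundamental_rect_R => // f h bf bh; have Kt := tensor_CK bf bh.
    have [F bF Ff] := bump_split br r1 bf; have [G bG Gg] := bump_split bs s1 bh.
    have E1 := Rint_split Lw br bF bh Ff.
    have E2 := Rint_split' Lw bs bG (bump_derive bF) Gg.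
    have E3 := Rint_split Lw br bF bs Ff.
    have Lt : L1 Q (tensor f h) := integrableS measurableT mQ (@subsetT _ _) (CK_L1 Kt).
    transitivity (\int[area]_(z in Q) (w z * tensor f h z -
        (g z.1 * tensor f h z + (k0 z.2 * tensor f h z - C * tensor f h z)))).
      by apply: eq_Rintegral => z _; lra.
    have I1 := L1_CK mQ Lw Kt; have I2 := L1_CK mQ Lg Kt; have I3 := L1_CK mQ Lk Kt.
    have I4 : L1 Q (fun z => C * tensor f h z) := integrableZl mQ C Lt.
    have I34 : L1 Q (fun z => k0 z.2 * tensor f h z - C * tensor f h z) := integrableB mQ I3 I4.
    have I234 : L1 Q (fun z => g z.1 * tensor f h z + (k0 z.2 * tensor f h z - C * tensor f h z)) :=
      integrableD mQ I2 I34.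
    rewrite (RintegralB mQ I1 I234) (RintegralD mQ I2 I34) (RintegralB mQ I3 I4).
    rewrite (RintegralZl C mQ Lt) Rint_tensor// Jk// Jg// E1 E2 E3 (H _ _ bF bG) -/C.
    (* [A] and [B'] are the integrals of [f] and [h]; [X] and [Y] are the pairings of [w] with the
       tensor products of [rho] with [h] and of [derive1 F] with [sigma]. The 0 is the mixed
       derivative. *)
    have pure (A B' X Y : R) : A * X + (B' * Y + 0) -
      (B' * (A * C + Y) + (A * X - C * (A * B'))) = 0 by lra.
    exact: pure.
  by apply: ae_areaS => z /[apply] /eqP; rewrite subr_eq0 => /eqP.
Qed.

(** The hypothesis is the weak form of equality of the cross derivatives of the prescribed gradient
    [(gx, gy)]. Besides the two derivatives a uniform bound is obtained, which later gives
    integrability on every square. *)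
Lemma local_potential (M : R) gx gy : 0 < M -> bdd2 M gx -> bdd2 M gy ->
  (forall phi, test_function Q phi -> (\int[area]_(z in Q) (gy z * pdx phi z)%:E =
     \int[area]_(z in Q) (gx z * pdy phi z)%:E)%E) ->
  exists f, [/\ exists2 K, 0 < K & bm K f, weak_deriv Q 1 0 f gx & weak_deriv Q 0 1 f gy].
Proof.
move=> M0 Bx By H; have finQ := area_rect_fin a b c d.
pose f1 := primy gy; pose f2 := primx gx.
have B1 : bm (M * (M + M)) f1 := primy_bm M0 By.
have B2 : bm (M * (M + M)) f2 := primx_bm M0 Bx.
set N := M * (M + M) in B1 B2; have N0 : 0 < N by rewrite mulr_gt0// addr_gt0.
have W1 : weak_deriv Q 0 1 f1 gy := primy_weak M0 By.
have W2 : weak_deriv Q 1 0 f2 gx := primx_weak M0 Bx.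
have L1f := bm_L1 oQ finQ B1; have L2f := bm_L1 oQ finQ B2.
have Lx := integrableS measurableT mQ (@subsetT _ _) (bdd2_L1 M0 Bx).
have Ly := integrableS measurableT mQ (@subsetT _ _) (bdd2_L1 M0 By).
pose w z : R := (f1 z - f2 z) * \1_Q z.
(* [N + N] bounds the values of [w], the other terms its support. *)
pose L := Num.max (N + N) (Num.max (Num.max `|a| `|b|) (Num.max `|c| `|d|)).
have B12 : bm (N + N) (fun z => f1 z - f2 z).
  case: B1 => m1 b1; case: B2 => m2 b2; split; first exact: measurable_funB.
  by move=> z; rewrite (le_trans (ler_normB _ _))// lerD.
have Lpos : 0 < L by rewrite lt_max addr_gt0.
have Bw : bdd2 L w.
  case: B12 => m12 b12; split.
  - by apply: measurable_funM => //; exact: measurable_indic.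
  - move=> z; rewrite /w indicE le_max; apply/orP; left.
    by case: (z \in Q); rewrite ?mulr1 ?mulr0 ?normr0// addr_ge0// ltW.
  - move=> z; rewrite /w indicE; case: (boolP (z \in Q)) => [|_]; last by rewrite mulr0 eqxx.
    rewrite inE /Q rectE => -[/andP[h1 h2] /andP[h3 h4]] _.
    have La : `|a| <= L by rewrite /L !le_max lexx !orbT.
    have Lb : `|b| <= L by rewrite /L !le_max lexx !orbT.
    have Lc : `|c| <= L by rewrite /L !le_max lexx !orbT.
    have Ld : `|d| <= L by rewrite /L !le_max lexx !orbT.
    move: La Lb Lc Ld; rewrite !ler_norml => /andP[? ?] /andP[? ?] /andP[? ?] /andP[? ?].
    by split; apply/andP; split; lra.
have [|F G bF bG|g [k [mg mk [K K0 [gK kK]] E]]] := mixed_zero Lpos Bw.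
- by move=> z Qz; rewrite /w indicE memNset ?mulr0.
- have bF' := bump_derive bF; have bG' := bump_derive bG.
  have Kt := tensor_CK bF' bG'.
  transitivity (\int[area]_(z in Q) (f1 z * tensor (derive1 F) (derive1 G) z -
     f2 z * tensor (derive1 F) (derive1 G) z)).
    apply: eq_Rintegral => z zQ; rewrite /w indicE zQ mulr1 mulrBl//.
  rewrite (RintegralB mQ (L1_CK mQ L1f Kt) (L1_CK mQ L2f Kt)).
  (* One derivative is taken off each primitive; what is left are the two sides of the hypothesis
     for the tensor product of [F] and [G]. *)
  rewrite (weak_tensor_y L1f Ly W1 bF' bG) (weak_tensor_x L2f Lx W2 bF bG').
  have := H _ (test_tensor bF bG).
  rewrite pdx_tensor; last by move=> x; apply: smooth_derivable; case: bF.
  rewrite pdy_tensor; last by move=> x; apply: smooth_derivable; case: bG.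
  by rewrite /Rintegral => ->; rewrite subrr.
(* On [Q] this equals f2 + k almost everywhere: the first form shows the y-derivative, the second
   the x-derivative. *)
pose f z := f1 z - g z.1.
have Bg : bm K (fun z => g z.1) := bm_fst mg gK.
have Bk : bm K (fun z => k z.2) := bm_snd mk kK.
have Lg := bm_L1 oQ finQ Bg; have Lk := bm_L1 oQ finQ Bk; have L0 := L1_cst a b c d 0.
have Bf : bm (K + N) f.
  rewrite (_ : f = fun z => (-1) * g z.1 + f1 z); last first.
    by apply/funext => z; rewrite /f mulN1r addrC.
  apply: bmD => //; have := bmZ (-1) Bg; by rewrite normrN1 mul1r.
exists f; split.
- by exists (K + N) => //; rewrite addr_gt0.
- have W := weak_linear 1 oQ L2f Lk Lx L0 W2 (@weak_cst_x _ K Q k K0 mk kK).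
  have Lf := bm_L1 oQ finQ Bf.
  have Lf2 : L1 Q (fun z => 1 * f2 z + k z.2) := integrableD mQ (integrableZl mQ 1 L2f) Lk.
  have Lx0 : L1 Q (fun z => 1 * gx z + 0) := integrableD mQ (integrableZl mQ 1 Lx) L0.
  apply: (weak_eq oQ Lf2 Lf Lx0 Lx _ _ W); last first.
    by apply: eq_on_pointwise => z _; rewrite mul1r addr0.
  apply: ae_areaS E => z + Qz => /(_ Qz); rewrite /f /w indicE mem_set// mulr1; lra.
- have W := weak_linear (-1) oQ Lg L1f L0 Ly (@weak_cst_y _ K Q g K0 mg gK) W1.
  rewrite (_ : f = fun z => (-1) * g z.1 + f1 z); last first.
    by apply/funext => z; rewrite /f mulN1r addrC.
  rewrite (_ : gy = fun z => (-1) * 0 + gy z)//.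
  by apply/funext => z; rewrite mulr0 add0r.
Qed.

End RectanglePotential.

(** * Cocycles on contractible sets *)

Section Topology.
Context {R : realType}.
Notation plane := (measurableTypeR R * measurableTypeR R)%type.
Implicit Types (D G U : set (R * R)) (u f g : R * R -> R) (p q x y z : R * R).

Lemma boxS p (r s : R) : r <= s -> box p r `<=` box p s.
Proof. by move=> rs z; rewrite !boxE => -[h1 h2]; split; exact: lt_le_trans rs. Qed.

Lemma open_box_in D x : open D -> D x -> exists2 r : R, 0 < r & box x r `<=` D.
Proof. by move=> oD Dx; move: oD; rewrite openE => /(_ _ Dx) /nbhs_boxP. Qed.

Lemma inv_exp2_le (r : R) : 0 < r -> exists m, forall n, (m <= n)%N -> 2 ^- n <= r.
Proof.
move=> r0; exists (Num.truncn r^-1).+1 => n Mn.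
rewrite invf_ple ?posrE ?exprn_gt0//.
have h1 : r^-1 < (Num.truncn r^-1).+1%:R by exact: truncnS_gt.
have h2 : (n <= 2 ^ n)%N by rewrite ltnW// ltn_expl.
rewrite (le_trans (ltW h1))// -natrX ler_nat; exact: leq_trans h2.
Qed.

Lemma eq_on_cst G (C C' : R) : open G -> G !=set0 ->
  eq_on G (fun=> C) (fun=> C') -> C = C'.
Proof.
move=> oG [z Gz] E.
exact: (continuous_eq_on oG (fun=> @cvg_cst _ _ _ _ _) (fun=> @cvg_cst _ _ _ _ _) E Gz).
Qed.

(** The points around which [u] is almost everywhere the constant found at [x0] form a subset that
    is open and closed in [G]. *)
Lemma locally_const_ae G u : open G -> connected G ->
  (forall x, G x -> exists r C, 0 < r /\ eq_on (G `&` box x r) u (fun=> C)) ->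
  exists C, eq_on G u (fun=> C).
Proof.
move=> oG cG H; have [G0|/set0P[x0 Gx0]] := eqVneq G set0.
  by exists 0; apply: eq_on_pointwise => z; rewrite G0.
have [r0 [C [r00 HC]]] := H _ Gx0; exists C.
pose B := [set x | G x /\ exists2 r, 0 < r & eq_on (G `&` box x r) u (fun=> C)].
have sub x r y : box x r y -> exists2 s : R, 0 < s & box y s `<=` box x r.
  by move=> h; apply: open_box_in h; exact: open_box.
have oB : open B.
  rewrite openE => x [Gx [r rpos E]].
  have [s s0 sG] := open_box_in oG Gx.
  apply/nbhs_boxP; exists (Num.min r s); first by rewrite lt_min rpos.
  move=> y hy; have yr : box x r y by apply: boxS hy; rewrite ge_min lexx.
  have ys : box x s y by apply: boxS hy; rewrite ge_min lexx orbT.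
  split; first exact: sG.
  have [t t0 tr] := sub _ _ _ yr; exists t => //.
  by apply: eq_onS E => w [Gw tw]; split=> //; exact: tr.
have oB' : open (G `&` ~` B).
  rewrite openE => x [Gx nB].
  have [r [C' [rpos E]]] := H _ Gx.
  have [s s0 sG] := open_box_in oG Gx.
  apply/nbhs_boxP; exists (Num.min r s); first by rewrite lt_min rpos.
  move=> y hy; have yr : box x r y by apply: boxS hy; rewrite ge_min lexx.
  have ys : box x s y by apply: boxS hy; rewrite ge_min lexx orbT.
  split; first exact: sG.
  move=> [Gy [t tpos Et]]; apply: nB; split=> //; exists r => //.
  (* The two squares share [y], so they meet in a nonempty open set, on which the two constants
     agree almost everywhere. *)
  have -> // : C = C'.
  apply: (@eq_on_cst (G `&` (box x r `&` box y t))).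
  - by apply: openI => //; apply: openI; exact: open_box.
  - by exists y; split=> //; split=> //; exact: box_center.
  - apply: eq_on_trans (eq_on_sym _) (eq_onS _ E).
      by apply: eq_onS Et => w [Gw [_ ?]].
    by move=> w [Gw [? _]].
have BG : B = G.
  apply: cG.
  - by exists x0; split=> //; exists r0.
  - by exists B => //; apply/seteqP; split=> [x [Gx hx]|x [_]//]; split=> //; split.
  - exists (~` (G `&` ~` B)); first exact: open_closedC.
    apply/seteqP; split=> [x [Gx hx]|x [Gx hx]].
      by split=> // -[_]; apply; split.
    by apply: contrapT => nB; apply: hx.
apply: eq_on_local => x Gx; have [_ [r rpos E]] : B x by rewrite BG.
by exists (box x r) => //; exact: nbhs_box.
Qed.

Lemma L1S D G u : open D -> open G -> G `<=` D -> L1 D u -> L1 G u.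
Proof.
move=> oD oG GD; apply: integrableS => //; exact: open_measurable_plane.
Qed.

Lemma zero_gradient G u : open G -> connected G -> L1 G u ->
  weak_deriv G 1 0 u (fun=> 0) -> weak_deriv G 0 1 u (fun=> 0) ->
  exists C, eq_on G u (fun=> C).
Proof.
move=> oG cG Lu Hx Hy; apply: locally_const_ae => // x Gx.
have [r r0 rG] := open_box_in oG Gx.
have l1 : x.1 - r < x.1 + r by lra.
have l2 : x.2 - r < x.2 + r by lra.
have [C E] := zero_gradient_rect l1 l2 (L1S oG (@open_box _ x r) rG Lu)
  (weakS rG Hx) (weakS rG Hy).
by exists r, C; split=> //; apply: eq_onS E => z [].
Qed.

Lemma big_double (V : zmodType) (F : nat -> V) m :
  \sum_(0 <= j < m.*2) F j = \sum_(0 <= j < m) (F j.*2 + F j.*2.+1).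
Proof.
elim: m => [|m IH]; first by rewrite !big_geq.
by rewrite doubleS !big_nat_recr//= IH addrA.
Qed.

(* A locally defined cocycle on a contractible set is a coboundary: C x is the
   sum of c along a fine subdivision of the path contracting x. *)
Lemma local_cocycle D (c : R * R -> R * R -> R) : open D -> contractible D ->
  (forall p, D p -> exists e, [/\ 0 < e, box p e `<=` D &
     forall x y z, box p e x -> box p e y -> box p e z -> c x y + c y z = c x z]) ->
  exists C : R * R -> R, forall x, D x ->
    exists r, [/\ 0 < r, box x r `<=` D & forall y, box x r y -> C x - C y = c x y].
Proof.
move=> oD [x0 Dx0 [H [cH HD H0 H1]]] cc.
pose good (p : R * R) (e : R) := box p e `<=` D /\
  forall x y z, box p e x -> box p e y -> box p e z -> c x y + c y z = c x z.
(* A Lebesgue number for the path of [x], uniform in the starting point: by compactness of [0, 1],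
   one [r] keeps all paths from the square of [x] in a single good square during any time interval
   of radius [r]. *)
have claim x : D x -> exists r : R, [/\ 0 < r, box x r `<=` D &
    forall t, t \in `[0, 1] -> exists p e, good p e /\
      forall y s, box x r y -> s \in `[0, 1] -> `|s - t| <= r -> box p e (H (y, s))].
  move=> Dx; have [r0 r00 r0D] := open_box_in oD Dx.
  have /compact_near_coveringP K := @segment_compact R 0 1.
  pose P (n : nat) (t : R) := exists p e, good p e /\
      forall y s, box x (Num.min r0 n.+1%:R^-1) y -> s \in `[0, 1] ->
        `|s - t| <= n.+1%:R^-1 -> box p e (H (y, s)).
  have [] := K nat \oo P _.
    move=> t /=; rewrite in_itv /= => t01.
    have It : t \in `[0, 1] by rewrite in_itv.
    have Dp := HD _ _ Dx It.
    have [e [e0 eD ec]] := cc _ Dp.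
    have /subspace_continuousP /(_ (x, t)) := cH.
    move=> /(_ (conj Dx It)) /(_ _ (nbhs_box (H (x, t)) e0)).
    rewrite /= /within /= => /nbhs_ballP[eta /= eta0 Heta].
    exists (ball t (eta / 2), [set n | n.+1%:R^-1 < eta / 2]) => /=.
      split; first by apply: nbhsx_ballx; rewrite divr_gt0.
      have eta2 : 0 < eta / 2 by rewrite divr_gt0.
      exact: (@near_infty_natSinv_lt _ (PosNum eta2)).
    move=> [t' n] /= [tt' nn]; exists (H (x, t)), e; split; first by [].
    move=> y s hy sI st; have yr0 : box x r0 y by apply: boxS hy; rewrite ge_min lexx.
    have yn : box x n.+1%:R^-1 y by apply: boxS hy; rewrite ge_min lexx orbT.
    apply: (Heta (y, s)); last by split=> //; exact: r0D.
    move: yn; rewrite boxE => -[y1 y2]; split; last first.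
      rewrite /ball /= distrC; rewrite /ball /= in tt'.
      apply: (le_lt_trans (ler_distD t' s t)); rewrite [ltRHS]splitr.
      by apply: ltrD; [exact: le_lt_trans st nn|rewrite distrC].
    have ne : n.+1%:R^-1 < eta by apply: lt_trans nn _; rewrite ltr_pdivrMr// ltr_pMr// ltr1n.
    by split; rewrite /ball /= distrC; [exact: lt_trans y1 ne|exact: lt_trans y2 ne].
  move=> N _ /(_ N (leqnn _)) PN.
  exists (Num.min r0 N.+1%:R^-1); split.
  - by rewrite lt_min r00 invr_gt0 ltr0n.
  - by apply: subset_trans r0D; apply: boxS; rewrite ge_min lexx.
  - move=> t t01; have [p [e [gp he]]] := PN t t01; exists p, e; split=> // y s hy hs hst.
    by apply: he => //; apply: le_trans hst _; rewrite ge_min lexx orbT.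
(* Dyadic times: each subdivision refines the preceding one, and comparing two of them reduces to
   halving. *)
pose tt (n j : nat) : R := j%:R / 2 ^+ n.
have p2 n : 0 < (2 : R) ^+ n by rewrite exprn_gt0.
have ttI n j : (j <= 2 ^ n)%N -> tt n j \in `[0, 1].
  move=> jn; rewrite in_itv /= /tt; apply/andP; split; first by rewrite divr_ge0// ltW.
  by rewrite ler_pdivrMr// mul1r -natrX ler_nat.
have tt_double n j : tt n.+1 j.*2 = tt n j.
  rewrite /tt -mul2n natrM exprS invfM mulrACA divff ?mul1r//.
have tt_step n j : tt n j.+1 - tt n j = (2 ^+ n)^-1.
  by rewrite /tt -mulrBl -natrB// subSnn mul1r.
pose S n y := \sum_(0 <= j < 2 ^ n) c (H (y, tt n j)) (H (y, tt n j.+1)).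
(* Once the mesh is below [r], halving it does not alter the sum, and the sums at two nearby points
   differ by [c x y]. *)
have step x r : D x -> 0 < r -> box x r `<=` D ->
    (forall t, t \in `[0, 1] -> exists p e, good p e /\
      forall y s, box x r y -> s \in `[0, 1] -> `|s - t| <= r -> box p e (H (y, s))) ->
    forall n, (2 ^+ n)^-1 <= r -> forall y, box x r y ->
      S n.+1 y = S n y /\ S n x - S n y = c x y.
  move=> Dx r0 rD Hr n nr y xy.
  have Dy := rD _ xy; have xx : box x r x by exact: box_center.
  have tn0 j : `|tt n j - tt n j| <= r by rewrite subrr normr0 ltW.
  have tn1 j : `|tt n j.+1 - tt n j| <= r.
    by rewrite tt_step ger0_norm// invr_ge0 ltW.
  have tn2 j : `|tt n.+1 j.*2.+1 - tt n j| <= r.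
    rewrite -(tt_double n j) tt_step ger0_norm; last by rewrite invr_ge0 ltW.
    apply: le_trans nr; rewrite lef_pV2 ?posrE// exprS.
    have := p2 n; lra.
  split.
    rewrite /S expnS mul2n big_double; apply: eq_big_nat => j /andP[_ jn].
    have I0 := ttI n j (ltnW jn); have I1 := ttI n j.+1 jn.
    have I2 : tt n.+1 j.*2.+1 \in `[0, 1].
      by apply: ttI; rewrite expnS mul2n ltn_double.
    have [p [e [[_ gc] he]]] := Hr _ I0.
    rewrite -doubleS !tt_double; apply: gc; exact: he.
  rewrite /S -sumrB.
  (* The four corners of each cell between the two paths lie in one good square, so the cocycle
     identity trades the sides along the paths for the rungs between them, and these telescope. *)
  transitivity (\sum_(0 <= j < 2 ^ n) (c (H (x, tt n j)) (H (y, tt n j)) -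
     c (H (x, tt n j.+1)) (H (y, tt n j.+1)))).
    apply: eq_big_nat => j /andP[_ jn].
    have I0 := ttI n j (ltnW jn); have I1 := ttI n j.+1 jn.
    have [p [e [[_ gc] he]]] := Hr _ I0.
    have bx0 := he _ _ xx I0 (tn0 j); have bx1 := he _ _ xx I1 (tn1 j).
    have by0 := he _ _ xy I0 (tn0 j); have by1 := he _ _ xy I1 (tn1 j).
    have e1 := gc _ _ _ bx0 bx1 by1; have e2 := gc _ _ _ bx0 by0 by1.
    lra.
  rewrite (eq_bigr (fun j => - (c (H (x, tt n j.+1)) (H (y, tt n j.+1)) -
     c (H (x, tt n j)) (H (y, tt n j))))); last by move=> j _; rewrite opprB.
  rewrite sumrN telescope_sumr ?expn_gt0//.
  have -> : tt n 0 = 0 by rewrite /tt mul0r.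
  have -> : tt n (2 ^ n)%N = 1 by rewrite /tt natrX divff// gt_eqF.
  rewrite !H0// !H1//.
  (* The last rung is [c x0 x0], which the cocycle identity makes zero. *)
  have [e [e0 eD ec]] := cc _ Dx0; have b0 := box_center x0 e0.
  have := ec _ _ _ b0 b0 b0; lra.
(* The rank from which the sums are stationary depends on [x]; [C x] is the eventual value. *)
have /choice[C HC] : forall x, exists v, D x -> exists N, forall n, (N <= n)%N -> S n x = v.
  move=> x; have [Dx|nDx] := pselect (D x); last by exists 0.
  have [r [r0 rD Hr]] := claim _ Dx; have [M HM] := inv_exp2_le r0.
  exists (S M x) => _; exists M => n; elim: n => [|n IH].
    by rewrite leqn0 => /eqP <-.
  rewrite leq_eqVlt => /orP[/eqP <-//|]; rewrite ltnS => Mn.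
  rewrite -IH//; apply: (proj1 (step x r Dx r0 rD Hr n (HM _ Mn) x _)).
  exact: box_center.
exists C => x Dx; have [r [r0 rD Hr]] := claim _ Dx; have [M HM] := inv_exp2_le r0.
exists r; split=> // y xy.
have [N1 HN1] := HC _ Dx; have [N2 HN2] := HC _ (rD _ xy).
pose n := maxn M (maxn N1 N2).
rewrite -(HN1 n) ?leq_max ?leqnn ?orbT// -(HN2 n) ?leq_max ?leqnn ?orbT//.
apply: (proj2 (step x r Dx r0 rD Hr n _ y xy)).
by apply: HM; rewrite leq_maxl.
Qed.

(** [F] takes its value from the square of least index containing the point. Countability serves
    twice: for the measurability of [F], and to keep the union of the exceptional sets null. *)
Lemma glue D (h : R * R -> R * R -> R) (r : R * R -> R) : open D -> D !=set0 ->
  (forall p, D p -> 0 < r p /\ box p (r p) `<=` D) ->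
  (forall p, D p -> measurable_fun (setT : set plane) (h p)) ->
  (forall p q, D p -> D q -> eq_on (box p (r p) `&` box q (r q)) (h p) (h q)) ->
  exists2 F, measurable_fun (D : set plane) F & forall p, D p -> eq_on (box p (r p)) F (h p).
Proof.
move=> oD D0 rP mh hh.
have [s sD cov] := countable_subcover (N := fun p => box p (r p)) D0
  (fun p Dp => nbhs_box p (rP p Dp).1).
have ex z : D z -> exists i, `[< box (s i) (r (s i)) z >].
  by move=> /cov [i _ hi]; exists i; apply/asboolP.
pose idx z := if pselect (D z) is left Dz then ex_minn (ex z Dz) else 0%N.
have idxP z : D z -> box (s (idx z)) (r (s (idx z))) z /\
    forall i, box (s i) (r (s i)) z -> (idx z <= i)%N.
  move=> Dz; rewrite /idx; case: pselect => // Dz'; case: ex_minnP => i /asboolP hi hmin.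
  by split=> // j hj; apply: hmin; apply/asboolP.
pose E i := box (s i) (r (s i)) `\` \bigcup_(j in [set j | (j < i)%N]) box (s j) (r (s j)).
have EP i z : E i z -> D z /\ idx z = i.
  move=> [hi ni]; have Dz : D z by exact: (rP _ (sD i)).2.
  split=> //; have [h1 h2] := idxP _ Dz; apply/eqP; rewrite eqn_leq h2//= leqNgt.
  by apply/negP => lt; apply: ni; exists (idx z).
have PE z : D z -> E (idx z) z.
  move=> Dz; have [h1 h2] := idxP _ Dz; split=> // -[j /= jlt hj].
  by have := h2 _ hj; rewrite leqNgt jlt.
have mE i : measurable (E i : set plane).
  apply: measurableD; first exact: measurable_rect.
  by apply: bigcup_measurable => j _; exact: measurable_rect.
pose F z := h (s (idx z)) z.
exists F.
  have -> : D = \bigcup_i E i.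
    apply/seteqP; split=> [z Dz|z [i _ /EP[]]//]; by exists (idx z) => //; exact: PE.
  apply/measurable_fun_bigcup => // i.
  apply: (@eq_measurable_fun _ _ _ _ _ (h (s i))); last by apply: measurable_funTS; exact: mh.
  by move=> z; rewrite inE => /EP[_ ei]; rewrite /F ei.
move=> p Dp.
apply: (@negligibleS _ _ _ area (\bigcup_i ~` [set z | (box p (r p) `&` box (s i) (r (s i))) z -> h p z = h (s i) z])).
  move=> z /not_implyP[pz nz]; have Dz := (rP _ Dp).2 _ pz.
  exists (idx z) => // hz; apply: nz; rewrite /F hz//; split=> //; exact: (idxP _ Dz).1.
by apply: negligible_bigcup => i; exact: hh.
Qed.

End Topology.

(** * Polynomials *)

Section Polynomials.
Context {R : realType}.
Implicit Types (p q : R * R -> R) (c : nat -> nat -> R) (j N : nat).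

(** A square array of coefficients, the degree being recorded apart by [low]: unlike the triangular
    ranges of [Pdeg], the index ranges survive differentiation and exchange of the variables. *)
Definition polyc N c : R * R -> R :=
  fun z => \sum_(a < N) \sum_(b < N) c a b * z.1 ^+ a * z.2 ^+ b.

Definition low j c := forall a b, (j < a + b)%N -> c a b = 0.

Lemma Pdeg_polyc j N p : (j < N)%N -> Pdeg j p <-> exists2 c, low j c & p = polyc N c.
Proof.
move=> jN.
have E c : low j c -> polyc N c =
    fun z => \sum_(a < j.+1) \sum_(b < (j - a).+1) c a b * z.1 ^+ a * z.2 ^+ b.
  move=> lc; apply/funext => z; rewrite /polyc.
  rewrite [RHS](big_ord_widen_cond N xpredT (fun a => \sum_(b < (j - a).+1) c a b * z.1 ^+ a * z.2 ^+ b))//.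
  rewrite [RHS]big_mkcond; apply: eq_bigr => a _ /=; case: ifP => aj; last first.
    by apply: big1 => b _; rewrite lc ?mul0r// ltn_addr// ltnNge -ltnS aj.
  have jaN : ((j - a).+1 <= N)%N by rewrite (leq_ltn_trans (leq_subr _ _)).
  rewrite [RHS](big_ord_widen_cond N xpredT (fun b => c a b * z.1 ^+ a * z.2 ^+ b))//.
  rewrite [RHS]big_mkcond; apply: eq_bigr => b _ /=; case: ifP => // bj.
  have jab : (j < a + b)%N.
    move/negbT: bj; rewrite ltnS -ltnNge -(ltn_add2l a) subnKC//.
  by rewrite lc ?mul0r.
split=> [[c pc]|[c lc ->]]; last by exists c => z; rewrite E.
exists (fun a b => if (a + b <= j)%N then c a b else 0).
  by move=> a b; rewrite ltnNge => /negbTE ->.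
apply/funext => z; rewrite E; last by move=> a b; rewrite ltnNge => /negbTE ->.
rewrite pc; apply: eq_bigr => a _; apply: eq_bigr => b _; rewrite ifT//.
by rewrite -leq_subRL -1?ltnS.
Qed.

Lemma low_lin j (r : R) c c' : low j c -> low j c' -> low j (fun a b => r * c a b + c' a b).
Proof. by move=> l l' a b h; rewrite l// l'// mulr0 addr0. Qed.

Lemma polyc_lin N (r : R) c c' z :
  polyc N (fun a b => r * c a b + c' a b) z = r * polyc N c z + polyc N c' z.
Proof.
rewrite /polyc mulr_sumr -big_split /=; apply: eq_bigr => a _.
by rewrite mulr_sumr -big_split /=; apply: eq_bigr => b _; lra.
Qed.

Lemma Pdeg_lin j (r : R) p q : Pdeg j p -> Pdeg j q -> Pdeg j (fun z => r * p z + q z).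
Proof.
move=> /(Pdeg_polyc p (ltnSn j))[c lc ->] /(Pdeg_polyc q (ltnSn j))[c' lc' ->].
apply/(Pdeg_polyc _ (ltnSn j)); exists (fun a b => r * c a b + c' a b).
  exact: low_lin.
by apply/funext => z; rewrite polyc_lin.
Qed.

Lemma Pdeg_cst j (r : R) : Pdeg j (fun=> r).
Proof.
apply/(Pdeg_polyc _ (ltnSn j)).
exists (fun a b => if (a + b == 0)%N then r else 0).
  by move=> a b; case: (a + b)%N.
apply/funext => z; rewrite /polyc big_ord_recl big_ord_recl /= !expr0 !mulr1.
rewrite big1 ?addr0; last by move=> b _; rewrite !mul0r.
by rewrite big1 ?addr0// => a _; rewrite big1// => b _; rewrite !mul0r.
Qed.

Lemma polyc_swapf N c : swapf (polyc N c) = polyc N (fun a b => c b a).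
Proof.
apply/funext => z; rewrite /swapf /polyc exchange_big /=.
by apply: eq_bigr => a _; apply: eq_bigr => b _; lra.
Qed.

Lemma Cinf_sum N (F : 'I_N -> R * R -> R) : (forall i, Cinf (F i)) ->
  Cinf (fun z => \sum_(i < N) F i z).
Proof.
elim: N F => [|N IH] F cF.
  rewrite (_ : (fun z => _) = fun=> 0); first exact: Cinf_cst.
  by apply/funext => z; rewrite big_ord0.
rewrite (_ : (fun z => _) = fun z => \sum_(i < N) F (widen_ord (leqnSn N) i) z + F ord_max z).
  by apply: CinfD => //; exact: IH.
by apply/funext => z; rewrite big_ord_recr.
Qed.

Lemma pdx_sum N (F : 'I_N -> R * R -> R) : (forall i, Cinf (F i)) ->
  pdx (fun z => \sum_(i < N) F i z) = (fun z => \sum_(i < N) pdx (F i) z).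
Proof.
elim: N F => [|N IH] F cF.
  apply/funext => z; rewrite big_ord0 /pdx.
  rewrite (_ : (fun t => _) = cst 0) ?derive1_cst//.
  by apply/funext => t; rewrite big_ord0.
rewrite (_ : (fun z => _) = fun z => \sum_(i < N) F (widen_ord (leqnSn N) i) z + F ord_max z); last first.
  by apply/funext => z; rewrite big_ord_recr.
rewrite pdxD; [|exact: (Cinf_sum (fun i => cF _) 1%N)|exact: cF].
by apply/funext => z; rewrite big_ord_recr /= IH.
Qed.

Lemma mono_tensor (r : R) a b :
  (fun z : R * R => r * z.1 ^+ a * z.2 ^+ b) = tensor (fun x => r * x ^+ a) (fun y => y ^+ b).
Proof. by []. Qed.

Lemma Cinf_mono (r : R) a b : Cinf (fun z : R * R => r * z.1 ^+ a * z.2 ^+ b).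
Proof.
rewrite mono_tensor; apply: Cinf_tensor; last exact: smooth_exp.
by apply: smoothZ; exact: smooth_exp.
Qed.

Lemma pdx_mono (r : R) a b : pdx (fun z : R * R => r * z.1 ^+ a * z.2 ^+ b) =
  (fun z => (r * a%:R) * z.1 ^+ a.-1 * z.2 ^+ b).
Proof.
rewrite mono_tensor pdx_tensor; last first.
  by move=> x; apply: smooth_derivable; apply: smoothZ; exact: smooth_exp.
apply/funext => z; rewrite /tensor; congr (_ * _).
have D : is_derive z.1 1 (fun x : R => r * x ^+ a) (r * (a%:R * z.1 ^+ a.-1)).
  have h : is_derive z.1 1 (fun x : R => x ^+ a) (a%:R * z.1 ^+ a.-1).
    have := is_derive_poly ('X^a : {poly R}) z.1.
    rewrite derivXn hornerMn hornerXn mulr_natl.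
    by rewrite (_ : horner 'X^a = fun x : R => x ^+ a)//; apply/funext => x; rewrite hornerXn.
  exact: (is_deriveZ r h).
by rewrite (derive1_ext D) mulrA.
Qed.

Lemma polyc_Cinf N c : Cinf (polyc N c).
Proof. by apply: Cinf_sum => a; apply: Cinf_sum => b; exact: Cinf_mono. Qed.

Lemma Pdeg_Cinf j p : Pdeg j p -> Cinf p.
Proof. by move=> /(Pdeg_polyc p (ltnSn j))[c _ ->]; exact: polyc_Cinf. Qed.

Lemma sum_shift N (F : nat -> R) : F 0%N = 0 -> F N = 0 ->
  \sum_(a < N) F a = \sum_(a < N) F a.+1.
Proof.
move=> F0 FN; have E1 : \sum_(a < N.+1) F a = \sum_(a < N) F a by rewrite big_ord_recr /= FN addr0.
by rewrite -E1 big_ord_recl /= F0 add0r.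
Qed.

(** Differentiation shifts the coefficients; since [j < N], the entry that the shift brings in at
    the end is zero, and the array keeps its size. *)
Lemma polyc_pdx j N c : (j < N)%N -> low j c ->
  pdx (polyc N c) = polyc N (fun a b => a.+1%:R * c a.+1 b).
Proof.
move=> jN lc; rewrite /polyc pdx_sum; last first.
  by move=> a; apply: Cinf_sum => b; exact: Cinf_mono.
apply/funext => z.
transitivity (\sum_(a < N) \sum_(b < N) (c a b * a%:R) * z.1 ^+ a.-1 * z.2 ^+ b).
  apply: eq_bigr => a _; rewrite pdx_sum; last by move=> b; exact: Cinf_mono.
  by apply: eq_bigr => b _; rewrite pdx_mono.
rewrite (sum_shift (F := fun a => \sum_(b < N) (c a b * a%:R) * z.1 ^+ a.-1 * z.2 ^+ b)).
- by apply: eq_bigr => a _; apply: eq_bigr => b _; rewrite [c _ _ * _]mulrC.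
- by apply: big1 => b _; rewrite mulr0 !mul0r.
- by apply: big1 => b _; rewrite lc ?mul0r// ltn_addr.
Qed.

Lemma polyc_pdy j N c : (j < N)%N -> low j c ->
  pdy (polyc N c) = polyc N (fun a b => b.+1%:R * c a b.+1).
Proof.
move=> jN lc; rewrite -[LHS]swapfK -pdx_swapf polyc_swapf (polyc_pdx jN) ?polyc_swapf//.
by move=> a b h; rewrite lc// addnC.
Qed.

Lemma Pdeg_pdx j p : Pdeg j.+1 p -> Pdeg j (pdx p).
Proof.
move=> /(Pdeg_polyc p (ltnSn j.+1))[c lc ->]; rewrite (polyc_pdx (ltnSn _) lc).
apply/(Pdeg_polyc _ (leqnSn j.+1)); exists (fun a b => a.+1%:R * c a.+1 b) => //.
by move=> a b h; rewrite lc ?mulr0// addSn.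
Qed.

Lemma Pdeg_pdy j p : Pdeg j.+1 p -> Pdeg j (pdy p).
Proof.
move=> /(Pdeg_polyc p (ltnSn j.+1))[c lc ->]; rewrite (polyc_pdy (ltnSn _) lc).
apply/(Pdeg_polyc _ (leqnSn j.+1)); exists (fun a b => b.+1%:R * c a b.+1) => //.
by move=> a b h; rewrite lc ?mulr0// addnS.
Qed.

Lemma coef_eq0 N (d : nat -> R) (x r : R) : 0 < r ->
  (forall t, `|t - x| < r -> \sum_(a < N) d a * t ^+ a = 0) ->
  forall a, (a < N)%N -> d a = 0.
Proof.
move=> r0 H; pose P : {poly R} := \poly_(a < N) d a.
suff P0 : P = 0.
  move=> a aN; have := congr1 (fun Q : {poly R} => Q`_a) P0.
  by rewrite coef_poly aN coef0.
apply/eqP/negPn/negP => Pn0.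
(* As many distinct roots as [size P], one more than the degree; denominators start at 2 to stay at
   distance less than [r] from [x]. *)
pose rs := [seq x + r / i.+2%:R | i <- iota 0 (size P)].
have urs : uniq rs.
  rewrite map_inj_uniq ?iota_uniq// => i k /addrI /(mulfI (lt0r_neq0 r0)) /invr_inj /eqP.
  by rewrite eqr_nat => /eqP [].
have ars : all (root P) rs.
  apply/allP => _ /mapP[i _ ->]; rewrite /root horner_poly; apply/eqP; apply: H.
  rewrite addrAC subrr add0r ger0_norm ?divr_ge0 ?ltW//.
  by rewrite ltr_pdivrMr// ltr_pMr// ltr1n.
by have := max_poly_roots Pn0 ars urs; rewrite size_map size_iota ltnn.
Qed.

Lemma polyc_eq0 N c x (r : R) : 0 < r -> (forall z, box x r z -> polyc N c z = 0) ->
  forall a b, (a < N)%N -> (b < N)%N -> c a b = 0.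
Proof.
move=> r0 H a b aN bN.
apply: (@coef_eq0 N (fun a => c a b) x.1 r r0) => // s sx.
apply: (@coef_eq0 N (fun b => \sum_(a < N) c a b * s ^+ a) x.2 r r0) => // t tx.
have E0 : polyc N c (s, t) = 0 by apply: H; rewrite boxE.
rewrite -[RHS]E0 /polyc [RHS]exchange_big /=.
by apply: eq_bigr => i _; rewrite mulr_suml.
Qed.

(** The potential is found coefficient by coefficient. A divergence that vanishes on a small square
    has all its coefficients zero. *)
Lemma Pdeg_potential k p1 p2 x (r : R) : 0 < r -> Pdeg k p1 -> Pdeg k p2 ->
  (forall z, box x r z -> pdx p1 z + pdy p2 z = 0) ->
  exists P, [/\ Pdeg k.+1 P, pdy P = p1 & pdx P = fun z => - p2 z].
Proof.
move=> r0; have kN : (k < k.+2)%N by rewrite leqW.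
move=> /(Pdeg_polyc p1 kN)[c1 l1 ->] /(Pdeg_polyc p2 kN)[c2 l2 ->].
rewrite (polyc_pdx kN l1) (polyc_pdy kN l2) => H.
have E a b : a.+1%:R * c1 a.+1 b + b.+1%:R * c2 a b.+1 = 0.
  have [ab|ab] := ltnP k (a + b).
    by rewrite l1 ?l2 ?mulr0 ?addr0// ?addSn ?addnS leqW.
  have aN : (a < k.+2)%N by rewrite ltnS leqW// (leq_trans _ ab)// leq_addr.
  have bN : (b < k.+2)%N by rewrite ltnS leqW// (leq_trans _ ab)// leq_addl.
  have := @polyc_eq0 k.+2 (fun a b => 1 * (a.+1%:R * c1 a.+1 b) + b.+1%:R * c2 a b.+1) x r r0.
  move=> /(_ _ a b aN bN); rewrite mul1r; apply.
  by move=> z zx; rewrite polyc_lin mul1r; exact: H.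
(* Powers of y come from integrating [p1] in y; the terms without y come from integrating - p2 along
   y = 0. The free constant term is 0. *)
pose C a b := if b is b'.+1 then c1 a b' / b%:R else if a is a'.+1 then - c2 a' 0%N / a%:R else 0.
have lC : low k.+1 C.
  move=> [|a] [|b] //=; rewrite ?addn0 ?add0n ?addSn ?addnS => h.
  - by rewrite l1 ?mul0r.
  - by rewrite l2 ?oppr0 ?mul0r// addn0.
  - by rewrite l1 ?mul0r// addSn.
exists (polyc k.+2 C); split.
- by apply/(Pdeg_polyc _ (ltnSn k.+1)); exists C.
- rewrite (polyc_pdy (ltnSn _) lC); congr polyc; apply/funext => a; apply/funext => b.
  by rewrite /C mulrC divfK.
- rewrite (polyc_pdx (ltnSn _) lC).
  rewrite (_ : (fun a b => _) = fun a b => (-1) * c2 a b + 0).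
    apply/funext => z; rewrite polyc_lin mulN1r /polyc [X in _ + X]big1 ?addr0// => a _.
    by apply: big1 => b _; rewrite !mul0r.
  apply/funext => a; apply/funext => -[|b] /=; rewrite addr0 mulN1r.
    by rewrite mulrC divfK.
  have := E a b; have b0 : (b.+1%:R : R) != 0 by rewrite pnatr_eq0.
  rewrite mulrA => /eqP; rewrite addr_eq0 => /eqP ->.
  by rewrite mulNr [X in X / _]mulrC mulfK.
Qed.

End Polynomials.

(** * Triangles and quadrilaterals *)

Section Geometry.
Context {R : realType}.
Notation plane := (measurableTypeR R * measurableTypeR R)%type.
Notation mu := (@lebesgue_measure R).
Implicit Types (D G T : set (R * R)) (p q r m x y z : R * R).

(** [area] integrates the lengths of vertical sections, which are points unless the line is
    vertical; a vertical line is a product with a point. *)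
Lemma line_negligible (A B C : R) : (A != 0) || (B != 0) ->
  area.-negligible ([set z : R * R | A * z.1 + B * z.2 = C] : set plane).
Proof.
move=> AB; set L := [set z | _].
have cL : continuous (fun z : R * R => A * z.1 + B * z.2).
  move=> z; apply: cvgD; (apply: cvgM; first exact: cvg_cst).
    exact: cvg_fst.
  exact: cvg_snd.
have mL : measurable (L : set plane).
  rewrite -[X in measurable X]setTI.
  exact: (continuous_measurable_plane cL measurableT (measurable_set1 C)).
apply/negligibleP => //.
have [B0|B0] := eqVneq B 0.
  move: AB; rewrite B0 eqxx orbF => A0.
  have -> : L = [set C / A] `*` setT.
    apply/seteqP; split=> z; rewrite /L /= B0 mul0r addr0.
      by move=> <-; split=> //; rewrite mulrC mulKf.
    by move=> [-> _]; rewrite mulrC divfK.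
  have E : (mu \x mu)%E ([set C / A] `*` setT) = 0%E.
    rewrite product_measure1E; [|exact: measurable_set1|exact: measurableT].
    by rewrite /= lebesgue_measure_set1 mul0e.
  exact: E.
suff E : (\int[mu]_x (mu \o xsection L) x)%E = 0%E by exact: E.
apply: integral0_eq => x _ /=.
have -> : xsection L x = [set (C - A * x) / B].
  apply/seteqP; split=> t; rewrite /xsection /= inE /L /=.
    by move=> <-; rewrite addrC addKr mulrC mulKf.
  by move=> ->; rewrite [B * _]mulrC divfK// addrC subrK.
exact: lebesgue_measure_set1.
Qed.

Lemma point_negligible p : area.-negligible ([set p] : set plane).
Proof.
apply: negligibleS (@line_negligible 1 0 p.1 _); last by rewrite oner_neq0.
by move=> z ->; rewrite /= mul1r mul0r addr0.
Qed.

Definition comb3 p q r (a b c : R) : R * R :=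
  (a * p.1 + b * q.1 + c * r.1, a * p.2 + b * q.2 + c * r.2).

Lemma hull3P p q r z : hull [:: p; q; r] z <->
  exists a b c, [/\ 0 <= a, 0 <= b, 0 <= c, a + b + c = 1 & z = comb3 p q r a b c].
Proof.
split.
  move=> [c [c0]]; rewrite !big_ord_recl !big_ord0 /= => c1 ->.
  exists (c 0%N), (c 1%N), (c 2%N); split=> //.
    by rewrite -c1 /bump /= !addr0 addrA.
  by rewrite /comb3 /bump /=; apply/pair_equal_spec; split; rewrite /= /GRing.scale /= !addr0 addrA.
move=> [a [b [c [a0 b0 c0 abc ->]]]].
exists (fun i => nth 0 [:: a; b; c] i); split.
- by move=> [|[|[|]]] //= i; rewrite nth_nil.
- by rewrite !big_ord_recl !big_ord0 /= addr0 addrA.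
- rewrite !big_ord_recl !big_ord0 /=.
  by rewrite /comb3; apply/pair_equal_spec; split; rewrite /= /GRing.scale /= !addr0 addrA.
Qed.

(** The open triangle. The factor [orient p q r] makes it independent of the order of the vertices,
    and empty when they are collinear. *)
Definition tri p q r : set (R * R) := [set z |
  [/\ 0 < orient p q r * orient q r z, 0 < orient p q r * orient r p z &
      0 < orient p q r * orient p q z]].

Lemma continuous_orient p q : continuous (orient p q : R * R -> R).
Proof.
move=> z; apply: cvgB.
  by apply: cvgM; [exact: cvg_cst|apply: cvgB; [exact: cvg_snd|exact: cvg_cst]].
by apply: cvgM; [exact: cvg_cst|apply: cvgB; [exact: cvg_fst|exact: cvg_cst]].
Qed.

Lemma open_tri p q r : open (tri p q r).
Proof.
have o s t : open [set z | 0 < orient p q r * orient s t z].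
  apply: (@open_comp _ _ (fun z => orient p q r * orient s t z) [set x | 0 < x]).
    by move=> z _; apply: cvgM; [exact: cvg_cst|exact: continuous_orient].
  exact: open_gt.
rewrite (_ : tri p q r = [set z | 0 < orient p q r * orient q r z] `&`
  ([set z | 0 < orient p q r * orient r p z] `&` [set z | 0 < orient p q r * orient p q z])).
  by do 2 (apply: openI => //).
by apply/seteqP; split=> z; [move=> [h1 h2 h3]|move=> [h1 [h2 h3]]].
Qed.

Definition segm x y (t : R) : R * R := (x.1 + t * (y.1 - x.1), x.2 + t * (y.2 - x.2)).

Lemma orient_segm p q x y t : orient p q (segm x y t) = (1 - t) * orient p q x + t * orient p q y.
Proof. by rewrite /orient /segm /=; lra. Qed.

Lemma tri_convex p q r x y t : 0 <= t <= 1 -> tri p q r x -> tri p q r y -> tri p q r (segm x y t).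
Proof.
move=> /andP[t0 t1] [x1 x2 x3] [y1 y2 y3].
have key (a b d : R) : 0 < d * a -> 0 < d * b -> 0 < d * ((1 - t) * a + t * b).
  move=> ha hb; rewrite mulrDr ![d * (_ * _)]mulrCA.
  have [->|tn0] := eqVneq t 0; first by rewrite subr0 mul1r mul0r addr0.
  have tpos : 0 < t by rewrite lt_def tn0.
  by apply: ltr_wpDl; [rewrite mulr_ge0 ?subr_ge0 // ltW|exact: mulr_gt0].
by split; rewrite orient_segm; apply: key.
Qed.

Lemma connected_convex G : (forall x y t, 0 <= t <= 1 -> G x -> G y -> G (segm x y t)) -> connected G.
Proof.
move=> cG; have [->|/set0P[x0 Gx0]] := eqVneq G set0; first exact: connected0.
have -> : G = \bigcup_(y in G) (segm x0 y @` `[0, 1]).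
  apply/seteqP; split=> [y Gy|y [w Gw [t]]].
    exists y => //; exists 1; first by rewrite /= in_itv /= ler01 lexx.
    by rewrite /segm !mul1r ![_ + (_ - _)]addrC !subrK -surjective_pairing.
  by rewrite /= in_itv /= => t01 <-; exact: cG.
apply: bigcup_connected.
  exists x0 => y Gy; exists 0; first by rewrite /= in_itv /= lexx ler01.
  by rewrite /segm !mul0r !addr0 -surjective_pairing.
move=> y Gy; apply: connected_continuous_connected.
  exact: segment_connected.
apply: continuous_subspaceT => t.
apply: (@cvg_pair _ _ _ _ (nbhs _) (nbhs _)).
  by apply: cvgD; [exact: cvg_cst|apply: cvgM; [exact: cvg_id|exact: cvg_cst]].
by apply: cvgD; [exact: cvg_cst|apply: cvgM; [exact: cvg_id|exact: cvg_cst]].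
Qed.

Lemma connected_tri p q r : connected (tri p q r).
Proof. by apply: connected_convex => x y t; exact: tri_convex. Qed.

(** The barycentric coordinates of [z] are the signed areas of the three triangles that it spans
    with the sides, divided by that of the whole. *)
Lemma tri_sub p q r : tri p q r `<=` hull [:: p; q; r].
Proof.
move=> z [z1 z2 z3]; apply/hull3P; set d := orient p q r in z1 z2 z3 *.
have d0 : d != 0 by apply/eqP => d0; rewrite d0 mul0r ltxx in z1.
have d2 : 0 < d ^+ 2 by rewrite exprn_even_gt0.
have pos a : 0 < d * a -> 0 <= a / d.
  move=> h; rewrite (_ : a / d = (d * a) / d ^+ 2); last by rewrite expr2 invfM mulrA [d * a]mulrC mulfK.
  by rewrite divr_ge0// ltW.
exists (orient q r z / d), (orient r p z / d), (orient p q z / d); split; [exact: pos|exact: pos|exact: pos| |].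
  rewrite -!mulrDl (_ : _ + _ = d) ?divff// /d /orient; lra.
have mD (a b e u v w t : R) : a * u + b * v + e * w = t * d -> t = a / d * u + b / d * v + e / d * w.
  by move=> E; apply: (mulIf d0); rewrite -E !mulrDl ![_ / d * _ * d]mulrAC !divfK.
rewrite /comb3 [LHS]surjective_pairing; apply/pair_equal_spec; split; apply: mD;
  rewrite /d /orient; lra.
Qed.

Lemma orient_comb p q r (a b c : R) : a + b + c = 1 ->
  [/\ orient q r (comb3 p q r a b c) = a * orient p q r,
      orient r p (comb3 p q r a b c) = b * orient p q r &
      orient p q (comb3 p q r a b c) = c * orient p q r].
Proof.
move=> abc; have -> : a = 1 - b - c by lra.
by split; rewrite /orient /comb3 /=; lra.
Qed.

Lemma orient_line p q : p != q -> area.-negligible ([set z | orient p q z = 0] : set plane).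
Proof.
move=> pq; apply: negligibleS (@line_negligible (p.2 - q.2) (q.1 - p.1)
  ((q.1 - p.1) * p.2 - (q.2 - p.2) * p.1) _).
  by move=> z /=; rewrite /orient; lra.
apply/negPn/negP; rewrite negb_or !negbK !subr_eq0 => /andP[/eqP h1 /eqP h2].
by move/eqP: pq; apply; case: (p) (q) h1 h2 => [? ?] [? ?] /= -> ->.
Qed.

(** A point with positive barycentric coordinates is in [tri], so the difference lies on the three
    side lines. A degenerate hull lies on a line or is a point. *)
Lemma hull_tri_negligible p q r : area.-negligible (hull [:: p; q; r] `\` tri p q r : set plane).
Proof.
have [d0|d0] := eqVneq (orient p q r) 0.
  have [pq|pq] := eqVneq p q; last first.
    apply: negligibleS (orient_line pq) => z [/hull3P[a [b [c [_ _ _ abc ->]]]] _] /=.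
    by have [_ _ ->] := orient_comb p q r abc; rewrite d0 mulr0.
  have [qr|qr] := eqVneq q r; last first.
    apply: negligibleS (orient_line qr) => z [/hull3P[a [b [c [_ _ _ abc ->]]]] _] /=.
    by have [-> _ _] := orient_comb p q r abc; rewrite d0 mulr0.
  apply: negligibleS (point_negligible p) => z [/hull3P[a [b [c [_ _ _ abc ->]]]] _] /=.
  rewrite /comb3 -qr -pq -!mulrDl abc !mul1r; exact/esym/surjective_pairing.
have ne p' q' r' : orient p' q' r' != 0 -> p' != q'.
  by apply: contra => /eqP ->; apply/eqP; rewrite /orient; lra.
have d1 : orient q r p != 0 by rewrite (_ : orient q r p = orient p q r)// /orient; lra.
have d2 : orient r p q != 0 by rewrite (_ : orient r p q = orient p q r)// /orient; lra.
apply: negligibleS (negligibleU (orient_line (ne _ _ _ d0))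
  (negligibleU (orient_line (ne _ _ _ d1)) (orient_line (ne _ _ _ d2)))).
move=> z [/hull3P[a [b [c [a0 b0 c0 abc zE]]]] nz].
have [E1 E2 E3] := orient_comb p q r abc; rewrite -zE in E1 E2 E3.
have [c00|cn0] := eqVneq c 0; first by left; rewrite /= E3 c00 mul0r.
have [a00|an0] := eqVneq a 0; first by right; left; rewrite /= E1 a00 mul0r.
have [b00|bn0] := eqVneq b 0; first by right; right; rewrite /= E2 b00 mul0r.
exfalso; apply: nz; rewrite /tri /= E1 E2 E3.
have dd : 0 < orient p q r ^+ 2 by rewrite exprn_even_gt0.
by split; rewrite mulrCA -expr2 mulr_gt0// lt_def ?an0 ?bn0 ?cn0.
Qed.

(** A Lipschitz domain has no slits: a point of the interior of the closure outside [D] would be a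
    boundary point, and the points straight below the graph there would be limits of points of [D],
    which lie above it. *)
Lemma lipschitz_interior D : open D -> lipschitz_boundary D -> interior (closure D) `<=` D.
Proof.
move=> oD lip z iz; apply: contrapT => nD.
have bz : bdry D z.
  split; first exact: interior_subset iz.
  by move=> /interior_subset.
have [c [s [g [cs lg /nbhs_boxP[e e0 He]]]]] := lip _ bz.
have /nbhs_boxP[e' e'0 He'] := iz.
(* In the local coordinates [z] is the origin; not being in [D], it is on or below the graph. *)
have g0 : 0 <= g 0.
  rewrite leNgt; apply/negP => g0; apply: nD; apply/(He z (box_center z e0)).
  by rewrite !subrr !mulr0 addr0 subr0.
have [L [L0 HL]] : exists L : R, 0 <= L /\ forall t, g 0 - L * `|t| <= g t.
  have [K [Kr HK]] := lg; exists (`|K| + 1); split; first by rewrite addr_ge0.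
  move=> t; have KL : K < `|K| + 1 by rewrite (le_lt_trans (ler_norm K))// ltrDl.
  have := HK _ KL (0, t) (conj I I); rewrite /= sub0r normrN => /ler_normlP[]; lra.
have n1 (a b : R) : a ^+ 2 + b ^+ 2 = 1 -> `|a| <= 1.
  by move=> h; rewrite -(@expr_le1 _ 2)// real_normK ?num_real//; have := sqr_ge0 b; lra.
have c1 := n1 _ _ cs; have s1 : `|s| <= 1 by apply: (n1 s c); rewrite addrC.
(* [w] is [z] lowered by [t]. A point of [D] within [d] of it in each coordinate is within 2d in the
   rotated ones, while the graph drops by at most 2dL from [g 0]; as 2d(L + 1) = t / 2, that point
   is below the graph. *)
pose t := Num.min e e' / 2; pose d := t / (4 * (L + 1)).
have t0 : 0 < t by rewrite divr_gt0// lt_min e0.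
have L1 : 0 < 4 * (L + 1) by lra.
have d0 : 0 < d by rewrite divr_gt0.
have dt : d * (4 * (L + 1)) = t by rewrite /d divfK// gt_eqF.
have te : t + t <= e by rewrite -splitr ge_min lexx.
have te' : t + t <= e' by rewrite -splitr ge_min lexx orbT.
pose w : R * R := (z.1 + s * t, z.2 - c * t).
have Ldt : 0 <= L * d by rewrite mulr_ge0// ltW.
have st : `|s * t| <= t by rewrite normrM (ger0_norm (ltW t0)) ler_piMl// ltW.
have ct : `|c * t| <= t by rewrite normrM (ger0_norm (ltW t0)) ler_piMl// ltW.
have cw : closure D w.
  apply: He'; rewrite boxE /w /=; move: st ct => /ler_normlP[? ?] /ler_normlP[? ?].
  by split; rewrite ltr_norml; lra.
have [w' [Dw']] := cw _ (nbhs_box w d0).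
rewrite boxE /w /= => -[w1 w2].
have we : box z e w'.
  rewrite boxE; move: st ct w1 w2 => /ler_normlP[? ?] /ler_normlP[? ?].
  by rewrite !ltr_norml => /andP[? ?] /andP[? ?]; split; apply/andP; split; lra.
have /(He _ we) := Dw'.
set xi := (X in g X); have xid : `|xi| <= d + d.
  have -> : xi = c * (w'.1 - (z.1 + s * t)) + s * (w'.2 - (z.2 - c * t)) by rewrite /xi; lra.
  apply: le_trans (ler_normD _ _) _; rewrite !normrM; apply: lerD; rewrite -[leRHS]mul1r;
    by apply: ler_pM => //; rewrite ltW // distrC.
have ct' : c * (w'.2 - z.2) - s * (w'.1 - z.1) <= d + d - t.
  have -> : c * (w'.2 - z.2) - s * (w'.1 - z.1) =
    c * (w'.2 - (z.2 - c * t)) - s * (w'.1 - (z.1 + s * t)) - (c ^+ 2 + s ^+ 2) * t by lra.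
  rewrite cs mul1r lerD2r; apply: le_trans (ler_norm _) _.
  apply: le_trans (ler_normB _ _) _; rewrite !normrM; apply: lerD; rewrite -[leRHS]mul1r;
    by apply: ler_pM => //; rewrite ltW // distrC.
have := HL xi; have : L * `|xi| <= L * (d + d) by rewrite ler_wpM2l.
lra.
Qed.

End Geometry.

(** * The mesh and its triangles *)

Section MeshGeometry.
Context {R : realType}.
Notation plane := (measurableTypeR R * measurableTypeR R)%type.
Notation quad := (4.-tuple (R * R)).
Implicit Types (D G T : set (R * R)) (p q r m x y z : R * R) (s t : seq (R * R)).

Lemma hull_nth s i : (i < size s)%N -> hull s (nth 0 s i).
Proof.
move=> si; exists (fun j => (j == i)%:R); split.
- by move=> j; rewrite ler0n.
- rewrite (bigD1 (Ordinal si))//= eqxx big1 ?addr0// => j ji.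
  by rewrite (_ : (_ == _) = false)//; apply/negbTE; apply: contra ji => /eqP ji; apply/eqP/val_inj.
- rewrite (bigD1 (Ordinal si))//= eqxx scale1r big1 ?addr0// => j ji.
  by rewrite (_ : (_ == _) = false) ?scale0r//; apply/negbTE; apply: contra ji => /eqP ji; apply/eqP/val_inj.
Qed.

Lemma hull_sub s t : (forall i, (i < size t)%N -> hull s (nth 0 t i)) -> hull t `<=` hull s.
Proof.
move=> st z [d [d0 d1 ->]].
have /choice[W HW] : forall i : 'I_(size t), exists c : nat -> R,
  [/\ forall i, 0 <= c i, \sum_(i < size s) c i = 1 &
      nth 0 t i = \sum_(i < size s) c i *: nth 0 s i] by move=> i; exact: st.
exists (fun j => \sum_(i < size t) d i * W i j); split.
- by move=> j; apply: sumr_ge0 => i _; apply: mulr_ge0 => //; have [] := HW i.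
- rewrite exchange_big /= -d1; apply: eq_bigr => i _.
  by have [_ e _] := HW i; rewrite -mulr_sumr e mulr1.
- under [RHS]eq_bigr do rewrite scaler_suml.
  rewrite exchange_big /=; apply: eq_bigr => i _.
  have [_ _ ->] := HW i; rewrite scaler_sumr; apply: eq_bigr => j _.
  by rewrite scalerA.
Qed.

Lemma crisscrossP D (Qh : seq quad) T : open D -> lipschitz_boundary D -> quad_mesh D Qh ->
  crisscross Qh T -> exists p q r, T = hull [:: p; q; r] /\ tri p q r `<=` D.
Proof.
move=> oD lD [_ cD _] [q [i [m [qQ m02 _ ->]]]].
exists (tnth q i), (tnth q (ordS i)), m; split=> //.
have hq (j : 'I_4) : hull q (tnth q j).
  by rewrite (tnth_nth 0); apply: hull_nth; rewrite size_tuple.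
apply: subset_trans (lipschitz_interior oD lD).
rewrite -open_subsetE; last exact: open_tri.
apply: subset_trans (@tri_sub _ _ _ _) _.
rewrite cD => z hz; exists q => //; apply: hull_sub hz => -[|[|[|//]]] _ /=.
- exact: hq.
- exact: hq.
- by apply: hull_sub m02 => -[|[|//]] _ /=; exact: hq.
Qed.

(* The four positive numbers are, up to the factor 1/(A + B), the areas of the
   triangles cut from the quadrilateral by its diagonals. *)
Lemma quad_center p0 p1 p2 p3 :
  0 < orient p0 p1 p2 -> 0 < orient p1 p2 p3 -> 0 < orient p2 p3 p0 -> 0 < orient p3 p0 p1 ->
  exists a0 a1 a2 a3 : R, [/\ [/\ 0 < a0, 0 < a1, 0 < a2 & 0 < a3], a0 + a2 = 1, a1 + a3 = 1,
    a0 * p0.1 + a2 * p2.1 = a1 * p1.1 + a3 * p3.1 &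
    a0 * p0.2 + a2 * p2.2 = a1 * p1.2 + a3 * p3.2].
Proof.
set E := orient p0 p1 p2; set B := orient p1 p2 p3; set F := orient p2 p3 p0.
set A := orient p3 p0 p1 => E0 B0 F0 A0.
have AB : A + B = E + F by rewrite /A /B /E /F /orient; lra.
have s0 : 0 < A + B by rewrite addr_gt0.
have sn : A + B != 0 by rewrite gt_eqF.
exists (B / (A + B)), (F / (A + B)), (A / (A + B)), (E / (A + B)); split.
- by split; apply: divr_gt0.
- by rewrite -mulrDl [B + A]addrC divff.
- by rewrite -mulrDl AB [F + E]addrC divff// -AB.
- by rewrite ![_ / _ * _]mulrAC -!mulrDl; congr (_ / _); rewrite /A /B /E /F /orient; lra.
- by rewrite ![_ / _ * _]mulrAC -!mulrDl; congr (_ / _); rewrite /A /B /E /F /orient; lra.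
Qed.

(** The largest multiple of (a, a') that can be removed from (c, c') with nonnegative remainders;
    the factor is the smaller of the two quotients. *)
Lemma peel (c c' a a' : R) : 0 <= c -> 0 <= c' -> 0 < a -> 0 < a' ->
  exists u d d', [/\ 0 <= u, 0 <= d, 0 <= d', c = u * a + d & c' = u * a' + d' /\ (d = 0 \/ d' = 0)].
Proof.
move=> c0 c0' a0 a0'; have [h|h] := leP (c / a) (c' / a').
  exists (c / a), 0, (c' - c / a * a'); split=> //.
  - by rewrite divr_ge0// ltW.
  - by rewrite subr_ge0 -ler_pdivlMr.
  - by rewrite divfK ?gt_eqF// addr0.
  - by rewrite addrC subrK; split=> //; left.
exists (c' / a'), (c - c' / a' * a), 0; split=> //.
- by rewrite divr_ge0// ltW.
- by rewrite subr_ge0 -ler_pdivlMr// ltW.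
- by rewrite addrC subrK.
- by rewrite divfK ?gt_eqF// addr0; split=> //; right.
Qed.

(** [m] is a convex combination of the ends of either diagonal. Given weights of [z] on the four
    vertices, as much of [m] as possible is extracted from each diagonal; one vertex of each
    survives, and two such vertices are consecutive. *)
Lemma quad_cover (q : quad) : convex_quad q -> exists m,
  [/\ hull [:: tnth q 0; tnth q 2] m, hull [:: tnth q 1; tnth q 3] m &
      forall z, hull q z -> exists i, hull [:: tnth q i; tnth q (ordS i); m] z].
Proof.
case: q => -[|p0 [|p1 [|p2 [|p3 [|? ?]]]]] // sq cq.
have t (i : 'I_4) : tnth (Tuple sq) i = nth 0 [:: p0; p1; p2; p3] i by exact: tnth_nth.
pose o (i : nat) (h : (i < 4)%N) := Ordinal h.
have o0 := cq (@o 0%N isT) (@o 2 isT) isT isT; have o1 := cq (@o 1%N isT) (@o 3 isT) isT isT.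
have o2 := cq (@o 2 isT) (@o 0%N isT) isT isT; have o3 := cq (@o 3 isT) (@o 1%N isT) isT isT.
rewrite !t /= in o0 o1 o2 o3; rewrite !t /=.
have [a0 [a1 [a2 [a3 [[a0p a1p a2p a3p] a02 a13 e1 e2]]]]] := quad_center o0 o1 o2 o3.
pose m : R * R := (a0 * p0.1 + a2 * p2.1, a0 * p0.2 + a2 * p2.2).
have hull2 p r (a b : R) : 0 <= a -> 0 <= b -> a + b = 1 ->
    hull [:: p; r] (a * p.1 + b * r.1, a * p.2 + b * r.2).
  move=> ha hb ab; exists (fun i => nth 0 [:: a; b] i); split.
  - by move=> [|[|]] //= i; rewrite nth_nil.
  - by rewrite !big_ord_recl !big_ord0 /= addr0.
  - by rewrite !big_ord_recl !big_ord0 /=; apply/pair_equal_spec; split; rewrite /= /GRing.scale /= !addr0.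
exists m; split.
- by apply: hull2 => //; exact: ltW.
- by rewrite /m e1 e2; apply: hull2 => //; exact: ltW.
move=> z [c [c0]]; rewrite !big_ord_recl !big_ord0 /= /bump /= => c1 zE.
have [u [d0 [d2 [u0 d00 d20 cE0 [cE2 D02]]]]] := peel (c0 0%N) (c0 2) a0p a2p.
have [v [d1 [d3 [v0 d10 d30 cE1 [cE3 D13]]]]] := peel (c0 1%N) (c0 3) a1p a3p.
rewrite !addr0 in c1.
have sum1 : d0 + d1 + d2 + d3 + (u + v) = 1.
  rewrite cE0 cE2 cE1 cE3 in c1; have h1 : u * a0 + u * a2 = u by rewrite -mulrDr a02 mulr1.
  have h2 : v * a1 + v * a3 = v by rewrite -mulrDr a13 mulr1.
  lra.
have zE' : z = (d0 * p0.1 + d1 * p1.1 + d2 * p2.1 + d3 * p3.1 + (u + v) * m.1,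
                d0 * p0.2 + d1 * p1.2 + d2 * p2.2 + d3 * p3.2 + (u + v) * m.2).
  rewrite zE; apply/pair_equal_spec; split; rewrite /= /GRing.scale /= cE0 cE2 cE1 cE3.
    by rewrite [(u + v) * _]mulrDl {2}e1; lra.
  by rewrite [(u + v) * _]mulrDl {2}e2; lra.
have uv0 : 0 <= u + v by rewrite addr_ge0.
case: D02 D13 => [d|d] [d'|d']; rewrite {}d {}d' in d00 d10 d20 d30 sum1 zE'.
- exists (@o 2 isT); rewrite !t /=; apply/hull3P; exists d2, d3, (u + v); split=> //; first by lra.
  by rewrite zE' /comb3 !mul0r !add0r.
- exists (@o 1%N isT); rewrite !t /=; apply/hull3P; exists d1, d2, (u + v); split=> //; first by lra.
  by rewrite zE' /comb3 !mul0r !add0r !addr0.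
- exists (@o 3 isT); rewrite !t /=; apply/hull3P; exists d3, d0, (u + v); split=> //; first by lra.
  by rewrite zE' /comb3 !mul0r !addr0 ![d3 * _ + _]addrC.
- exists (@o 0%N isT); rewrite !t /=; apply/hull3P; exists d0, d1, (u + v); split=> //; first by lra.
  by rewrite zE' /comb3 !mul0r !addr0.
Qed.

(** Finitely many triangles cover [D]; sums of the absolute values of their bounds play the role of
    a maximum. *)
Lemma mesh_bound D (Qh : seq quad) (u : R * R -> R) : quad_mesh D Qh ->
  (forall T, crisscross Qh T -> exists K : R, area.-negligible (T `&` [set z | K < `|u z|] : set plane)) ->
  exists K : R, area.-negligible (D `&` [set z | K < `|u z|] : set plane).
Proof.
move=> [cq cD _] H.
have hq (q : quad) : q \in Qh -> exists K : R, area.-negligible (hull q `&` [set z | K < `|u z|] : set plane).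
  move=> qQ; have [m [m1 m2 hm]] := quad_cover (cq _ qQ).
  have /choice[K HK] : forall i : 'I_4, exists K : R, area.-negligible
      (hull [:: tnth q i; tnth q (ordS i); m] `&` [set z | K < `|u z|] : set plane).
    by move=> i; apply: H; exists q, i, m.
  exists (\sum_i `|K i|).
  (* The union runs over all naturals; [inord] sends those beyond 3 to a triangle already
     present. *)
  apply: negligibleS (negligible_bigcup (fun n => HK (inord n))) => z [/hm [i hi] /= Kz].
  exists (val i) => //=; rewrite inord_val; split=> //.
  apply: le_lt_trans Kz; rewrite (bigD1 i)//=; apply: (le_trans (ler_norm _)).
  by rewrite lerDl sumr_ge0.
have /choice[K HK] : forall q : quad, exists K : R, q \in Qh ->
    area.-negligible (hull q `&` [set z | K < `|u z|] : set plane).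
  move=> q; have [/hq [K HK]|_] := boolP (q \in Qh); first by exists K.
  by exists 0.
exists (\sum_(q <- Qh) `|K q|).
pose Q n : quad := nth [tuple 0 | i < 4] Qh n.
have HQ n : area.-negligible ((if (n < size Qh)%N then
    hull (Q n) `&` [set z | K (Q n) < `|u z|] else set0) : set plane).
  case: ifP => nQ; last exact: negligible_set0.
  by apply: HK; exact: mem_nth.
apply: negligibleS (negligible_bigcup HQ) => z [/subset_closure].
rewrite cD => -[q /= qQ hz] Kz.
exists (index q Qh) => //; rewrite /Q index_mem qQ nth_index//; split=> //=.
apply: le_lt_trans Kz; apply: (le_trans (ler_norm _)).
by rewrite (big_rem q)//= lerDl sumr_ge0.
Qed.

End MeshGeometry.

(** * Sobolev spaces *)

Section L2Functions.
Context {R : realType}.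
Notation plane := (measurableTypeR R * measurableTypeR R)%type.
Implicit Types (D G : set (R * R)) (u v f g : R * R -> R).

Lemma L2P D u : measurable (D : set plane) ->
  L2 D u <-> measurable_fun (D : set plane) u /\ L1 D (fun z => u z ^+ 2).
Proof.
move=> mD; have E : (fun z => (u \_ D) z ^+ 2) = ((fun z => u z ^+ 2) \_ D : plane -> R).
  by apply/funext => z; rewrite /patch; case: ifP => // _; rewrite expr0n.
have E' : EFin \o (fun z => (u \_ D) z ^+ 2) = (EFin \o (fun z => u z ^+ 2)) \_ D.
  by rewrite E; apply/funext => z; rewrite /patch /=; case: ifP.
split=> [L|[mu Lu]].
  split; first by move: L => /sub_Lfun_mfun; rewrite inE => /(measurable_restrictT _ mD).
  by apply/(integrable_mkcond _ mD); rewrite -E'; exact: Lfun2_integrable_sqr.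
have mu' : measurable_fun (setT : set plane) (u \_ D) by apply/(measurable_restrictT _ mD).
rewrite /L2 inE; apply/andP; split; rewrite inE //= /finite_norm unlock.
apply: poweR_lty.
move/(integrable_mkcond _ mD): Lu; rewrite -E' => /integrableP[_].
apply: le_lt_trans; apply: ge0_le_integral => //.
- by move=> z _; apply: poweR_ge0.
- apply/measurable_EFinP; apply: (@measurableT_comp _ _ _ _ _ _ (fun x : R => x `^ 2)%R) => //.
  exact: measurableT_comp.
- by apply: measurableT_comp => //; apply/measurable_EFinP; exact: measurable_funX.
- by move=> z _ /=; rewrite lee_fin normrX powR_mulrn.
Qed.

Lemma L2_lin D (c : R) u v : L2 D u -> L2 D v -> L2 D (fun z => c * u z + v z).
Proof.
move=> Lu Lv; rewrite /L2.
have p1 : (1 <= 2%:E :> \bar R)%E by rewrite lee_fin ler1n.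
have := (Lfun_submod_closed (area : {measure set plane -> \bar R}) p1).2 c _ _ Lu Lv.
rewrite (_ : c *: u \_ D + v \_ D = (fun z => c * u z + v z) \_ D)//.
apply/funext => z; rewrite !fctE /patch; case: ifP => // _.
by rewrite scaler0 addr0.
Qed.

Lemma L1_ae D u v : measurable (D : set plane) -> L1 D u -> measurable_fun (D : set plane) v ->
  eq_on D u v -> L1 D v.
Proof.
move=> mD Lu mv uv; have mu := measurable_int area Lu.
apply/integrableP; split; first exact/measurable_EFinP.
move/integrableP: Lu => [_]; congr (_ < _)%E; apply: ae_eq_integral => //.
- exact: measurableT_comp.
- by apply: measurableT_comp => //; exact/measurable_EFinP.
- by move: uv; apply: ae_areaS => z /[apply] /= ->.
Qed.

Lemma L1_bounded D u (K : R) : open D -> (area D < +oo)%E -> measurable_fun (D : set plane) u ->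
  area.-negligible (D `&` [set z | K < `|u z|] : set plane) -> L1 D u.
Proof.
move=> oD fD mu nK; have mD := open_measurable_plane oD.
(* The bound on [u] holds off a null set only; clipping gives a copy bounded at every point. *)
pose v z := Num.max (- K) (Num.min K (u z)).
have mv : measurable_fun (D : set plane) v.
  by apply: measurable_maxr => //; apply: measurable_minr.
apply: (@L1_ae D v) => //.
  apply: measurable_bounded_integrable => //.
  exists `|K|; split; first exact: num_real.
  move=> x Kx z _ /=; rewrite (le_trans _ (ltW Kx))// ler_norml.
  have := ler_norm K; have := ler_norm (- K); rewrite normrN => h1 h2.
  by rewrite le_max ge_max ge_min; apply/andP; split; [|apply/andP; split];
    rewrite ?h1 ?h2 //; apply/orP; left; lra.
apply: negligibleS nK => z /not_implyP[Dz nv]; split=> //=.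
rewrite ltNge; apply/negP; rewrite ler_norml => /andP[h1 h2]; apply: nv.
by rewrite /v min_r// max_r.
Qed.

Lemma L2_bounded D u (K : R) : open D -> (area D < +oo)%E -> measurable_fun (D : set plane) u ->
  area.-negligible (D `&` [set z | K < `|u z|] : set plane) -> L2 D u.
Proof.
move=> oD fD mu nK; apply/(L2P _ (open_measurable_plane oD)); split=> //.
apply: (@L1_bounded _ _ (K ^+ 2)) => //; first exact: measurable_funX.
apply: negligibleS nK => z [Dz /= h]; split=> //=.
rewrite ltNge; apply/negP => h'; move: h; rewrite normrX ltNge => /negP; apply.
by rewrite ler_pXn2r// nnegrE (le_trans _ h').
Qed.

(** |u| <= 1 + u^2, and the area is finite. *)
Lemma L2_L1 D u : open D -> (area D < +oo)%E -> L2 D u -> L1 D u.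
Proof.
move=> oD fD /(L2P _ (open_measurable_plane oD))[mu Lu]; have mD := open_measurable_plane oD.
have L1' : L1 D (fun=> 1).
  by apply: (@L1_bounded _ _ 1) => //; apply: negligibleS (negligible_set0 _) => z [_ /=];
    rewrite normr1 ltxx.
have L := integrableD mD L1' Lu.
apply: le_integrable L => //; first exact/measurable_EFinP.
move=> z _ /=; rewrite lee_fin.
have s0 := sqr_ge0 (u z); rewrite [leRHS]ger0_norm ?addr_ge0//.
by rewrite ler_norml; have := sqr_ge0 (u z - 1); have := sqr_ge0 (u z + 1);
   rewrite !expr2 => h1 h2; apply/andP; split; nra.
Qed.

Lemma bounded_rect D : bounded_set D ->
  exists2 M : R, 0 < M & forall z, D z -> `|z.1| <= M /\ `|z.2| <= M.
Proof.
move=> [M [Mr HM]]; exists (`|M| + 1); first by rewrite ltr_wpDl.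
move=> z Dz; have h : `|z| <= `|M| + 1.
  by apply: HM => //; rewrite (le_lt_trans (ler_norm M))// ltrDl.
have [h1 h2] : `|z.1| <= `|z| /\ `|z.2| <= `|z|.
  by rewrite [`|z|]prod_normE !le_max !lexx orbT.
by split; [exact: le_trans h1 h|exact: le_trans h2 h].
Qed.

Lemma bounded_area D : open D -> bounded_set D -> (area D < +oo)%E.
Proof.
move=> oD /bounded_rect[M M0 HM].
apply: le_lt_trans (area_rect_fin (- (M + 1)) (M + 1) (- (M + 1)) (M + 1)).
apply: le_measure; rewrite ?inE; [exact: open_measurable_plane|exact: measurable_rect|].
move=> z /HM[]; rewrite rectE !ler_norml => /andP[h1 h2] /andP[h3 h4].
by split; apply/andP; split; lra.
Qed.

Lemma continuous_bounded D f : bounded_set D -> continuous f ->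
  exists K : R, forall z, D z -> `|f z| <= K.
Proof.
move=> /bounded_rect[M M0 HM] cf; have [K _ HK] := rect_bounded (- M) M (- M) M cf.
by exists K => z /HM [h1 h2]; apply: HK; rewrite -ler_norml.
Qed.

Lemma L2_continuous D f : open D -> bounded_set D -> continuous f -> L2 D f.
Proof.
move=> oD bD cf; have [K HK] := continuous_bounded bD cf.
apply: (@L2_bounded _ _ K) => //; first exact: bounded_area.
  by apply: measurable_funTS; exact: continuous_measurable_plane.
apply: negligibleS (negligible_set0 _) => z [/HK h /=].
by rewrite ltNge h.
Qed.

End L2Functions.

(** * Weak derivatives of smooth functions and constants *)

Section WeakDerivativesPolynomials.
Context {R : realType}.
Implicit Types (D : set (R * R)) (p : R * R -> R).

Lemma weak00 D u : @weak_deriv R D 0 0 u u.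
Proof. by move=> phi _; rewrite /= expr0 mul1e. Qed.

Lemma weak_Cinf_x D p : Cinf p -> weak_deriv D 1 0 p (pdx p).
Proof.
move=> cp phi tp; have [c1 _ _] := tp.
rewrite -(integral_test p (@subsetT _ D) (test_pdx tp)) -(integral_test (pdx p) (@subsetT _ D) tp).
by rewrite (integral_by_parts_x (cp 1%N) (c1 1%N) (test_CK tp)) expr1 EFinN mulN1e.
Qed.

Lemma weak_Cinf_y D p : Cinf p -> weak_deriv D 0 1 p (pdy p).
Proof.
move=> cp phi tp; have [c1 _ _] := tp.
rewrite -(integral_test p (@subsetT _ D) (test_pdy tp)) -(integral_test (pdy p) (@subsetT _ D) tp).
by rewrite (integral_by_parts_y (cp 1%N) (c1 1%N) (test_CK tp)) expr1 EFinN mulN1e.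
Qed.

Lemma pd_cst (c : R) : pdx (fun=> c) = (fun=> 0) /\ pdy (fun=> c) = (fun=> 0).
Proof. by split; apply/funext => z; rewrite /pdx /pdy derive1_cst. Qed.

Lemma weak_cst D a b (c : R) : exists c' : R, weak_deriv D a b (fun=> c) (fun=> c').
Proof.
have [Ex Ey] := pd_cst 0.
have W0 : weak_deriv D 1 0 (fun=> 0) (fun=> 0) /\ weak_deriv D 0 1 (fun=> 0) (fun=> 0).
  have := @weak_Cinf_x D _ (Cinf_cst 0); have := @weak_Cinf_y D _ (Cinf_cst 0).
  by rewrite Ex Ey.
have W a' b' : weak_deriv D a' b' (fun=> 0) (fun=> 0).
  have Hy : weak_deriv D 0 b' (fun=> 0) (fun=> 0).
    by elim: b' => [|b' IH]; [exact: weak00|exact: (weak_comp W0.2 IH)].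
  elim: a' => [|a' IH]; first exact: Hy.
  exact: (weak_comp W0.1 IH).
case: a => [|a]; last first.
  exists 0; have := @weak_Cinf_x D _ (Cinf_cst c); rewrite (pd_cst c).1 => h.
  exact: (weak_comp h (W a b)).
case: b => [|b]; first by exists c; exact: weak00.
exists 0; have := @weak_Cinf_y D _ (Cinf_cst c); rewrite (pd_cst c).2 => h.
exact: (weak_comp h (W 0%N b)).
Qed.

End WeakDerivativesPolynomials.

(** * Sobolev spaces on a bounded open set *)

Section SobolevSpaces.
Context {R : realType}.
Variable D : set (R * R).
Hypotheses (oD : open D) (bD : bounded_set D).
Implicit Types (u v g : R * R -> R) (a b m : nat).

Let fD : (area D < +oo)%E := bounded_area oD bD.

Lemma wD_spec m u a b : Hm D m u -> (a + b <= m)%N ->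
  L2 D (wD D a b u) /\ weak_deriv D a b u (wD D a b u).
Proof.
move=> [_ H] /H[g Lg Wg]; rewrite /wD.
exact: (@getPex _ [set g | L2 D g /\ weak_deriv D a b u g]) (ex_intro _ g (conj Lg Wg)).
Qed.

Lemma wD_eq u g a b : L2 D g -> weak_deriv D a b u g -> eq_on D (wD D a b u) g.
Proof.
move=> Lg Wg; have [L W] : L2 D (wD D a b u) /\ weak_deriv D a b u (wD D a b u).
  rewrite /wD; exact: (@getPex _ [set g | L2 D g /\ weak_deriv D a b u g]) (ex_intro _ g (conj Lg Wg)).
exact: (weak_unique oD (L2_L1 oD fD L) (L2_L1 oD fD Lg) W Wg).
Qed.

Lemma weak_lin a b (c : R) u v g h : L2 D u -> L2 D v -> L2 D g -> L2 D h ->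
  weak_deriv D a b u g -> weak_deriv D a b v h ->
  weak_deriv D a b (fun z => c * u z + v z) (fun z => c * g z + h z).
Proof. by move=> *; apply: weak_linear => //; exact: L2_L1. Qed.

Lemma Hm_lin m (c : R) u v : Hm D m u -> Hm D m v -> Hm D m (fun z => c * u z + v z).
Proof.
move=> Hu Hv; split; first by apply: L2_lin; [case: Hu|case: Hv].
move=> a b ab; have [Lg Wg] := wD_spec Hu ab; have [Lh Wh] := wD_spec Hv ab.
exists (fun z => c * wD D a b u z + wD D a b v z); first exact: L2_lin.
by apply: weak_lin => //; [case: Hu|case: Hv].
Qed.

Lemma wD_lin m (c : R) u v a b : Hm D m u -> Hm D m v -> (a + b <= m)%N ->
  eq_on D (wD D a b (fun z => c * u z + v z)) (fun z => c * wD D a b u z + wD D a b v z).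
Proof.
move=> Hu Hv ab; have [Lg Wg] := wD_spec Hu ab; have [Lh Wh] := wD_spec Hv ab.
apply: wD_eq; first exact: L2_lin.
by apply: weak_lin => //; [case: Hu|case: Hv].
Qed.

Lemma wD_ae m u v a b : Hm D m u -> Hm D m v -> (a + b <= m)%N -> eq_on D u v ->
  eq_on D (wD D a b u) (wD D a b v).
Proof.
move=> Hu Hv ab uv; have [Lg Wg] := wD_spec Hu ab; have [Lh Wh] := wD_spec Hv ab.
have L1D w : L2 D w -> L1 D w by exact: L2_L1.
apply: (wD_eq Lh); have Lu := L1D _ Hu.1; have Lv := L1D _ Hv.1.
exact: (weak_eq oD Lv Lu (L1D _ Lh) (L1D _ Lh) (eq_on_sym uv) (@eq_on_refl _ _ _ _) Wh).
Qed.

Lemma Hm_wD m u a b : Hm D (a + b + m) u -> Hm D m (wD D a b u).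
Proof.
move=> Hu; have [Lg Wg] := wD_spec Hu (leq_addr m (a + b)); split=> // a' b' ab'.
have le : (a + a' + (b + b') <= a + b + m)%N by rewrite addnACA leq_add2l.
have [Lh Wh] := wD_spec Hu le.
by exists (wD D (a + a') (b + b') u); [exact: Lh|exact: (weak_cancel Wg Wh)].
Qed.

Lemma wD_wD m u a b a' b' : Hm D m u -> (a + b <= m)%N -> (a + a' + (b + b') <= m)%N ->
  eq_on D (wD D a' b' (wD D a b u)) (wD D (a + a') (b + b') u).
Proof.
move=> Hu ab le; have [Lg Wg] := wD_spec Hu ab; have [Lh Wh] := wD_spec Hu le.
exact: (wD_eq Lh (weak_cancel Wg Wh)).
Qed.

Lemma Hm_cst m (c : R) : Hm D m (fun=> c).
Proof.
have L (d : R) : L2 D (fun=> d) by apply: L2_continuous => // z; exact: cvg_cst.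
split=> // a b _; have [c' W] := weak_cst D a b c.
by exists (fun=> c').
Qed.

Lemma HmN m u : Hm D m u -> Hm D m (fun z => - u z).
Proof.
move=> Hu; rewrite (_ : (fun z => - u z) = fun z => (-2) * u z + u z); first exact: Hm_lin.
by apply/funext => z; lra.
Qed.

Lemma wDN m u a b : Hm D m u -> (a + b <= m)%N ->
  eq_on D (wD D a b (fun z => - u z)) (fun z => - wD D a b u z).
Proof.
move=> Hu ab; rewrite (_ : (fun z => - u z) = fun z => (-2) * u z + u z); last first.
  by apply/funext => z; lra.
rewrite (_ : (fun z => - wD D a b u z) = fun z => (-2) * wD D a b u z + wD D a b u z).
  exact (wD_lin (-2) Hu Hu ab).
by apply/funext => z; lra.
Qed.

(** On [G] both functions are weak derivatives of [p], and weak derivatives are unique. Applied to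
    open triangles, it identifies [wD] with the classical derivative of a polynomial. *)
Lemma wD_poly u p a b G : open G -> G `<=` D -> L2 D u ->
  eq_on G u p -> continuous p -> L2 D (wD D a b u) -> weak_deriv D a b u (wD D a b u) ->
  forall g, continuous g -> weak_deriv G a b p g -> eq_on G (wD D a b u) g.
Proof.
move=> oG GD Lu up cp Lw Ww g cg Wg.
have bG : bounded_set G by move: bD => [M [Mr HM]]; exists M; split=> // x Mx z /GD; exact: HM.
have fG := bounded_area oG bG.
have L1G w : L2 D w -> L1 G w by move=> Lw'; exact: (L1S oD oG GD (L2_L1 oD fD Lw')).
have LC w : continuous w -> L1 G w by move=> cw; apply: L2_L1 => //; exact: L2_continuous.
apply: (weak_unique oG (L1G _ Lw) (LC _ cg) _ Wg).
by apply: (@weak_eq _ _ _ _ u p (wD D a b u)) => //;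
  [exact: L1G|exact: LC|exact: L1G|exact: L1G|exact: eq_on_refl|exact: weakS GD Ww].
Qed.

End SobolevSpaces.

(** * The complex *)

Section Complex.
Context {R : realType}.
Notation quad := (4.-tuple (R * R)).
Implicit Types (u v : R * R -> R) (T : set (R * R)).

Lemma eq_on_lin T (c : R) u u' v v' : eq_on T u u' -> eq_on T v v' ->
  eq_on T (fun z => c * u z + v z) (fun z => c * u' z + v' z).
Proof. by apply: ae_areaS2 => z + + Tz => /(_ Tz) -> /(_ Tz) ->. Qed.

Lemma eq_on_pair T u u' v v' : eq_on T u u' -> eq_on T v v' ->
  eq_on T (fun z => (u z, v z)) (fun z => (u' z, v' z)).
Proof. by apply: ae_areaS2 => z + + Tz => /(_ Tz) -> /(_ Tz) ->. Qed.

Lemma eq_on_map {V W : Type} T (F : V -> W) (u v : R * R -> V) : eq_on T u v ->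
  eq_on T (F \o u) (F \o v).
Proof. by apply: ae_areaS => z + Tz => /(_ Tz) /= ->. Qed.

Lemma eq_onN T u v : eq_on T u v -> eq_on T (fun z => - u z) (fun z => - v z).
Proof. exact: (@eq_on_map _ _ T (fun x => - x)). Qed.

Lemma eq_onD T u u' v v' : eq_on T u u' -> eq_on T v v' ->
  eq_on T (fun z => u z + v z) (fun z => u' z + v' z).
Proof. by apply: ae_areaS2 => z + + Tz => /(_ Tz) -> /(_ Tz) ->. Qed.

Lemma poly_on_lin T j (c : R) u v : poly_on T j u -> poly_on T j v ->
  poly_on T j (fun z => c * u z + v z).
Proof.
move=> [p Pp up] [q Pq vq]; exists (fun z => c * p z + q z); first exact: Pdeg_lin.
exact: eq_on_lin.
Qed.

Lemma poly_on_cst T j (c : R) : poly_on T j (fun=> c).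
Proof. by exists (fun=> c); [exact: Pdeg_cst|exact: eq_on_refl]. Qed.

Lemma poly_onN T j u : poly_on T j u -> poly_on T j (fun z => - u z).
Proof.
move=> Pu; rewrite (_ : (fun z => - u z) = fun z => (-1) * u z + 0).
  exact: poly_on_lin Pu (poly_on_cst T j 0).
by apply/funext => z; rewrite mulN1r addr0.
Qed.

Lemma eq_on_hull p q r u v : eq_on (tri p q r) u v -> eq_on (hull [:: p; q; r]) u v.
Proof.
move=> E; apply: negligibleS (negligibleU E (hull_tri_negligible p q r)) => z /not_implyP[Tz nz].
have [tz|tz] := pselect (tri p q r z); [left|right] => //.
by move=> /(_ tz).
Qed.

Variables (D : set (R * R)) (Qh : seq quad).
Hypotheses (oD : open D) (bD : bounded_set D) (lD : lipschitz_boundary D)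
  (mD : quad_mesh D Qh).

(** Weak derivatives are identified on the open triangle, which lies in [D]; the closed one adds a
    null set. *)
Lemma poly_on_wD j m u T : Hm D m.+1 u -> crisscross Qh T -> poly_on T j.+1 u ->
  poly_on T j (wD D 1 0 u) /\ poly_on T j (wD D 0 1 u).
Proof.
move=> Hu /(crisscrossP oD lD mD)[p [q [r [-> tD]]]] [P PP uP].
have uP' := eq_onS (@tri_sub _ p q r) uP.
have cP := Pdeg_Cinf PP.
split.
  have [L W] := wD_spec Hu (isT : (1 + 0 <= m.+1)%N).
  exists (pdx P); first exact: Pdeg_pdx.
  apply: eq_on_hull; apply: (wD_poly oD bD (@open_tri _ p q r) tD Hu.1 uP' (Cinf_continuous cP) L W).
    exact: Cinf_continuous (Cinf_pdx cP).
  exact: weak_Cinf_x.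
have [L W] := wD_spec Hu (isT : (0 + 1 <= m.+1)%N).
exists (pdy P); first exact: Pdeg_pdy.
apply: eq_on_hull; apply: (wD_poly oD bD (@open_tri _ p q r) tD Hu.1 uP' (Cinf_continuous cP) L W).
  exact: Cinf_continuous (Cinf_pdy cP).
exact: weak_Cinf_y.
Qed.

Lemma Sigma_subspace k : Defs.subspace (Sigma_h D Qh k).
Proof.
split; first by split; [exact: Hm_cst|move=> T _; exact: poly_on_cst].
move=> a f g [Hf Pf] [Hg Pg]; split; first exact: Hm_lin.
by move=> T cT; apply: poly_on_lin; [exact: Pf|exact: Pg].
Qed.

Lemma V_subspace k : Defs.subspace (V_h D Qh k).
Proof.
split.
  by split; [exact: Hm_cst|exact: Hm_cst|move=> T _; split; exact: poly_on_cst].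
move=> a f g [Hf1 Hf2 Pf] [Hg1 Hg2 Pg]; split; [exact: (Hm_lin oD bD a Hf1 Hg1)|exact: (Hm_lin oD bD a Hf2 Hg2)|].
move=> T cT; have [pf1 pf2] := Pf T cT; have [pg1 pg2] := Pg T cT.
by split; [exact: (poly_on_lin a pf1 pg1)|exact: (poly_on_lin a pf2 pg2)].
Qed.

Lemma div_L2 (v : R * R -> R * R) : Hm D 1 (fst \o v) -> Hm D 1 (snd \o v) -> L2 D (div D v).
Proof.
move=> H1 H2; have [L1' _] := wD_spec H1 (isT : (1 + 0 <= 1)%N).
have [L2' _] := wD_spec H2 (isT : (0 + 1 <= 1)%N).
rewrite (_ : div D v = fun z => 1 * wD D 1 0 (fst \o v) z + wD D 0 1 (snd \o v) z); first exact: L2_lin.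
by apply/funext => z; rewrite mul1r.
Qed.

Lemma div_lin (a : R) (f g : R * R -> R * R) :
  Hm D 1 (fst \o f) -> Hm D 1 (snd \o f) -> Hm D 1 (fst \o g) -> Hm D 1 (snd \o g) ->
  eq_on D (div D (fun z => a *: f z + g z)) (fun z => a * div D f z + div D g z).
Proof.
move=> Hf1 Hf2 Hg1 Hg2.
have := eq_onD (wD_lin oD bD a Hf1 Hg1 (isT : (1 + 0 <= 1)%N)) (wD_lin oD bD a Hf2 Hg2 (isT : (0 + 1 <= 1)%N)).
rewrite [X in eq_on _ _ X -> _](_ : _ = fun z => a * div D f z + div D g z); first exact.
by apply/funext => z; rewrite /div mulrDr addrACA.
Qed.

Lemma W_subspace k : Defs.subspace (W_h D Qh k).
Proof.
have [V0 Vl] := @V_subspace k; split.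
  split; first by have [] := Hm_cst oD bD 0 0.
  exists (fun=> 0) => //.
  have [c1 W1] := weak_cst D 1 0 0; have [c2 W2] := weak_cst D 0 1 0.
  have [Ex Ey] := @pd_cst R 0.
  have L0 := (Hm_cst oD bD 0 0).1.
  have Wx := @weak_Cinf_x R D _ (Cinf_cst 0); rewrite Ex in Wx.
  have Wy := @weak_Cinf_y R D _ (Cinf_cst 0); rewrite Ey in Wy.
  have := eq_onD (wD_eq oD bD L0 Wx) (wD_eq oD bD L0 Wy).
  rewrite [X in eq_on _ _ X -> _](_ : _ = fun=> 0); first exact: eq_on_sym.
  by apply/funext => z; rewrite addr0.
move=> a f g [Lf [v Vv fv]] [Lg [w Vw gw]]; split; first exact: (L2_lin a Lf Lg).
exists (fun z => a *: v z + w z); first exact: Vl.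
have [v1 v2 _] := Vv; have [w1 w2 _] := Vw.
apply: eq_on_trans (eq_on_lin a fv gw) _; apply: eq_on_sym; exact: div_lin.
Qed.

Lemma curl_map k : linear_map D (Sigma_h D Qh k.+1) (V_h D Qh k) (curl D).
Proof.
have le01 : (0 + 1 <= 2)%N by []; have le10 : (1 + 0 <= 2)%N by [].
split.
- move=> f [Hf Pf].
  have H1 : Hm D 1 (wD D 0 1 f) := @Hm_wD R D 1 f 0 1 Hf.
  have H2 : Hm D 1 (wD D 1 0 f) := @Hm_wD R D 1 f 1 0 Hf.
  split; [exact: H1|exact: (HmN oD bD H2)|move=> T cT].
  have [p1 p2] := poly_on_wD Hf cT (Pf T cT).
  by split; [exact: p2|exact: (poly_onN p1)].
- move=> f g [Hf _] [Hg _] fg; apply: eq_on_pair; first exact: (wD_ae oD bD Hf Hg le01 fg).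
  exact: eq_onN (wD_ae oD bD Hf Hg le10 fg).
- move=> a f g [Hf _] [Hg _].
  have := eq_on_pair (wD_lin oD bD a Hf Hg le01) (eq_onN (wD_lin oD bD a Hf Hg le10)).
  congr eq_on; apply/funext => z; apply/pair_equal_spec; split=> //=.
  by rewrite /GRing.scale /=; lra.
Qed.

Lemma div_map k : linear_map D (V_h D Qh k) (W_h D Qh k) (div D).
Proof.
split.
- move=> v Vv; have [H1 H2 _] := Vv; split; first exact: div_L2.
  by exists v => //; exact: eq_on_refl.
- move=> f g [f1 f2 _] [g1 g2 _] fg; apply: eq_onD.
    exact: (wD_ae oD bD f1 g1 (isT : (1 + 0 <= 1)%N) (eq_on_map fst fg)).
  exact: (wD_ae oD bD f2 g2 (isT : (0 + 1 <= 1)%N) (eq_on_map snd fg)).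
- by move=> a f g [f1 f2 _] [g1 g2 _]; exact: div_lin.
Qed.

Lemma sequence_complex k :
  is_complex D (Sigma_h D Qh k.+1) (curl D) (V_h D Qh k) (div D) (W_h D Qh k).
Proof.
split.
- split; [exact: Sigma_subspace|exact: V_subspace|exact: W_subspace].
- split; [|exact: curl_map|exact: div_map].
  by move=> c; split; [exact: Hm_cst|move=> T _; exact: poly_on_cst].
- move=> c; have [Ex Ey] := pd_cst c; have L0 := (Hm_cst oD bD 0 0).1.
  have Wx := @weak_Cinf_x R D _ (Cinf_cst c); rewrite Ex in Wx.
  have Wy := @weak_Cinf_y R D _ (Cinf_cst c); rewrite Ey in Wy.
  have := eq_on_pair (wD_eq oD bD L0 Wy) (eq_onN (wD_eq oD bD L0 Wx)).
  by rewrite [X in eq_on _ _ X -> _](_ : _ = fun=> 0)//; apply/funext => z; rewrite oppr0.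
- move=> f [Hf _].
  have H2 : Hm D 1 (wD D 1 0 f) := @Hm_wD R D 1 f 1 0 Hf.
  (* Both terms of the divergence of the curl reduce to the same [wD D 1 1 f], with opposite
     signs. *)
  have E1 := @wD_wD R D oD bD 2 f 0 1 1 0 Hf isT isT.
  have E2 := @wD_wD R D oD bD 2 f 1 0 0 1 Hf isT isT.
  have E3 := wDN oD bD H2 (isT : (0 + 1 <= 1)%N).
  have := eq_onD E1 (eq_on_trans E3 (eq_onN E2)).
  rewrite [X in eq_on _ _ X -> _](_ : _ = fun=> 0); first exact.
  by apply/funext => z; rewrite subrr.
Qed.

End Complex.

(** * Potentials on contractible domains *)

Section Potential.
Context {R : realType}.
Notation plane := (measurableTypeR R * measurableTypeR R)%type.
Implicit Types (D G : set (R * R)) (u v f g h gx gy : R * R -> R) (p q x y z : R * R).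

Lemma bdd2W (M N : R) g : M <= N -> bdd2 M g -> bdd2 N g.
Proof.
move=> MN [mg gM gs]; split=> // [z|z /gs[h1 h2]]; first exact: le_trans (gM z) MN.
by split; [exact: le_trans h1 MN|exact: le_trans h2 MN].
Qed.

(** Provides a representative on the whole plane with a bounded support, as primitives along full
    lines require. [M] adds the bound on the values and the one on [D]. *)
Lemma truncation D u (K : R) : open D -> bounded_set D -> measurable_fun (D : set plane) u ->
  area.-negligible (D `&` [set z | K < `|u z|] : set plane) ->
  exists M g, [/\ 0 < M, bdd2 M g & eq_on D u g].
Proof.
move=> oD bD mu nK; have mD := open_measurable_plane oD.
have [N N0 HN] := bounded_rect bD.
pose M := `|K| + N; have M0 : 0 < M by rewrite ltr_wpDl.
pose t z := Num.max (- M) (Num.min M (u z)).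
have mt : measurable_fun (D : set plane) t.
  by apply: measurable_maxr => //; apply: measurable_minr.
have tM z : `|t z| <= M.
  by rewrite ler_norml le_max ge_max ge_min; apply/andP; split; [|apply/andP; split];
    rewrite ?lexx//; lra.
exists M, (t \_ D); split=> //.
  split.
  - by apply/(measurable_restrictT _ mD).
  - by move=> z; rewrite /patch; case: ifP => // _; rewrite normr0 ltW.
  - move=> z; rewrite /patch; case: ifPn; last by rewrite eqxx.
    rewrite inE => /HN[h1 h2] _.
    by split; [apply: le_trans h1 _|apply: le_trans h2 _]; rewrite lerDr.
apply: negligibleS nK => z /not_implyP[Dz nv]; split=> //=.
rewrite ltNge; apply/negP => uK; apply: nv; rewrite /patch mem_set// /t.
have : `|u z| <= M by rewrite (le_trans uK)// (le_trans (ler_norm K))// lerDl ltW.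
by rewrite ler_norml => /andP[h1 h2]; rewrite min_r// max_r.
Qed.

(* The lower bound makes rho large on a neighbourhood of each point, although
   rho is not continuous. *)
Lemma box_radius D : open D -> exists rho : R * R -> R, forall p, D p ->
  [/\ 0 < rho p, box p (rho p) `<=` D & forall m, box p (2 ^- m) `<=` D -> 2 ^- m <= rho p].
Proof.
move=> oD; suff /choice[rho H] : forall p, exists r : R, D p -> [/\ 0 < r, box p r `<=` D &
    forall m, box p (2 ^- m) `<=` D -> 2 ^- m <= r] by exists rho.
move=> p.
have [Dp|nDp] := pselect (D p); last by exists 0.
have [r r0 rD] := open_box_in oD Dp.
have p2 m : 0 < (2 : R) ^- m by rewrite invr_gt0 exprn_gt0.
have ex : exists n, `[< box p (2 ^- n) `<=` D >].
  have [m mr] := inv_exp2_le r0; exists m; apply/asboolP.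
  by apply: subset_trans rD; apply: boxS; exact: mr.
case: (ex_minnP ex) => n /asboolP nD nmin.
exists (2 ^- n) => _; split=> // m mD.
rewrite lef_pV2 ?posrE ?exprn_gt0// ler_weXn2l ?ler1n//.
by apply: nmin; apply/asboolP.
Qed.

Lemma box_trans p q (r s : R) : box p r q -> box q s `<=` box p (r + s).
Proof.
move=> pq z; move: pq; rewrite !boxE => -[h1 h2] [h3 h4].
split; [rewrite (_ : z.1 - p.1 = (q.1 - p.1) + (z.1 - q.1))|rewrite (_ : z.2 - p.2 = (q.2 - p.2) + (z.2 - q.2))];
  try (by lra); by rewrite (le_lt_trans (ler_normD _ _))// ltrD.
Qed.

Lemma box_sym p q (r : R) : box p r q -> box q r p.
Proof. by rewrite !boxE !(distrC q.1) !(distrC q.2). Qed.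

Lemma box_fin p (r : R) : (area (box p r) < +oo)%E.
Proof. exact: area_rect_fin. Qed.

Lemma L1_lin D (c : R) u v : measurable (D : set plane) -> L1 D u -> L1 D v ->
  L1 D (fun z => c * u z + v z).
Proof. by move=> mD Lu Lv; exact (integrableD mD (integrableZl mD c Lu) Lv). Qed.

(** Two squares meet in a rectangle, on which the difference has zero gradient; for an empty
    intersection any constant will do. *)
Lemma box_potential_unique p q (r s M K L : R) f g gx gy :
  0 < M -> bdd2 M gx -> bdd2 M gy -> bm K f -> bm L g ->
  weak_deriv (box p r) 1 0 f gx -> weak_deriv (box p r) 0 1 f gy ->
  weak_deriv (box q s) 1 0 g gx -> weak_deriv (box q s) 0 1 g gy ->
  exists C, eq_on (box p r `&` box q s) f (fun z => g z + C).
Proof.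
move=> M0 Bx By Bf Bg Wfx Wfy Wgx Wgy.
have subl : box p r `&` box q s `<=` box p r by move=> z [].
have subr : box p r `&` box q s `<=` box q s by move=> z [].
have [Q0|/set0P[z0 Qz0]] := eqVneq (box p r `&` box q s) set0.
  by exists 0; rewrite Q0; apply: eq_on_pointwise.
have := weakS subl Wfx; have := weakS subl Wfy; have := weakS subr Wgx; have := weakS subr Wgy.
rewrite /box rectI in Qz0 *.
set a := Num.max _ _ in Qz0 *; set b := Num.min _ _ in Qz0 *.
set c := Num.max _ _ in Qz0 *; set d := Num.min _ _ in Qz0 *.
move: Qz0; rewrite rectE => -[/andP[h1 h2] /andP[h3 h4]].
have ab := lt_trans h1 h2; have cd := lt_trans h3 h4.
have oQ := @open_rect R a b c d; have fQ := area_rect_fin a b c d.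
have L1f := bm_L1 oQ fQ Bf; have L1g := bm_L1 oQ fQ Bg.
have mQ := open_measurable_plane oQ.
have L1x : L1 (rect a b c d) gx.
  by apply: (@bm_L1 _ M) => //; case: Bx.
have L1y : L1 (rect a b c d) gy.
  by apply: (@bm_L1 _ M) => //; case: By.
move=> V1 V2 V3 V4.
have D1 := weak_linear (-1) oQ L1g L1f L1x L1x V2 V4.
have D2 := weak_linear (-1) oQ L1g L1f L1y L1y V1 V3.
have E (w : R * R -> R) : (fun z => -1 * w z + w z) = (fun=> 0).
  by apply/funext => z; rewrite mulN1r addNr.
rewrite !E in D1 D2.
have L1u : L1 (rect a b c d) (fun z => -1 * g z + f z).
  exact: L1_lin.
have [C HC] := zero_gradient_rect ab cd L1u D1 D2.
exists C; move: HC; apply: ae_areaS => z + Qz => /(_ Qz); lra.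
Qed.

(** The common cross derivative [h] expresses that the gradient [(gx, gy)] is curl-free. The
    conclusion is local because [F] is not yet known to be integrable over [D]. *)
Lemma potential D (M : R) gx gy h : open D -> bounded_set D -> contractible D -> 0 < M ->
  bdd2 M gx -> bdd2 M gy -> weak_deriv D 1 0 gy h -> weak_deriv D 0 1 gx h ->
  exists2 F, measurable_fun (D : set plane) F & forall p, D p ->
    exists r, [/\ 0 < r, box p r `<=` D, L1 (box p r) F,
      weak_deriv (box p r) 1 0 F gx & weak_deriv (box p r) 0 1 F gy].
Proof.
move=> oD bD cD M0 Bx By Wy Wx.
have D0 : D !=set0 by case: cD => x0 Dx0 _; exists x0.
have [rho Hrho] := box_radius oD.
have /choice[f Hf] : forall p, exists f : R * R -> R, D p -> [/\ exists2 K, 0 < K & bm K f,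
    weak_deriv (box p (rho p)) 1 0 f gx & weak_deriv (box p (rho p)) 0 1 f gy].
  move=> p; have [Dp|nDp] := pselect (D p); last by exists (fun=> 0).
  have [r0 rD _] := Hrho _ Dp.
  have l1 : p.1 - rho p < p.1 + rho p by lra.
  have l2 : p.2 - rho p < p.2 + rho p by lra.
  have [phi tp|f Hf] := local_potential l1 l2 M0 Bx By; last by exists f.
  by rewrite (weakS rD Wy tp) (weakS rD Wx tp).
have /choice[c Hc] : forall pq : (R * R) * (R * R), exists C : R, D pq.1 -> D pq.2 ->
    eq_on (box pq.1 (rho pq.1) `&` box pq.2 (rho pq.2)) (f pq.1) (fun z => f pq.2 z + C).
  move=> [p q] /=; have [[Dp Dq]|nD] := pselect (D p /\ D q); last first.
    by exists 0 => Dp Dq; exfalso; apply: nD.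
  have [[K K0 BK] W1 W2] := Hf _ Dp; have [[L L0 BL] W3 W4] := Hf _ Dq.
  have [C HC] := box_potential_unique M0 Bx By BK BL W1 W2 W3 W4.
  by exists C.
have [C HC] : exists C : R * R -> R, forall x, D x -> exists r,
    [/\ 0 < r, box x r `<=` D & forall y, box x r y -> C x - C y = c (x, y)].
  apply: (local_cocycle (c := fun x y => c (x, y)) oD cD) => p Dp.
  have [r0 rD rho_min] := Hrho _ Dp; have [e e0 eD] := open_box_in oD Dp.
  (* Twice the radius: for [x] within 2^-m of [p], the square of radius 2^-m around [x] is still in
     [D], so [rho x] is at least 2^-m and the square of [x] contains [p]. *)
  have [m me] : exists m, 2 ^- m + 2 ^- m <= e.
    have [m me] := inv_exp2_le (divr_gt0 e0 (ltr0Sn R 1)).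
    by exists m; rewrite [leRHS]splitr lerD// me.
  have p20 : 0 < (2 : R) ^- m by rewrite invr_gt0 exprn_gt0.
  have pD : box p (2 ^- m + 2 ^- m) `<=` D.
    by apply: subset_trans eD; exact: boxS.
  have inD x : box p (2 ^- m) x -> D x /\ box x (rho x) p.
    move=> px; have Dx : D x by apply: pD; apply: boxS px; rewrite lerDl ltW.
    split=> //; have [_ _ xmin] := Hrho _ Dx.
    apply: boxS (box_sym px); apply: xmin; apply: subset_trans pD; exact: box_trans.
  exists (2 ^- m); split=> //.
    by apply: subset_trans pD; apply: boxS; rewrite lerDl ltW.
  move=> x y z /inD[Dx xp] /inD[Dy yp] /inD[Dz zp].
  (* Contains [p], hence is a nonempty open set on which the three constants can be compared. *)
  pose U := box x (rho x) `&` (box y (rho y) `&` box z (rho z)).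
  apply: (@eq_on_cst _ U).
  - by apply: openI; [|apply: openI]; exact: open_box.
  - by exists p.
  - have E1 : eq_on U _ _ := eq_onS _ (Hc (x, y) Dx Dy).
    have E2 : eq_on U _ _ := eq_onS _ (Hc (y, z) Dy Dz).
    have E3 : eq_on U _ _ := eq_onS _ (Hc (x, z) Dx Dz).
    have {}E1 := E1 (fun w (h : U w) => conj h.1 h.2.1).
    have {}E2 := E2 (fun w (h : U w) => conj h.2.1 h.2.2).
    have {}E3 := E3 (fun w (h : U w) => conj h.1 h.2.2).
    have E4 : eq_on U (fun w => f y w + c (x, y)) (fun w => f z w + c (y, z) + c (x, y)).
      by move: E2; apply: ae_areaS => w + Uw => /(_ Uw) /= ->.
    have E5 := eq_on_trans (eq_on_sym (eq_on_trans E1 E4)) E3.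
    by move: E5; apply: ae_areaS => w + Uw => /(_ Uw) /=; lra.
have /choice[r Hr] : forall p, exists r : R, D p -> [/\ 0 < r, r <= rho p &
    forall y, box p r y -> C p - C y = c (p, y)].
  move=> p; have [Dp|nDp] := pselect (D p); last by exists 0.
  have [r [r0 _ rC]] := HC _ Dp; have [rho0 _ _] := Hrho _ Dp.
  exists (Num.min r (rho p)) => _; split; first by rewrite lt_min r0.
    by rewrite ge_min lexx orbT.
  by move=> y py; apply: rC; apply: boxS py; rewrite ge_min lexx.
have brD p : D p -> box p (r p) `<=` box p (rho p).
  by move=> Dp; have [_ ? _] := Hr _ Dp; exact: boxS.
have rD p : D p -> box p (r p) `<=` D.
  by move=> Dp; have [_ rhoD _] := Hrho _ Dp; apply: subset_trans rhoD; exact: brD.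
pose k p z := 1 * f p z + - C p.
have mk p : D p -> measurable_fun (setT : set plane) (k p).
  move=> Dp; have [[K K0 [mf _]] _ _] := Hf _ Dp.
  by apply: measurable_funD => //; apply: measurable_funM.
have L1k p : D p -> L1 (box p (r p)) (k p) /\ L1 (box p (r p)) (f p).
  move=> Dp; have [[K K0 Bf] _ _] := Hf _ Dp.
  have L1f := bm_L1 (@open_box _ p (r p)) (box_fin p (r p)) Bf.
  split=> //; apply: L1_lin => //; first exact: measurable_rect.
  exact: L1_cst.
(* [p] and [q] may be too far apart for C p - C q to be compared with c (p, q); both functions are
   compared with [f z] near each common point [z]. *)
have kk p q : D p -> D q -> eq_on (box p (r p) `&` box q (r q)) (k p) (k q).
  move=> Dp Dq; apply: eq_on_local => z [pz qz]; have Dz := rD _ Dp _ pz.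
  exists (box z (rho z)); first by apply: nbhs_box; have [] := Hrho _ Dz.
  have [_ _ Cp] := Hr _ Dp; have [_ _ Cq] := Hr _ Dq.
  have Ep := Hc (p, z) Dp Dz; have Eq := Hc (q, z) Dq Dz.
  have ep := Cp _ pz; have eq := Cq _ qz.
  apply: ae_areaS2 Ep Eq => w /= ep' eq' [[pw qw] zw]; rewrite /k.
  have e1 := ep' (conj (brD _ Dp _ pw) zw); have e2 := eq' (conj (brD _ Dq _ qw) zw).
  rewrite e1 e2; lra.
have [|F mF HF] := glue oD D0 _ mk kk.
  by move=> p Dp; split; [have [] := Hr _ Dp|exact: rD].
exists F => // p Dp; exists (r p).
have oB := @open_box _ p (r p); have mB := open_measurable_plane oB; have fB := box_fin p (r p).
have [L1kp L1fp] := L1k _ Dp.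
have FB : measurable_fun (box p (r p) : set plane) F.
  by apply: measurable_funS mF; [exact: open_measurable_plane|exact: rD].
have kF := eq_on_sym (HF _ Dp).
have L1F : L1 (box p (r p)) F := L1_ae mB L1kp FB kF.
have L1x : L1 (box p (r p)) gx.
  by apply: (@bm_L1 _ M) => //; case: Bx.
have L1y : L1 (box p (r p)) gy.
  by apply: (@bm_L1 _ M) => //; case: By.
have [_ Wfx Wfy] := Hf _ Dp.
have Wf0 := @weak_Cinf_x R (box p (r p)) _ (Cinf_cst (- C p)).
have Wf1 := @weak_Cinf_y R (box p (r p)) _ (Cinf_cst (- C p)).
rewrite (pd_cst _).1 in Wf0; rewrite (pd_cst _).2 in Wf1.
have L1c (e : R) : L1 (box p (r p)) (fun=> e) by exact: L1_cst.
have E (g : R * R -> R) : (fun z => 1 * g z + 0) = g.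
  by apply/funext => z; rewrite mul1r addr0.
have W1 := weak_linear 1 oB L1fp (L1c _) L1x (L1c 0) (weakS (brD _ Dp) Wfx) Wf0.
have W2 := weak_linear 1 oB L1fp (L1c _) L1y (L1c 0) (weakS (brD _ Dp) Wfy) Wf1.
rewrite !E in W1 W2.
split; [by have [] := Hr _ Dp|exact: rD|exact: L1F| |].
  exact: (weak_eq oB L1kp L1F L1x L1x kF (@eq_on_refl _ _ _ _) W1).
exact: (weak_eq oB L1kp L1F L1y L1y kF (@eq_on_refl _ _ _ _) W2).
Qed.

End Potential.

(** * Exactness of the sequence *)

Section Exactness.
Context {R : realType}.
Notation plane := (measurableTypeR R * measurableTypeR R)%type.
Notation quad := (4.-tuple (R * R)).
Implicit Types (u f : R * R -> R) (T : set (R * R)).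
Variables (D : set (R * R)) (Qh : seq quad).
Hypotheses (oD : open D) (bD : bounded_set D) (lD : lipschitz_boundary D)
  (mD : quad_mesh D Qh).

Let fD : (area D < +oo)%E := bounded_area oD bD.

Lemma curl_zero m f : connected D -> Hm D m.+1 f -> eq_on D (curl D f) (fun=> 0) ->
  exists c, eq_on D f (fun=> c).
Proof.
move=> cD Hf E0.
have [Lx Wx] := wD_spec Hf (isT : (1 + 0 <= m.+1)%N).
have [Ly Wy] := wD_spec Hf (isT : (0 + 1 <= m.+1)%N).
have L1D u : L2 D u -> L1 D u := L2_L1 oD fD.
have L0 := L1D _ (Hm_cst oD bD 0 0).1; have Lf := L1D _ Hf.1.
have Ex : eq_on D (wD D 1 0 f) (fun=> 0).
  by move: E0; apply: ae_areaS => z + Dz => /(_ Dz) [_ /eqP]; rewrite oppr_eq0 => /eqP.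
have Ey : eq_on D (wD D 0 1 f) (fun=> 0).
  by move: E0; apply: ae_areaS => z + Dz => /(_ Dz) [-> _].
have W1 := weak_eq oD Lf Lf (L1D _ Lx) L0 (@eq_on_refl _ _ _ f) Ex Wx.
have W2 := weak_eq oD Lf Lf (L1D _ Ly) L0 (@eq_on_refl _ _ _ f) Ey Wy.
exact: zero_gradient oD cD Lf W1 W2.
Qed.

Lemma tri_bounded T u j : crisscross Qh T -> poly_on T j u ->
  exists K, area.-negligible (T `&` [set z | K < `|u z|] : set plane).
Proof.
move=> /(crisscrossP oD lD mD)[p [q [r [-> tD]]]] [P PP uP].
have [K HK] := continuous_bounded bD (Cinf_continuous (Pdeg_Cinf PP)).
exists K; apply: negligibleS (negligibleU uP (hull_tri_negligible p q r)) => z [hz /= Kz].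
have [tz|tz] := pselect (tri p q r z); [left|right; split] => //.
by move=> /(_ hz) uz; move: Kz; rewrite uz ltNge HK//; exact: tD.
Qed.

(** [F] minus the polynomial potential of (p1, p2) has zero weak gradient on small squares;
    connectedness merges the local constants. *)
Lemma poly_potential G p1 p2 k F gx gy : open G -> connected G -> G `<=` D ->
  Pdeg k p1 -> Pdeg k p2 -> eq_on G gy p1 -> eq_on G gx (fun z => - p2 z) ->
  (forall z, G z -> pdx p1 z + pdy p2 z = 0) ->
  (forall p, D p -> exists r, [/\ 0 < r, box p r `<=` D, L1 (box p r) F,
      weak_deriv (box p r) 1 0 F gx & weak_deriv (box p r) 0 1 F gy]) ->
  measurable_fun (setT : set plane) gx -> measurable_fun (setT : set plane) gy ->
  exists2 P, Pdeg k.+1 P & eq_on G F P.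
Proof.
move=> oG cG GD P1 P2 E1 E2 div0 HF mgx mgy.
have [->|/set0P[x0 Gx0]] := eqVneq G set0.
  by exists (fun=> 0); [exact: Pdeg_cst|apply: eq_on_pointwise].
have [r r0 rG] := open_box_in oG Gx0.
have [P [PP Py Px]] := Pdeg_potential r0 P1 P2 (fun z h => div0 z (rG z h)).
have cP := Pdeg_Cinf PP.
have [C HC] : exists C, eq_on G (fun z => -1 * P z + F z) (fun=> C).
  apply: locally_const_ae => // x Gx.
  have [s [s0 sD LF Wx Wy]] := HF _ (GD _ Gx); have [t t0 tG] := open_box_in oG Gx.
  pose e := Num.min s t; have e0 : 0 < e by rewrite lt_min s0.
  have es : box x e `<=` box x s by apply: boxS; rewrite ge_min lexx.
  have eG : box x e `<=` G by apply: subset_trans tG; apply: boxS; rewrite ge_min lexx orbT.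
  have oB := @open_box _ x e; have mB := open_measurable_plane oB.
  have fB := box_fin x e.
  have bB : bounded_set (box x e).
    by move: bD => [M [Mr HM]]; exists M; split=> // y My z /eG/GD; exact: HM.
  have LC w : continuous w -> L1 (box x e) w.
    by move=> cw; apply: (L2_L1 oB fB); exact: L2_continuous.
  have L1P := LC _ (Cinf_continuous cP).
  have L1x := LC _ (Cinf_continuous (Cinf_pdx cP)).
  have L1y := LC _ (Cinf_continuous (Cinf_pdy cP)).
  have L1F := L1S (@open_box _ x s) oB es LF.
  have Ex : eq_on (box x e) gx (pdx P) by rewrite Px; exact: eq_onS eG E2.
  have Ey : eq_on (box x e) gy (pdy P) by rewrite Py; exact: eq_onS eG E1.
  have l1 : x.1 - e < x.1 + e by lra.
  have l2 : x.2 - e < x.2 + e by lra.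
  have L1gx := L1_ae mB L1x (measurable_funTS mgx) (eq_on_sym Ex).
  have L1gy := L1_ae mB L1y (measurable_funTS mgy) (eq_on_sym Ey).
  have W1 := weak_eq oB L1F L1F L1gx L1x (@eq_on_refl _ _ _ F) Ex (weakS es Wx).
  have W2 := weak_eq oB L1F L1F L1gy L1y (@eq_on_refl _ _ _ F) Ey (weakS es Wy).
  have E0 (w : R * R -> R) : (fun z => -1 * w z + w z) = (fun=> 0).
    by apply/funext => z; rewrite mulN1r addNr.
  have D1 := weak_linear (-1) oB L1P L1F L1x L1x (@weak_Cinf_x _ _ _ cP) W1.
  have D2 := weak_linear (-1) oB L1P L1F L1y L1y (@weak_Cinf_y _ _ _ cP) W2.
  rewrite !E0 in D1 D2.
  have [C HC] := zero_gradient_rect l1 l2 (L1_lin (-1) mB L1P L1F) D1 D2.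
  by exists e, C; split=> //; apply: eq_onS HC => z [].
exists (fun z => 1 * P z + C).
  exact: Pdeg_lin PP (Pdeg_cst _ C).
by move: HC; apply: ae_areaS => z + Gz => /(_ Gz); lra.
Qed.

Lemma div_free_potential k v : contractible D -> V_h D Qh k v -> eq_on D (div D v) (fun=> 0) ->
  exists2 f, Sigma_h D Qh k.+1 f & eq_on D v (curl D f).
Proof.
move=> cD [H1 H2 Pv] div0; have meD := open_measurable_plane oD.
have H2N := HmN oD bD H2.
have L1D u : L2 D u -> L1 D u := L2_L1 oD fD.
have mL2 u : L2 D u -> measurable_fun (D : set plane) u by move=> /(L2P _ meD)[].
have [K1 HK1] := mesh_bound mD (fun T cT => tri_bounded cT (Pv T cT).1).
have [K2 HK2] := mesh_bound mD (fun T cT => tri_bounded cT (poly_onN (Pv T cT).2)).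
(* [gy] represents the first component of [v] and [gx] the opposite of the second, since the curl of
   F consists of its y-derivative and minus its x-derivative. *)
have [M1 [gy [M10 By vy]]] := truncation oD bD (mL2 _ H1.1) HK1.
have [M2 [gx [M20 Bx vx]]] := truncation oD bD (mL2 _ H2N.1) HK2.
pose M := M1 + M2; have M0 : 0 < M by rewrite addr_gt0.
have {}By : bdd2 M gy by apply: bdd2W By; rewrite lerDl ltW.
have {}Bx : bdd2 M gx by apply: bdd2W Bx; rewrite lerDr ltW.
have [mgy gyM _] := By; have [mgx gxM _] := Bx.
have L1y : L1 D gy := bm_L1 oD fD (conj mgy gyM).
have L1x : L1 D gx := bm_L1 oD fD (conj mgx gxM).
have [L10 W10] := wD_spec H1 (isT : (1 + 0 <= 1)%N).
have [L01 W01] := wD_spec H2 (isT : (0 + 1 <= 1)%N).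
have [L01N W01N] := wD_spec H2N (isT : (0 + 1 <= 1)%N).
have hE : eq_on D (wD D 0 1 (fun z => - (snd \o v) z)) (wD D 1 0 (fst \o v)).
  apply: eq_on_trans (wDN oD bD H2 (isT : (0 + 1 <= 1)%N)) _.
  by move: div0; apply: ae_areaS => z + Dz => /(_ Dz) /eqP; rewrite /div addr_eq0 => /eqP ->.
have Wy := weak_eq oD (L1D _ H1.1) L1y (L1D _ L10) (L1D _ L10) vy (@eq_on_refl _ _ _ _) W10.
have Wx := weak_eq oD (L1D _ H2N.1) L1x (L1D _ L01N) (L1D _ L10) vx hE W01N.
have [F mF HF] := potential oD bD cD M0 Bx By Wy Wx.
have PF T : crisscross Qh T -> poly_on T k.+1 F.
  move=> cT; have [[p1 Pp1 E1] [p2 Pp2 E2]] := Pv _ cT.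
  have [p [q [r [TE tD]]]] := crisscrossP oD lD mD cT.
  have tT : tri p q r `<=` T by rewrite TE; exact: tri_sub.
  have {}E1 := eq_onS tT E1; have {}E2 := eq_onS tT E2.
  have c1 := Pdeg_Cinf Pp1; have c2 := Pdeg_Cinf Pp2.
  have X1 := wD_poly oD bD (@open_tri _ p q r) tD H1.1 E1 (Cinf_continuous c1) L10 W10
    (Cinf_continuous (Cinf_pdx c1)) (@weak_Cinf_x _ _ _ c1).
  have X2 := wD_poly oD bD (@open_tri _ p q r) tD H2.1 E2 (Cinf_continuous c2) L01 W01
    (Cinf_continuous (Cinf_pdy c2)) (@weak_Cinf_y _ _ _ c2).
  (* The weak divergence vanishes almost everywhere; for the polynomials, continuity makes this hold
     at every point of the open triangle. *)
  have d0 : forall z, tri p q r z -> pdx p1 z + pdy p2 z = 0.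
    apply: (continuous_eq_on (@open_tri _ p q r) (f := fun z => pdx p1 z + pdy p2 z) (g := fun=> 0)).
    - move=> z; apply: cvgD; first exact: (Cinf_continuous (Cinf_pdx c1)).
      exact: (Cinf_continuous (Cinf_pdy c2)).
    - by move=> z; exact: cvg_cst.
    - apply: eq_on_trans (eq_on_sym (eq_onD X1 X2)) _; exact: eq_onS tD div0.
  have Ey := eq_on_trans (eq_on_sym (eq_onS tD vy)) E1.
  have Ex := eq_on_trans (eq_on_sym (eq_onS tD vx)) (eq_onN E2).
  have [P PP FP] := poly_potential (@open_tri _ p q r) (@connected_tri _ p q r) tD Pp1 Pp2 Ey Ex d0 HF mgx mgy.
  by exists P => //; rewrite TE; exact: eq_on_hull.
have [K HK] := mesh_bound mD (fun T cT => tri_bounded cT (PF T cT)).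
have L2F : L2 D F := L2_bounded oD fD mF HK; have L1F := L1D _ L2F.
have WFx : weak_deriv D 1 0 F gx.
  apply: (weak_deriv_local oD L1F L1x) => x Dx; have [r [r0 rD _ W _]] := HF _ Dx.
  by exists r; split; [exact: r0|exact: rD|exact: W].
have WFy : weak_deriv D 0 1 F gy.
  apply: (weak_deriv_local oD L1F L1y) => x Dx; have [r [r0 rD _ _ W]] := HF _ Dx.
  by exists r; split; [exact: r0|exact: rD|exact: W].
have {}WFx := weak_eq oD L1F L1F L1x (L1D _ H2N.1) (@eq_on_refl _ _ _ F) (eq_on_sym vx) WFx.
have {}WFy := weak_eq oD L1F L1F L1y (L1D _ H1.1) (@eq_on_refl _ _ _ F) (eq_on_sym vy) WFy.
(* A derivative of [F] of order at least one is a derivative of order at most one of a component of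
   [v], up to sign; the x-derivative is split off whenever there is one. *)
have HF2 : Hm D 2 F.
  split=> // -[|a] b ab; last first.
    have [L W] := wD_spec H2N (ab : (a + b <= 1)%N).
    by exists (wD D a b (fun z => - (snd \o v) z)); [exact: L|exact: (weak_comp WFx W)].
  case: b ab => [|b] ab; first by exists F; [exact: L2F|exact: weak00].
  have [L W] := wD_spec H1 (ab : (0 + b <= 1)%N).
  by exists (wD D 0 b (fst \o v)); [exact: L|exact: (weak_comp WFy W)].
exists F; first by split.
have := eq_on_pair (wD_eq oD bD H1.1 WFy) (eq_onN (wD_eq oD bD H2N.1 WFx)).
rewrite [X in eq_on _ _ X -> _](_ : _ = v); first exact: eq_on_sym.
by apply/funext => z; rewrite /= opprK -surjective_pairing.
Qed.

Lemma sequence_exact k : D !=set0 -> connected D -> contractible D ->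
  is_exact D (Sigma_h D Qh k.+1) (curl D) (V_h D Qh k) (div D) (W_h D Qh k).
Proof.
move=> D0 cD kD; split.
- by move=> c; exact: eq_on_cst.
- by move=> f [Hf _]; exact: curl_zero cD Hf.
- by move=> v; exact: div_free_potential.
- by move=> w [_].
Qed.

End Exactness.

Theorem lemma3p4 (R : realType) (k : nat) (hk : k = 2%N \/ k = 3%N)
    (Omega : set (R * R)) (Qh : seq (4.-tuple (R * R)))
    (hOmega : lipschitz_polygonal_domain Omega)
    (hQh : quad_mesh Omega Qh) (hc : contractible Omega) :
  let Sigma := Sigma_h Omega Qh k.+1 in
  let V := V_h Omega Qh k in
  let W := W_h Omega Qh k in
  is_complex Omega Sigma (curl Omega) V (div Omega) W /\
  is_exact Omega Sigma (curl Omega) V (div Omega) W.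
Proof.
move=> Sigma V W; have [D0 oD cD bD [_ lD]] := hOmega; split.
  exact: sequence_complex.
exact: sequence_exact.
Qed.
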